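(* Let $\ell\ge 1$, $\ell+2<i\le n-1$, and let $B=B^n_{4,\ell}=\{x=(x',x'')\in\mathbb{R}^n: |x'|^4+|x''|^4\le 1\}$, where $x'\in\mathbb{R}^{n-\ell}$, $x''\in\mathbb{R}^\ell$. Then there is an infinitely smooth $K_\ell$-symmetric convex body $A$ in $\mathbb{R}^n$ such that $$\mathrm{vol}_i(A\cap\xi)\le \mathrm{vol}_i(B\cap\xi)\quad\text{for all } \xi\in G_{n,i},$$ but $\mathrm{vol}_n(A)>\mathrm{vol}_n(B)$.
   Context: Points of $\mathbb{R}^n$ are written $x=(x',x'')$ with $x'\in\mathbb{R}^{n-\ell}=\mathrm{span}(e_1,\dots,e_{n-\ell})$, $x''\in\mathbb{R}^\ell=\mathrm{span}(e_{n-\ell+1},\dots,e_n)$, and $|\cdot|$ is the Euclidean norm. $K_\ell\subset O(n)$ is the group of block-diagonal matrices $\gamma=\mathrm{diag}(\alpha,\beta)$ with $\alpha\in O(n-\ell)$, $\beta\in O(\ell)$. A body $A$ is $K_\ell$-symmetric if $\gamma A=A$ for all $\gamma\in K_\ell$. A convex body is a compact convex set with non-empty interior. An origin-symmetric body $A$ is infinitely smooth if its radial function $\rho_A(\theta)=\sup\{\lambda\ge 0:\lambda\theta\in A\}$ is $C^\infty$ on the unit sphere $S^{n-1}$. $G_{n,i}$ is the Grassmann manifold of $i$-dimensional linear subspaces of $\mathbb{R}^n$; $\mathrm{vol}_i$ is $i$-dimensional volume. *)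

(* Defs.v *)
From HB Require Import structures.
From mathcomp Require Import all_boot all_order all_algebra.
From mathcomp Require Import all_classical all_reals all_analysis.

Set Implicit Arguments.
Unset Strict Implicit.
Unset Printing Implicit Defensive.

Import Order.TTheory GRing.Theory Num.Theory.
Import numFieldNormedType.Exports.

Local Open Scope classical_set_scope.
Local Open Scope ring_scope.

(* [R : realType] is the real line and points of [R^n] are row vectors.  The  *)
(* topology of ['rV[R]_n] in the library comes from the sup norm; it is the   *)
(* Euclidean topology.                                                        *)

Section Euclidean.
Variables (R : realType) (n : nat).
Implicit Types (x y : 'rV[R]_n) (A : set 'rV[R]_n).

Definition dot x y : R := \sum_(j < n) x 0 j * y 0 j.

Definition enorm x : R := Num.sqrt (\sum_(j < n) x 0 j ^+ 2).

Definition unit_sphere : set 'rV[R]_n := [set x | enorm x = 1].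

Definition convex_body A := [/\ compact A, convex_set A & interior A !=set0].

Definition origin_symmetric A := [set - x | x in A] = A.

Definition radial A (theta : 'rV[R]_n) : R :=
  sup [set r : R | 0 <= r /\ A (r *: theta)].

Definition basis_vec (j : 'I_n) : 'rV[R]_n := delta_mx 0 j.

Fixpoint partials (s : seq 'I_n) (f : 'rV[R]_n -> R) : 'rV[R]_n -> R :=
  if s is j :: s' then (fun x => 'D_(basis_vec j) (partials s' f) x) else f.

(* For [U] open, the partial derivatives at points of [U] depend on [f] only  *)
(* through its restriction to [U].                                            *)
Definition Cinfty_on (U : set 'rV[R]_n) (f : 'rV[R]_n -> R) :=
  forall (s : seq 'I_n) x, U x ->
    {for x, continuous (partials s f)} /\
    (forall j, derivable (partials s f) x (basis_vec j)).

(* Smoothness of a function on the embedded submanifold [S^(n-1)]: near each  *)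
(* point of the sphere it is the restriction of a smooth function on an open  *)
(* subset of [R^n].  The values of [f] off the sphere are irrelevant.         *)
Definition Cinfty_sphere (f : 'rV[R]_n -> R) :=
  forall p, unit_sphere p ->
    exists (U : set 'rV[R]_n) (F : 'rV[R]_n -> R),
      [/\ open U, U p, Cinfty_on U F &
          forall x, U x -> unit_sphere x -> F x = f x].

Definition infinitely_smooth A :=
  origin_symmetric A /\ Cinfty_sphere (radial A).

End Euclidean.

Section BlockSymmetry.
Variables (R : realType) (n l : nat).

(* [x = x' + x''], where [x'] and [x''] are regarded as points of the         *)
(* subspaces spanned by the first [n - l] and the last [l] basis vectors.     *)
Definition fst_part (x : 'rV[R]_n) : 'rV[R]_n :=
  \row_j (if (j < n - l)%N then x 0 j else 0).
Definition snd_part (x : 'rV[R]_n) : 'rV[R]_n :=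
  \row_j (if (j < n - l)%N then 0 else x 0 j).

Definition orthogonal_group m : set 'M[R]_m := [set g | g *m g^T = 1%:M].

(* The equation [e], which holds if and only if [l <= n], only serves to view *)
(* a matrix with blocks of sizes [n - l] and [l] as an [n x n] matrix.        *)
Definition K_group : set 'M[R]_n :=
  [set g | exists (e : (n - l + l)%N = n) (alpha : 'M[R]_(n - l))
             (beta : 'M[R]_l),
     [/\ orthogonal_group alpha, orthogonal_group beta &
         g = castmx (e, e) (block_mx alpha 0 0 beta)]].

(* A matrix [g] acts on a column vector [v] by [g *m v], hence on a row       *)
(* vector [x] by [x *m g^T].                                                  *)
Definition K_symmetric (A : set 'rV[R]_n) :=
  forall g, K_group g -> [set x *m g^T | x in A] = A.

Definition B4 : set 'rV[R]_n :=
  [set x | enorm (fst_part x) ^+ 4 + enorm (snd_part x) ^+ 4 <= 1].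

End BlockSymmetry.

Section Lebesgue.
Variable R : realType.
Local Notation T := (measurableTypeR R).
Local Open Scope ereal_scope.

Definition tcons m (p : T * m.-tuple T) : m.+1.-tuple T :=
  [the m.+1.-tuple T of p.1 :: p.2].

(* [m]-dimensional Lebesgue measure as an iterated product measure.           *)
Fixpoint lebesgue_tuple (m : nat) : set (m.-tuple T) -> \bar R :=
  match m with
  | 0%N => \d_([tuple] : 0.-tuple T)
  | m'.+1 => pushforward (@lebesgue_measure R \x @lebesgue_tuple m')
               (@tcons m')
  end.

Lemma measurable_tcons m : measurable_fun setT (@tcons m).
Proof. by apply: measurable_cons. Qed.

Section step.
Variables (m : nat) (mu : {sigma_finite_measure set (m.-tuple T) -> \bar R}).

Let step : set (m.+1.-tuple T) -> \bar R :=
  pushforward (@lebesgue_measure R \x mu) (@tcons m).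

Let step0 : step set0 = 0.
Proof. by rewrite /step /pushforward preimage_set0 measure0. Qed.

Let step_ge0 A : 0 <= step A.
Proof.
exact: (measure_ge0 ((@lebesgue_measure R \x mu) : {measure set _ -> \bar R})).
Qed.

Let step_sigma_additive : semi_sigma_additive step.
Proof.
move=> F mF tF mUF; rewrite /step /pushforward preimage_bigcup.
have mt k : measurable (@tcons m @^-1` F k).
  by rewrite -[X in measurable X]setTI; exact: measurable_tcons.
apply: measure_semi_sigma_additive => //; last exact: bigcupT_measurable.
apply/trivIsetP => /= i j _ _ ij; rewrite -preimage_setI.
by move/trivIsetP : tF => /(_ _ _ _ _ ij) ->//; rewrite preimage_set0.
Qed.

Let step_sigma_finite : sigma_finite setT step.
Proof.
have /sigma_finiteP[F [FT ndF Foo]] := sigma_finiteT (@lebesgue_measure R).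
have /sigma_finiteP[G [GT ndG Goo]] := sigma_finiteT mu.
pose FG k : set (T * m.-tuple T) := F k `*` G k.
pose un (t : m.+1.-tuple T) := (thead t, [tuple of behead t]).
have mun : measurable_fun setT un.
  apply: measurable_fun_pair; last exact: measurable_behead.
  exact: measurable_tnth.
have unK p : un (@tcons m p) = p.
  by case: p => x t; rewrite /un /tcons theadE/=; congr pair; exact: val_inj.
exists (fun k => un @^-1` FG k).
  rewrite -preimage_bigcup; apply/esym; rewrite -subTset => t _.
  have : setT (un t).1 by []. rewrite FT => -[i _ Fi].
  have : setT (un t).2 by []. rewrite GT => -[j _ Gj].
  exists (maxn i j) => //; split.
    by move: (un t).1 Fi; exact/subsetPset/ndF/leq_maxl.
  by move: (un t).2 Gj; exact/subsetPset/ndG/leq_maxr.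
move=> k; have [mF Fk] := Foo k; have [mG Gk] := Goo k.
have mFG : measurable (FG k) by exact: measurableX.
split; first by rewrite -[X in measurable X]setTI; exact: mun.
rewrite /step /pushforward -comp_preimage (_ : un \o @tcons m = id); last first.
  by apply/funext => p /=.
by rewrite preimage_id product_measure1E// lte_mul_pinfty// ge0_fin_numE.
Qed.

Lemma lebesgue_tuple_step :
  exists nu : {sigma_finite_measure set (m.+1.-tuple T) -> \bar R},
    pushforward (@lebesgue_measure R \x mu) (@tcons m) = nu.
Proof.
pose ms := isMeasure.Build _ _ _ step step0 step_ge0 step_sigma_additive.
pose M : {measure set (m.+1.-tuple T) -> \bar R} := HB.pack step ms.
pose sf := Measure_isSigmaFinite.Build _ _ _ M step_sigma_finite.
pose S : {sigma_finite_measure set (m.+1.-tuple T) -> \bar R} :=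
  HB.pack step ms sf.
by exists S.
Qed.

End step.

Let lebesgue_tuple_measure m :
  exists mu : {sigma_finite_measure set (m.-tuple T) -> \bar R},
    @lebesgue_tuple m = mu.
Proof.
elim: m => [|m [mu IH]]; first by exists (\d_([tuple] : 0.-tuple T)).
by rewrite /= IH; exact: lebesgue_tuple_step.
Qed.

Let lebesgue_tuple0 m : @lebesgue_tuple m set0 = 0.
Proof. by have [mu ->] := lebesgue_tuple_measure m; exact: measure0. Qed.

Let lebesgue_tuple_ge0 m A : 0 <= @lebesgue_tuple m A.
Proof. by have [mu ->] := lebesgue_tuple_measure m; exact: measure_ge0. Qed.

Let lebesgue_tuple_sigma_additive m : semi_sigma_additive (@lebesgue_tuple m).
Proof.
have [mu ->] := lebesgue_tuple_measure m.
exact: measure_semi_sigma_additive.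
Qed.

HB.instance Definition _ m := isMeasure.Build _ _ _ (@lebesgue_tuple m)
  (@lebesgue_tuple0 m) (@lebesgue_tuple_ge0 m)
  (@lebesgue_tuple_sigma_additive m).

Let lebesgue_tuple_sigma_finite m : sigma_finite setT (@lebesgue_tuple m).
Proof.
by have [mu ->] := lebesgue_tuple_measure m; exact: sigma_finiteT.
Qed.

HB.instance Definition _ m := Measure_isSigmaFinite.Build _ _ _
  (@lebesgue_tuple m) (@lebesgue_tuple_sigma_finite m).

End Lebesgue.

Section Volume.
Variables (R : realType) (n : nat).
Local Notation V := 'rV[R]_n.

Definition vol (A : set V) : \bar R :=
  @lebesgue_tuple R n [set t | A (\row_j tnth t j)].

Definition orthonormal k (e : k.-tuple V) :=
  forall a b, dot (tnth e a) (tnth e b) = (a == b)%:R.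

Lemma dotC (x y : V) : dot x y = dot y x.
Proof. by apply: eq_bigr => j _; rewrite mulrC. Qed.

Lemma dotDl (x y z : V) : dot (x + y) z = dot x z + dot y z.
Proof. by rewrite -big_split; apply: eq_bigr => j _; rewrite mxE mulrDl. Qed.

Lemma dotZl (c : R) (x z : V) : dot (c *: x) z = c * dot x z.
Proof. by rewrite mulr_sumr; apply: eq_bigr => j _; rewrite mxE mulrA. Qed.

Lemma dot_suml (I : finType) (F : I -> V) (z : V) :
  dot (\sum_i F i) z = \sum_i dot (F i) z.
Proof.
apply: (big_morph (fun x => dot x z) (fun x y => dotDl x y z)).
by rewrite -(scale0r 0) dotZl mul0r.
Qed.

Lemma dot_gt0 (x : V) : x != 0 -> 0 < dot x x.
Proof.
move=> x0; have dxx : dot x x = \sum_j x 0 j ^+ 2.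
  by apply: eq_bigr => j _; rewrite expr2.
rewrite lt0r dxx sumr_ge0 ?andbT; last by move=> j _; exact: sqr_ge0.
apply: contra x0 => /eqP/psumr_eq0P xj.
apply/eqP/rowP => j; rewrite mxE; apply/eqP; rewrite -sqrf_eq0.
by rewrite xj// => k _; exact: sqr_ge0.
Qed.

Lemma orthonormal_free k (e : k.-tuple V) : orthonormal e -> free e.
Proof.
move=> oe; apply/freeP => c ce0 a.
have eE (b : 'I_k) : e`_b = tnth e b by rewrite (tnth_nth 0).
have : dot (\sum_(i < k) c i *: e`_i) (tnth e a) = 0.
  by rewrite ce0 -(scale0r 0) dotZl mul0r.
rewrite dot_suml (bigD1 a)//= big1 ?addr0 => [|b ba].
  by rewrite dotZl !eE oe eqxx mulr1.
by rewrite dotZl !eE oe (negbTE ba) mulr0.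
Qed.

Lemma orthonormal_extend (U : {vspace V}) k : (k <= \dim U)%N ->
  exists e : k.-tuple V, orthonormal e /\ {subset e <= U}.
Proof.
elim: k => [_|k IH kU]; first by exists [tuple]; split => // -[].
have [e [oe eU]] := IH (ltnW kU).
have /subvPn[u uU ue] : ~~ (U <= <<e>>)%VS.
  apply: contraL kU => /dimvS/leq_trans; rewrite -leqNgt; apply.
  by rewrite (leq_trans (dim_span e))// size_tuple.
pose w := u - \sum_(a < k) dot u (tnth e a) *: tnth e a.
have we b : dot w (tnth e b) = 0.
  rewrite /w -scaleN1r dotDl dotZl dot_suml (bigD1 b)//= big1 ?addr0.
    by rewrite dotZl oe eqxx mulr1 mulN1r subrr.
  by move=> a ab; rewrite dotZl oe (negbTE ab) mulr0.
have wU : w \in U.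
  by rewrite rpredB// rpred_sum// => a _; rewrite rpredZ// eU// mem_tnth.
have w0 : w != 0.
  apply: contra ue; rewrite subr_eq0 => /eqP ->.
  by rewrite rpred_sum// => a _; rewrite rpredZ// memv_span// mem_tnth.
have dw := dot_gt0 w0.
pose c := (Num.sqrt (dot w w))^-1.
exists [tuple of c *: w :: e]; split; last first.
  by move=> x; rewrite inE => /orP[/eqP ->|/eU//]; rewrite rpredZ.
have ce b : dot (c *: w) (tnth e b) = 0 by rewrite dotZl we mulr0.
have c1 : dot (c *: w) (c *: w) = 1.
  rewrite dotZl dotC dotZl mulrA -invfM -expr2 sqr_sqrtr ?ltW//.
  by rewrite mulVf// gt_eqF.
set e' := [tuple of _].
have t0 : tnth e' ord0 = c *: w by [].
have tS a : tnth e' (lift ord0 a) = tnth e a by rewrite !(tnth_nth 0).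
move=> a b; case: (unliftP ord0 a) => [a' ->|->];
  case: (unliftP ord0 b) => [b' ->|->]; rewrite ?t0 ?tS.
- by rewrite oe (inj_eq lift_inj).
- by rewrite dotC ce.
- by rewrite ce.
- by rewrite c1 eqxx.
Qed.

Lemma orthonormal_basis_exists (U : {vspace V}) :
  exists e : (\dim U).-tuple V, basis_of U e /\ orthonormal e.
Proof.
have [e [oe eU]] := orthonormal_extend (leqnn (\dim U)).
exists e; split => //; rewrite basisEfree orthonormal_free// size_tuple leqnn.
by rewrite andbT/=; apply/span_subvP.
Qed.

Definition onb (U : {vspace V}) : (\dim U).-tuple V :=
  sval (cid (orthonormal_basis_exists U)).

(* Volume, of dimension [\dim U], of a subset of the subspace [U]: Lebesgue   *)
(* measure in the coordinates of an orthonormal basis of [U].  It does not    *)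
(* depend on the basis since Lebesgue measure is invariant under [O(\dim U)]. *)
Definition vol_in (U : {vspace V}) (A : set V) : \bar R :=
  @lebesgue_tuple R (\dim U)
    [set t | A (\sum_(a < \dim U) tnth t a *: tnth (onb U) a)].

End Volume.

Arguments B4 : clear implicits.

(* Main.v *)
Require Import Defs.
From HB Require Import structures.
From mathcomp Require Import all_boot all_order all_algebra.
From mathcomp Require Import all_classical all_reals all_analysis.
From mathcomp Require Import measurable_realfun.
From mathcomp Require Import ring lra.

Set Implicit Arguments.
Unset Strict Implicit.
Unset Printing Implicit Defensive.

Import Order.TTheory GRing.Theory Num.Theory.
Import numFieldNormedType.Exports.

Local Open Scope classical_set_scope.
Local Open Scope ring_scope.

(* Put [X = |x'|^2], [Y = |x''|^2], and let [B_tau] be the body               *)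
(* [X^2 + Y^2 / tau^2 <= 1], so [B = B_1]. The body [A] is obtained by adding *)
(* to [rho_B^i] a small multiple of a combination of the [rho_(B_tau)^i] for  *)
(* [tau = 1], [t = g + (1 - g) g] and [g]. The coefficients contain the       *)
(* factor [tau^(-l/2)], which undoes the shrinking of [x''].                  *)
(*                                                                            *)
(* Sections get smaller: since [i >= l + 2], a section of [B_tau] fibres into *)
(* discs in a plane orthogonal to [e_(n-l+1), ..., e_n]; after rescaling      *)
(* [x''] the area of each disc is the positive part of an affine function of  *)
(* [tau], so [tau^(-l/2) vol_i (B_tau /\ xi)] is convex in [tau].             *)
(*                                                                            *)
(* The volume gets larger: by Young's inequality [vol A > vol B] follows from *)
(* the same combination of the integrals                                      *)
(* [K tau = \int rho_(B_1)^(n-i) rho_(B_tau)^i tau^(-l/2)] being positive.    *)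
(* [K] is decreasing with [K 0 - K tau = O (tau^(5/4))], so it is too flat    *)
(* at [0] to be convex, and [K t > g K 1 + (1 - g) K g] for small [g].        *)
(*                                                                            *)
(* Convexity survives a small perturbation because the radial functional of   *)
(* [B] is uniformly convex enough in the variables [(X, Y)] to dominate the   *)
(* second derivative of the added terms.                                      *)

(** * Lebesgue measure on tuples *)

(** Everything is expressed through powers of radial functions. In dimension m, if f is homogeneous
    of degree -m, the volume of {f >= 1} is m ln 2 times less than the integral of f over the shell
    1 <= p < 2, for any gauge p of degree 1 vanishing only inside a hyperplane ([polar_integral]).
    So vol_i of a section is linear in the i-th power of the radial function, and a combination of
    such powers, negative coefficients included, can be integrated term by term.

    Sections. Put F tau = tau^(-l/2) vol_i (B_tau /\ xi). Passing from B to A changes the section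
    volume by eta (F t - g F 1 - (1 - g) F g), with t = [tmid g], so convexity of F suffices.
    [adapted_basis] and [vol_in_change_basis] provide coordinates of xi in which F tau is the
    measure of a family of discs ([V_disc_bundle]). The area of a disc is the positive part of an
    affine function of tau, whence [disc_bundle_convex], [V_convex] and [adapted_section_le].

    Volume. The same second difference, taken for K tau = tau^(-l/2) \int rho_B^(n-i) rho_(B_tau)^i,
    must be positive. Rescaling x'' moves tau into the factor rho_B^(n-i) ([kernel_integral_scale]),
    so K extends to tau = 0 and is largest there. Moreover K 1 < K 0 ([kernel_integral_lt]), while K
    0 - K tau = O(tau^(5/4)) ([kernel_integral_gap_le]). A convex function with K 1 < K 0 would have
    to drop at least linearly on one of these chords; [kernel_gap] finds a g that exhibits the
    failure. It follows that \int rho_A^i rho_B^(n-i) > \int rho_B^n ([integral_product_gt]), and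
    Young's inequality turns this into vol A > vol B ([integral_powR_gt], [lebesgue_star_gt]).

    Convexity. In the variables X, Y the body is {N <= 1}, where N = G^(-1/(2q)) is homogeneous of
    degree 1. For small eta the second derivative of N along segments is nonnegative
    ([discriminant_ge0]), so N has supporting functionals with nonnegative coefficients
    ([quartic_comb_support]), and A is an intersection of the convex sets a |x'|^2 + b |x''|^2 <= 1
    ([comb_bodyE]). Smoothness is read off from the closed form of the radial function
    ([comb_body_radial]). The final proof fixes g first and then takes eta small in terms of g. *)

Section Affine.
Variable R : realType.
Local Notation T := (measurableTypeR R).
Local Notation leb := (@lebesgue_measure R).
Local Notation L m := (@lebesgue_tuple R m).
Local Open Scope ereal_scope.

Lemma measurable_preimageT d1 d2 (X : measurableType d1) (Y : measurableType d2)
    (f : X -> Y) (A : set Y) :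
  measurable_fun setT f -> measurable A -> measurable (f @^-1` A).
Proof. by move=> mf mA; rewrite -[X in measurable X]setTI; exact: mf. Qed.

Definition image_measure d1 d2 (X : measurableType d1) (Y : measurableType d2)
    (m : {measure set X -> \bar R}) (f : X -> Y) (mf : measurable_fun setT f) :
    {measure set Y -> \bar R} :=
  measure_function_pushforward__canonical__measure_function_Measure m mf.

(** The hypothesis on [phi] says that its image measure is [c] times [m]; the rest is change of
    variables for pushforwards. *)
Lemma ge0_integral_image_scale d (X : measurableType d)
    (m : {measure set X -> \bar R}) (phi : X -> X) (c : R) (f : X -> \bar R) :
  measurable_fun setT phi -> (0 <= c)%R ->
  (forall A, measurable A -> m (phi @^-1` A) = c%:E * m A) ->
  measurable_fun setT f -> (forall x, 0 <= f x) ->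
  \int[m]_x f (phi x) = c%:E * \int[m]_x f x.
Proof.
move=> mphi c0 mc mf f0.
transitivity (\int[image_measure m mphi]_x f x).
  by rewrite [RHS]ge0_integral_pushforward.
rewrite (eq_measure_integral (mscale (NngNum c0) m)).
  exact: (ge0_integral_mscale m measurableT (NngNum c0) mf).
by move=> A mA _; exact: mc.
Qed.

Lemma measurable_fun_affine (d v : R) :
  measurable_fun [set: T] (fun s : T => d * s + v : T)%R.
Proof.
apply: measurable_funD => //; apply: measurable_funM => //.
Qed.

(** By uniqueness of Lebesgue measure it is enough to compare both sides on half-open intervals. *)
Lemma lebesgue_measure_affine (d v : R) (A : set T) : (0 < d)%R ->
  measurable A -> leb [set s | A (d * s + v)%R] = (d^-1)%:E * leb A.
Proof.
move=> d0 mA.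
pose phi := (fun s : T => d * s + v : T)%R.
have dge0 : (0 <= d)%R by exact: ltW.
pose mu : {measure set T -> \bar R} := mscale (NngNum dge0) (image_measure leb (measurable_fun_affine d v)).
suff -> : leb A = mu A.
  rewrite /mu /mscale/= /pushforward muleA -EFinM mulVf ?gt_eqF// mul1e.
  by [].
apply: lebesgue_measure_unique => // X [[a b] _ <-] /=.
rewrite /mu /mscale /= /pushforward /=.
have -> : phi @^-1` `]a, b]%classic =
    `]((a - v) / d)%R, ((b - v) / d)%R]%classic.
  apply/seteqP; split => s /=; rewrite !in_itv/= ltr_pdivrMr// ler_pdivlMr//
    ltrBlDr lerBrDr ![(s * d)%R]mulrC //.
rewrite !lebesgue_measure_itv /= !lte_fin ltr_pM2r ?invr_gt0// ltrD2r.
case: ifPn => ab; last by rewrite mule0.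
rewrite -!EFinB -EFinM; congr EFin.
by field; rewrite gt_eqF.
Qed.

Lemma lebesgue_tupleS m (A : set (m.+1.-tuple T)) : measurable A ->
  L m.+1 A = \int[leb]_s L m [set t | A (tcons (s, t))].
Proof.
move=> mA; rewrite /= /pushforward/=.
rewrite /product_measure1; apply: eq_integral => s _ /=; congr lebesgue_tuple.
by apply/seteqP; split => t /=; rewrite /xsection /= inE.
Qed.

Lemma ge0_integral_tupleS m (f : m.+1.-tuple T -> \bar R) :
  measurable_fun setT f -> (forall t, 0 <= f t) ->
  \int[L m.+1]_t f t = \int[leb]_s \int[L m]_t f (tcons (s, t)).
Proof.
move=> mf f0.
have mt := @measurable_tcons R m.
rewrite [LHS](_ : _ = \int[pushforward (leb \x L m) (@tcons R m)]_t f t)//.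
rewrite ge0_integral_pushforward// preimage_setT.
rewrite fubini_tonelli1//; first exact: (measurableT_comp mf mt).
by move=> x; exact: f0.
Qed.

Lemma ge0_integral_tupleS' m (f : m.+1.-tuple T -> \bar R) :
  measurable_fun setT f -> (forall t, 0 <= f t) ->
  \int[L m.+1]_t f t = \int[L m]_t \int[leb]_s f (tcons (s, t)).
Proof.
move=> mf f0; rewrite ge0_integral_tupleS//.
rewrite (fubini_tonelli (m1 := leb) (m2 := L m) (fun p => f (tcons p)))//.
exact: (measurableT_comp mf (@measurable_tcons R m)).
Qed.

Lemma lebesgue_tupleS' m (A : set (m.+1.-tuple T)) : measurable A ->
  L m.+1 A = \int[L m]_t leb [set s | A (tcons (s, t))].
Proof.
move=> mA; have mt := @measurable_tcons R m.
rewrite -[in LHS](setIT A) -integral_indic// ge0_integral_tupleS'//; last first.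
  by apply/measurable_EFinP; exact: measurable_indic.
apply: eq_integral => t _.
rewrite -[X in leb X]setIT -integral_indic//.
rewrite [X in measurable X](_ : _ = (fun s => tcons (s, t)) @^-1` A)//.
apply: measurable_preimageT => //; apply: measurableT_comp => //.
Qed.

Definition taffine m (d v : 'I_m -> R) (t : m.-tuple T) : m.-tuple T :=
  [tuple (d j * tnth t j + v j)%R | j < m].

Lemma measurable_taffine m (d v : 'I_m -> R) :
  measurable_fun setT (taffine d v).
Proof.
apply/measurable_fun_tnthP => j.
rewrite (_ : _ \o _ = fun t => d j * tnth t j + v j)%R; last first.
  by apply/funext => t /=; rewrite tnth_mktuple.
apply: measurable_funD => //; apply: measurable_funM => //.
exact: measurable_tnth.
Qed.

Lemma taffineS m (d v : 'I_m.+1 -> R) s (t : m.-tuple T) :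
  taffine d v (tcons (s, t)) =
  tcons (d ord0 * s + v ord0, taffine (d \o lift ord0) (v \o lift ord0) t)%R.
Proof.
apply: eq_from_tnth => j; rewrite tnth_mktuple.
case: (unliftP ord0 j) => [k ->|->]; last by rewrite !(tnth_nth 0%R).
by rewrite /tcons !tnthS /= tnth_mktuple.
Qed.

(** The map acts separately on head and tail ([taffineS]), so Fubini and induction reduce to
    dimension one. *)
Lemma lebesgue_tuple_affine m (d v : 'I_m -> R) (A : set (m.-tuple T)) :
  (forall j, 0 < d j)%R -> measurable A ->
  L m (taffine d v @^-1` A) = (\prod_j (d j)^-1)%:E * L m A.
Proof.
elim: m d v A => [|m IH] d v A d0 mA.
  rewrite big_ord0 mul1e; congr (L 0); apply/seteqP.
  by split => t /=; rewrite (tuple0 t) (tuple0 (taffine _ _ _)).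
have mB : measurable (taffine d v @^-1` A).
  by apply: measurable_preimageT => //; exact: measurable_taffine.
rewrite lebesgue_tupleS//.
have mA' s : measurable [set t | A (tcons (s, t))].
  apply: (measurable_preimageT (f := fun t => tcons (s, t))) => //.
  by apply: measurableT_comp => //; exact: measurable_tcons.
under eq_integral => s _.
  rewrite (_ : [set t | _] = taffine (d \o lift ord0) (v \o lift ord0) @^-1`
     [set t | A (tcons (d ord0 * s + v ord0, t)%R)]); last first.
    by apply/seteqP; split => t /=; rewrite taffineS.
  rewrite IH//; last by move=> j; exact: d0.
  over.
have mf : measurable_fun setT (fun s : T => L m [set t | A (tcons (s, t))]).
  rewrite (_ : (fun s => _) = L m \o xsection (@tcons R m @^-1` A)).
    apply: measurable_fun_xsection.
    by apply: measurable_preimageT => //; exact: measurable_tcons.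
  by apply/funext => s /=; congr (L m); apply/seteqP; split => t /=;
    rewrite /xsection /= inE.
have mf' : measurable_fun setT (fun s : T =>
    L m [set t | A (tcons (d ord0 * s + v ord0, t))])%R.
  rewrite (_ : (fun s => _) = (fun s : T => L m [set t | A (tcons (s, t))]) \o
    (fun s => d ord0 * s + v ord0)%R)//.
  by apply: measurableT_comp => //; exact: measurable_fun_affine.
rewrite ge0_integralZl//; last first.
  by rewrite lee_fin prodr_ge0// => j _; rewrite invr_ge0; exact/ltW/d0.
rewrite lebesgue_tupleS// big_ord_recl [X in _ = X%:E * _]mulrC EFinM -muleA; congr (_ * _).
rewrite (@ge0_integral_image_scale _ _ leb (fun s => d ord0 * s + v ord0)%R
  (d ord0)^-1 (fun s => L m [set t | A (tcons (s, t))]))//.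
- exact: measurable_fun_affine.
- by rewrite invr_ge0 ltW.
- by move=> B mB'; exact: lebesgue_measure_affine.
Qed.

Lemma ge0_integral_tuple_affine m (d v : 'I_m -> R) (f : m.-tuple T -> \bar R) :
  (forall j, 0 < d j)%R -> measurable_fun setT f -> (forall t, 0 <= f t) ->
  \int[L m]_t f (taffine d v t) = (\prod_j (d j)^-1)%:E * \int[L m]_t f t.
Proof.
move=> d0 mf f0.
have d'0 : (0 <= \prod_j (d j)^-1)%R.
  by rewrite prodr_ge0// => j _; rewrite invr_ge0; exact/ltW/d0.
apply: ge0_integral_image_scale => //; first exact: measurable_taffine.
by move=> A mA; exact: lebesgue_tuple_affine.
Qed.

End Affine.

(** * Invertible linear changes of variables *)

Section LinearChange.
Variable R : realType.
Local Notation T := (measurableTypeR R).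
Local Notation leb := (@lebesgue_measure R).
Local Notation L m := (@lebesgue_tuple R m).
Local Open Scope ereal_scope.

Lemma integral_indicT d (X : measurableType d) (mu : {measure set X -> \bar R})
    (A : set X) : measurable A -> \int[mu]_x (\1_A x)%:E = mu A.
Proof. by move=> mA; rewrite integral_indic// setIT. Qed.

Definition tcube m (a b : R) : set (m.-tuple T) :=
  [set t | forall j, (a <= tnth t j <= b)%R].

Lemma tcubeS m (a b : R) :
  (@tcons R m) @^-1` tcube a b = `[a, b]%classic `*` tcube a b.
Proof.
apply/seteqP; split => -[s t]/= h.
  split => [|j]; first by have := h ord0; rewrite /tcons (tnth_nth 0%R)/= in_itv.
  by have := h (lift ord0 j); rewrite /tcons tnthS.
move=> j; case: (unliftP ord0 j) => [k ->|->].
  by rewrite /tcons tnthS; exact: h.2.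
by have := h.1; rewrite in_itv/= /tcons (tnth_nth 0%R).
Qed.

Lemma lebesgue_measure_itvcc (a b : R) : (a <= b)%R ->
  leb `[a, b]%classic = (b - a)%:E.
Proof.
move=> ab; rewrite lebesgue_measure_itv/= lte_fin; case: ltP => // ba.
have /eqP -> : a == b by rewrite eq_le ab ba.
by rewrite subrr.
Qed.

Lemma measurable_tcube m (a b : R) : measurable (tcube a b : set (m.-tuple T)).
Proof.
rewrite (_ : tcube a b =
    \bigcap_(j in [set: 'I_m]) ((fun t => tnth t j) @^-1` `[a, b]%classic)).
  apply: fin_bigcap_measurable => // j _.
  by apply: measurable_preimageT => //; exact: measurable_tnth.
apply/seteqP; split => t /= h j; last by have := h j I; rewrite /= in_itv.
by move=> _; rewrite /= in_itv; exact: h.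
Qed.

Lemma lebesgue_tuple_cube m (a b : R) : (a <= b)%R ->
  L m (tcube a b) = ((b - a) ^+ m)%:E.
Proof.
move=> ab; elim: m => [|m IH].
  by rewrite expr0 /= diracE mem_set// => -[].
rewrite /= /pushforward tcubeS product_measure1E//; last exact: measurable_tcube.
rewrite [X in _ * X]IH exprS EFinM; congr (_ * _).
exact: lebesgue_measure_itvcc.
Qed.

Lemma lebesgue_tuple_hyperplane m : L m.+1 [set t | thead t = 0%R] = 0.
Proof.
rewrite /= /pushforward (_ : _ @^-1` _ = [set 0%R] `*` setT); last first.
  apply/seteqP; split => -[s t]/=; first by rewrite theadE.
  by move=> [->]; rewrite theadE.
rewrite product_measure1E// [X in X * _]lebesgue_measure_set1.
by rewrite mul0e.
Qed.

Definition tadd m (s t : m.-tuple T) : m.-tuple T :=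
  [tuple (tnth t j + tnth s j)%R | j < m].

Lemma tnth_tadd m (s t : m.-tuple T) j :
  tnth (tadd s t) j = (tnth t j + tnth s j)%R.
Proof. by rewrite tnth_mktuple. Qed.

Lemma taddE m (s : m.-tuple T) : tadd s = taffine (fun=> 1%R) (tnth s).
Proof.
by apply/funext => t; apply: eq_from_tnth => j; rewrite !tnth_mktuple mul1r.
Qed.

Lemma lebesgue_tuple_tadd m (s : m.-tuple T) A : measurable A ->
  L m (tadd s @^-1` A) = L m A.
Proof.
move=> mA; rewrite taddE lebesgue_tuple_affine// big1 ?mul1e// => j _.
by rewrite invr1.
Qed.

Lemma ge0_integral_tadd m (s : m.-tuple T) (f : m.-tuple T -> \bar R) :
  measurable_fun setT f -> (forall t, 0 <= f t) ->
  \int[L m]_t f (tadd s t) = \int[L m]_t f t.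
Proof.
move=> mf f0; rewrite taddE ge0_integral_tuple_affine// big1 ?mul1e// => j _.
by rewrite invr1.
Qed.

Definition tmulmx m (M : 'M[R]_m) (t : m.-tuple T) : m.-tuple T :=
  [tuple (\sum_a tnth t a * M a b)%R | b < m].

Lemma measurable_tmulmx m (M : 'M[R]_m) : measurable_fun setT (tmulmx M).
Proof.
apply/measurable_fun_tnthP => j.
rewrite (_ : _ \o _ = fun t => \sum_a tnth t a * M a j)%R; last first.
  by apply/funext => t /=; rewrite tnth_mktuple.
apply: measurable_sum => a; apply: measurable_funM => //.
exact: measurable_tnth.
Qed.

Lemma tmulmx_add m (M : 'M[R]_m) s t :
  tmulmx M (tadd s t) = tadd (tmulmx M s) (tmulmx M t).
Proof.
apply: eq_from_tnth => j; rewrite !tnth_mktuple -big_split/=.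
by apply: eq_bigr => a _; rewrite tnth_mktuple mulrDl.
Qed.

Lemma tmulmxM m (M N : 'M[R]_m) t : tmulmx N (tmulmx M t) = tmulmx (M *m N) t.
Proof.
apply: eq_from_tnth => j; rewrite !tnth_mktuple.
under eq_bigr do rewrite tnth_mktuple mulr_suml.
rewrite exchange_big; apply: eq_bigr => a _; rewrite mxE mulr_sumr.
by apply: eq_bigr => b _; rewrite mulrA.
Qed.

Lemma tmulmx_scalar m (c : R) (t : m.-tuple T) j :
  tnth (tmulmx c%:M t) j = (c * tnth t j)%R.
Proof.
rewrite !tnth_mktuple (bigD1 j)//= mxE eqxx mulr1n big1 ?addr0 1?mulrC// => a aj.
by rewrite mxE (negbTE aj) mulr0.
Qed.

(* With [Q] the unit cube and [M] the linear map, both sides equal the double *)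
(* integral of [1_Q(M x) * 1_A(M x + y)].                                     *)
Lemma lebesgue_tuple_linear m (M : 'M[R]_m) : M \in unitmx ->
  exists2 c : \bar R, 0 <= c &
    forall A, measurable A -> L m (tmulmx M @^-1` A) = c * L m A.
Proof.
move=> uM; pose Q := tcube 0 1 : set (m.-tuple T).
have mQ : measurable Q by exact: measurable_tcube.
have mM := measurable_tmulmx M.
have mMQ : measurable (tmulmx M @^-1` Q) by exact: measurable_preimageT.
(* The factor is the volume of the preimage of the unit cube, which avoids determinants. *)
exists (L m (tmulmx M @^-1` Q)) => // A mA.
have mQ1 : measurable_fun setT (\1_Q : _ -> R) by exact: measurable_indic.
have mA1 : measurable_fun setT (\1_A : _ -> R) by exact: measurable_indic.
have mMfst : measurable_fun setT
    (fun p : m.-tuple T * m.-tuple T => tmulmx M p.1).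
  exact: (measurableT_comp mM measurable_fst).
have msub d (X : measurableType d) (f g : X -> m.-tuple T) :
    measurable_fun setT f -> measurable_fun setT g ->
    measurable_fun setT (fun x => tadd (f x) (g x)).
  move=> mf mg; apply/measurable_fun_tnthP => j.
  rewrite (_ : _ \o _ = fun p => tnth (g p) j + tnth (f p) j)%R; last first.
    by apply/funext => t /=; rewrite tnth_mktuple.
  by apply: measurable_funD; apply: (measurableT_comp (measurable_tnth _)).
have mMA : measurable (tmulmx M @^-1` A) by exact: measurable_preimageT.
pose h (p : m.-tuple T * m.-tuple T) : \bar R :=
  (\1_Q (tmulmx M p.1) * \1_A (tadd (tmulmx M p.1) p.2))%:E.
have mh : measurable_fun setT h.
  apply/measurable_EFinP; apply: measurable_funM.
    exact: (measurableT_comp mQ1 mMfst).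
  exact: (measurableT_comp mA1 (msub _ _ _ _ mMfst measurable_snd)).
have h0 p : 0 <= h p by rewrite lee_fin mulr_ge0.
transitivity (\int[L m]_y \int[L m]_x h (x, y)).
  (* [k] is [h] after translating [x] by [- M^-1 y], which turns [M x + y] into [M x]; negation of a
     tuple is written [tmulmx (-1)%:M]. *)
  pose k (p : m.-tuple T * m.-tuple T) : \bar R :=
    (\1_Q (tadd (tmulmx (-1)%:M p.2) (tmulmx M p.1)) * \1_A (tmulmx M p.1))%:E.
  have hk y : \int[L m]_x h (x, y) = \int[L m]_x k (x, y).
    rewrite -[LHS](ge0_integral_tadd (tmulmx (invmx M) (tmulmx (-1)%:M y))).
    - apply: eq_integral => x _; rewrite /h /k/= tmulmx_add tmulmxM mulVmx//.
      have -> z : tmulmx (1%:M : 'M[R]_m) z = z.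
        by apply: eq_from_tnth => j; rewrite tmulmx_scalar mul1r.
      congr (_ * \1_A _)%:E; apply: eq_from_tnth => j.
      by rewrite !tnth_tadd tmulmx_scalar mulN1r addrCA subrr addr0.
    - by apply: (measurableT_comp mh).
    - by move=> t; exact: h0.
  under [RHS]eq_integral do rewrite hk.
  rewrite -(fubini_tonelli (m1 := L m) (m2 := L m) k); last 2 first.
    - apply/measurable_EFinP; apply: measurable_funM.
        apply: (measurableT_comp mQ1); apply: msub mMfst.
        exact: (measurableT_comp (measurable_tmulmx _) measurable_snd).
      exact: (measurableT_comp mA1 mMfst).
    - by move=> x; rewrite lee_fin mulr_ge0.
  rewrite -[X in L m X]setIT -integral_indic//; apply: eq_integral => x _.
  rewrite /k/= -[LHS]mul1e.
  have -> : \1_(tmulmx M @^-1` A) x = \1_A (tmulmx M x) :> R by [].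
  under eq_integral do rewrite EFinM muleC.
  rewrite ge0_integralZl//; last first.
    apply/measurable_EFinP; apply: (measurableT_comp mQ1).
    by apply: msub => //; exact: measurable_tmulmx.
  rewrite muleC; congr (_ * _).
  pose w := tmulmx M x.
  pose v := [tuple (1 - tnth w j)%R | j < m].
  have vE j : tnth v j = (1 - tnth w j)%R by rewrite tnth_mktuple.
  transitivity (\int[L m]_y (\1_(tadd v @^-1` Q) y)%:E).
    rewrite integral_indicT; last first.
      by apply: measurable_preimageT => //; rewrite taddE; exact: measurable_taffine.
    by rewrite /= lebesgue_tuple_tadd// lebesgue_tuple_cube// subr0 expr1n.
  apply: eq_integral => y _; congr EFin; rewrite !indicE; congr (nat_of_bool _)%:R.
  apply/idP/idP; rewrite !inE /= => hy j; have := hy j;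
    rewrite !tnth_tadd tmulmx_scalar vE; lra.
rewrite -(fubini_tonelli (m1 := L m) (m2 := L m) h)//.
rewrite -[X in L m X * _]setIT -integral_indic// -ge0_integralZr//; last first.
  by apply/measurable_EFinP; exact: measurable_indic.
apply: eq_integral => x _; rewrite /h/=.
under eq_integral do rewrite EFinM.
rewrite ge0_integralZl//; last first.
  by apply/measurable_EFinP; apply: (measurableT_comp mA1); exact: msub.
congr (_ * _); transitivity (\int[L m]_y (\1_(tadd (tmulmx M x) @^-1` A) y)%:E).
  by [].
rewrite integral_indicT; first exact: lebesgue_tuple_tadd.
by apply: measurable_preimageT => //; exact: msub.
Qed.

End LinearChange.

(** * Integration in polar form *)

Section Polar.
Variable R : realType.
Local Notation T := (measurableTypeR R).
Local Notation leb := (@lebesgue_measure R).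
Local Notation L m := (@lebesgue_tuple R m).
Local Open Scope ereal_scope.

Lemma measurable_set_ler d (X : measurableType d) (f g : X -> R) :
  measurable_fun setT f -> measurable_fun setT g ->
  measurable [set x | f x <= g x]%R.
Proof.
move=> mf mg; rewrite (_ : [set x | _] =
  (fun x => f x <= g x)%R @^-1` [set true]); last by apply/seteqP; split.
by apply: measurable_preimageT => //; exact: measurable_fun_ler.
Qed.

Lemma measurable_set_ltr d (X : measurableType d) (f g : X -> R) :
  measurable_fun setT f -> measurable_fun setT g ->
  measurable [set x | f x < g x]%R.
Proof.
move=> mf mg; rewrite (_ : [set x | _] =
  (fun x => f x < g x)%R @^-1` [set true]); last by apply/seteqP; split.
by apply: measurable_preimageT => //; exact: measurable_fun_ltr.
Qed.

Lemma integral_inv_itv (a b : R) : (0 < a)%R -> (a < b)%R ->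
  \int[leb]_(s in `]a, b]%classic) (s^-1)%:E = (ln b - ln a)%:E.
Proof.
move=> a0 ab.
have pos s : s \in `[a, b] -> (0 < s)%R.
  by rewrite in_itv/= => /andP[+ _]; exact: lt_le_trans.
have cf : {within `[a, b]%classic, continuous (fun s : R => s^-1)%R}.
  apply: continuous_in_subspaceT => s; rewrite inE/= => /pos s0.
  by apply: cvgV => //; rewrite gt_eqF.
rewrite integral_itv_obnd_cbnd; last first.
  apply/measurable_EFinP; apply: measurable_funS (subspace_continuous_measurable_fun _ cf) => //.
  exact: subset_itv_oc_cc.
rewrite EFinB; apply: continuous_FTC2 => //.
  split=> [s||].
  - by move=> /subset_itv_oo_cc/pos s0; apply: ex_derive; exact: is_derive1_ln.
  - exact/cvg_at_right_filter/continuous_ln.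
  - by apply/cvg_at_left_filter/continuous_ln/(lt_trans a0).
move=> s /subset_itv_oo_cc/pos s0; rewrite derive1E.
by rewrite (@derive_val _ _ _ _ _ _ _ (is_derive1_ln s0)).
Qed.

Definition tscale m (c : R) (t : m.-tuple T) : m.-tuple T :=
  [tuple (c * tnth t j)%R | j < m].

Lemma tscaleE m c : @tscale m c = taffine (fun=> c) (fun=> 0%R).
Proof.
by apply/funext => t; apply: eq_from_tnth => j; rewrite !tnth_mktuple addr0.
Qed.

Lemma lebesgue_tuple_scale m (c : R) A : (0 < c)%R -> measurable A ->
  L m (tscale c @^-1` A) = (c ^- m)%:E * L m A.
Proof.
move=> c0 mA; rewrite tscaleE lebesgue_tuple_affine//.
by rewrite prodr_const card_ord exprVn.
Qed.

Section polar_integral.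
Variables (m : nat) (p f : m.+1.-tuple T -> R).
Hypotheses (mp : measurable_fun setT p) (mf : measurable_fun setT f).
Hypotheses (p0 : forall t, (0 <= p t)%R) (f0 : forall t, (0 <= f t)%R).
Hypothesis pZ : forall c t, (0 < c)%R -> p (tscale c t) = (c * p t)%R.
Hypothesis fZ : forall c t, (0 < c)%R -> (f (tscale c t) * c ^+ m.+1 = f t)%R.
Hypothesis p_eq0 : forall t, p t = 0%R -> thead t = 0%R.

(* Integrate [1 / |s|] over the pairs [(u, s)] with [1 <= f u] and            *)
(* [s <= p u ^ (m + 1) < 2 ^ (m + 1) s]; the substitution                     *)
(* [u = s ^ (1 / (m + 1)) t] turns this into the area below [f] over the      *)
(* shell [1 <= p < 2].                                                        *)
Lemma polar_integral :
  \int[L m.+1]_(t in [set t | 1 <= p t < 2]%R) (f t)%:E =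
  (ln 2 *+ m.+1)%:E * L m.+1 [set t | 1 <= f t]%R.
Proof.
pose P := (m.+1.-tuple T * T)%type.
have mfst d (X : measurableType d) (g : m.+1.-tuple T -> X) :
    measurable_fun setT g -> measurable_fun setT (fun z : P => g z.1).
  by move=> mg; exact: (measurableT_comp mg measurable_fst).
have m2 : measurable_fun setT (fun z : P => z.2 : R) by exact: measurable_snd.
pose E : set P := [set z | 0 < z.2]%R `&`
  ([set z | 1 <= p z.1]%R `&` [set z | p z.1 < 2]%R `&` [set z | z.2 <= f z.1]%R).
pose E' : set P := [set z | 0 < z.2]%R `&`
  ([set z | z.2 <= p z.1 ^+ m.+1]%R `&`
   [set z | p z.1 ^+ m.+1 < 2 ^+ m.+1 * z.2]%R `&` [set z | 1 <= f z.1]%R).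
have mE : measurable E.
  apply: measurableI; first exact: measurable_set_ltr.
  apply: measurableI; last by apply: measurable_set_ler => //; exact: mfst.
  apply: measurableI; [apply: measurable_set_ler|apply: measurable_set_ltr] => //;
    exact: mfst.
have mE' : measurable E'.
  apply: measurableI; first exact: measurable_set_ltr.
  apply: measurableI; last by apply: measurable_set_ler => //; exact: mfst.
  have mpX : measurable_fun setT (fun z : P => p z.1 ^+ m.+1)%R.
    by apply: measurable_funX; exact: mfst.
  apply: measurableI; first exact: measurable_set_ler.
  by apply: measurable_set_ltr => //; exact: measurable_funM.
have mEs s : measurable [set t | E (t, s)].
  exact: (measurable_preimageT (pair2_measurable s) mE).
have mEs' s : measurable [set t | E' (t, s)].
  exact: (measurable_preimageT (pair2_measurable s) mE').
have mEt t : measurable [set s | E (t, s)].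
  exact: (measurable_preimageT (pair1_measurable t) mE).
have mS : measurable ([set t | 1 <= p t < 2]%R : set (m.+1.-tuple T)).
  rewrite (_ : [set t | _] = [set t | 1 <= p t]%R `&` [set t | p t < 2]%R).
    by apply: measurableI; [apply: measurable_set_ler|apply: measurable_set_ltr].
  by apply/seteqP; split => t /= /andP.
(* rescaling at height [s] *)
have slice s : L m.+1 [set t | E (t, s)] =
    (`|s|^-1)%:E * L m.+1 [set t | E' (t, s)].
  have [s0|s0] := ltP 0%R s; last first.
    have -> : [set t | E (t, s)] = set0.
      by apply/seteqP; split => // t [/=]; rewrite ltNge s0.
    have -> : [set t | E' (t, s)] = set0.
      by apply/seteqP; split => // t [/=]; rewrite ltNge s0.
    by rewrite measure0 mule0.
  pose r := (s `^ (m.+1%:R)^-1)%R.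
  have r0 : (0 < r)%R by rewrite powR_gt0.
  have rs : (r ^+ m.+1 = s)%R.
    by rewrite -powR_mulrn ?ltW// -powRrM mulVf ?powRr1 ?pnatr_eq0// ltW.
  rewrite gtr0_norm// -[X in (X^-1)%:E]rs -lebesgue_tuple_scale//.
  congr (L _ _); apply/seteqP; split => t; rewrite /E/E'/= pZ//.
  - move=> [_ [[p1 p2] sf]]; split => //; split; last first.
      by rewrite -(ler_pM2r s0) mul1r -[X in (_ * X)%R]rs fZ.
    rewrite exprMn rs; split; first by rewrite ler_pMr// exprn_ege1.
    by rewrite mulrC ltr_pM2r// ltrXn2r// ltW.
  - move=> [_ [[p1 p2] sf]]; split => //; split; last first.
      by rewrite -[X in (X <= _)%R]mul1r -(fZ t r0) rs ler_pM2r.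
    move: p1 p2; rewrite exprMn rs ler_pMr// [(2 ^+ _ * _)%R]mulrC ltr_pM2l//.
    by rewrite -[X in (X <= _)%R](expr1n _ m.+1) ler_pXn2r ?ltr_pXn2r ?nnegrE.
transitivity (\int[leb]_s \int[L m.+1]_t (\1_E (t, s))%:E).
  rewrite -(fubini_tonelli (m1 := L m.+1) (m2 := leb) (EFin \o \1_E)); last 2 first.
  - by apply/measurable_EFinP; exact: measurable_indic.
  - by move=> x; rewrite lee_fin.
  rewrite integral_mkcond; apply: eq_integral => t _.
  transitivity (leb [set s | E (t, s)]); last by rewrite -integral_indicT.
  rewrite patchE; case: ifPn; rewrite ?inE ?notin_setE/=; last first.
    move=> np; rewrite (_ : [set s | _] = set0) ?measure0//; apply/seteqP.
    by split => // s [_ [[/= p1 p2] _]]; apply: np; rewrite p1.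
  move=> /andP[p1 p2]; rewrite (_ : [set s | _] = `]0%R, f t]%classic).
    rewrite lebesgue_measure_itv/= lte_fin; case: ltP => [_|].
      by rewrite sube0.
    by move=> ft; congr EFin; apply/le_anti; rewrite ft f0.
  apply/seteqP; split => s; rewrite /E/= in_itv/=.
    by move=> [-> [_ ->]].
  by move=> /andP[-> ->].
transitivity (\int[leb]_s \int[L m.+1]_t (`|s|^-1 * \1_E' (t, s))%:E).
  apply: eq_integral => s _.
  under [RHS]eq_integral do rewrite EFinM.
  rewrite ge0_integralZl//; last first.
    have mE'1 : measurable_fun setT (\1_E' : P -> R) by exact: measurable_indic.
    apply/measurable_EFinP; exact: (measurableT_comp mE'1 (pair2_measurable s)).
  transitivity (L m.+1 [set t | E (t, s)]); first by rewrite -integral_indicT.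
  by rewrite slice -[in LHS]integral_indicT.
pose h (z : P) : \bar R := (`|z.2|^-1 * \1_E' z)%:E.
have mh : measurable_fun setT h.
  apply/measurable_EFinP; apply: measurable_funM; last exact: measurable_indic.
  rewrite (_ : (fun z => _) = fun z : P => `|z.2| `^ (-1))%R; last first.
    by apply/funext => z; rewrite powR_inv1.
  apply: (measurableT_comp (measurable_powR (-1))).
  exact: (measurableT_comp (@normr_measurable _ _) measurable_snd).
rewrite -(fubini_tonelli (m1 := L m.+1) (m2 := leb) h)//; last first.
  by move=> x; rewrite lee_fin mulr_ge0// invr_ge0.
(* Where [p] vanishes the fibre of [E'] is empty. Such points lie in the null hyperplane
   [thead t = 0], so replacing {f >= 1} by [D] does not change the measure. *)
pose D := [set t | 0 < p t]%R `&` [set t | 1 <= f t]%R.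
have mD : measurable D.
  by apply: measurableI; [exact: measurable_set_ltr|exact: measurable_set_ler].
(* Over a point of [D], [s] ranges over the interval from [(p t / 2) ^ (m + 1)] to [p t ^ (m + 1)],
   whose measure for ds / s is (m + 1) ln 2 independently of [t]. *)
have inner t : \int[leb]_s h (t, s) = (ln 2 *+ m.+1)%:E * (\1_D t)%:E.
  rewrite indicE; have [pf|npf] := boolP (t \in D); last first.
    rewrite mule0 (_ : (fun s => h (t, s)) = cst 0) ?integral0//.
    apply/funext => s; rewrite /h/= indicE memNset ?mulr0//.
    move=> [/= s0 [[sp _] f1]]; move: npf; rewrite notin_setE; apply; split => //=.
    rewrite lt_neqAle p0 andbT eq_sym; apply/eqP => pt0.
    by move: sp; rewrite pt0 expr0n/= leNgt s0.
  rewrite mule1; move: pf; rewrite inE => -[/= pt0 f1].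
  have a0 : (0 < (p t / 2) ^+ m.+1)%R by rewrite exprn_gt0// divr_gt0.
  have ab : ((p t / 2) ^+ m.+1 < p t ^+ m.+1)%R.
    rewrite ltrXn2r// ?divr_ge0//; lra.
  have := integral_inv_itv a0 ab.
  rewrite !lnXn ?divr_gt0// ln_div ?posrE// mulrnBl opprB addrCA subrr addr0.
  move=> <-; rewrite [RHS]integral_mkcond; apply: eq_integral => s _.
  rewrite patchE /h/= indicE.
  have EE' : (s \in `](p t / 2) ^+ m.+1, p t ^+ m.+1]%classic)%R = ((t, s) \in E').
    apply/idP/idP; rewrite !inE /= in_itv/= expr_div_n ltr_pdivrMr ?exprn_gt0//.
      move=> /andP[s1 s2]; split; last by split => //; split => //=; rewrite mulrC.
      by rewrite /= -(@pmulr_lgt0 _ (2 ^+ m.+1)) ?exprn_gt0// (lt_trans _ s1)// exprn_gt0.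
    by move=> [/= s0 [[/= s1 s2] _]]; rewrite mulrC s2.
  rewrite EE'; case: ifPn => [|_]; last by rewrite mulr0.
  by rewrite inE => -[/= s0 _]; rewrite mulr1 gtr0_norm.
under eq_integral do rewrite inner.
rewrite ge0_integralZl//; last 2 first.
- by apply/measurable_EFinP; exact: measurable_indic.
- by rewrite lee_fin mulrn_wge0// ln_ge0// ler1n.
rewrite integral_indicT//; congr (_ * _).
have mF : measurable [set t | 1 <= f t]%R by exact: measurable_set_ler.
apply/le_anti/andP; split.
  by apply: le_measure; rewrite ?inE// => t [].
pose N := [set t : m.+1.-tuple T | thead t = 0%R].
have mN : measurable N.
  rewrite (_ : N = (fun t => tnth t ord0) @^-1` [set 0%R])//.
  by apply: measurable_preimageT => //; exact: measurable_tnth.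
have FDN : [set t | 1 <= f t]%R `<=` D `|` N.
  move=> t /= f1; have [pt0|pt0] := ltP 0%R (p t); first by left.
  by right; apply: p_eq0; apply/le_anti; rewrite pt0 p0.
have := @le_measure _ _ _ (L m.+1) _ _ _ _ FDN.
rewrite !inE => /(_ mF (measurableU _ _ mD mN)) /le_trans; apply.
apply: le_trans (measureU2 _ mD mN) _.
by rewrite [X in _ + X]lebesgue_tuple_hyperplane adde0.
Qed.
End polar_integral.

End Polar.

(** * Section volumes *)

Section DiscBundle.
Variable R : realType.
Local Notation T := (measurableTypeR R).
Local Notation leb := (@lebesgue_measure R).
Local Notation L m := (@lebesgue_tuple R m).
Local Open Scope ereal_scope.

Lemma measurable_fun_lebesgue_section m (A : set (m.+1.-tuple T)) :
  measurable A -> measurable_fun setT (fun t => leb [set s | A (tcons (s, t))]).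
Proof.
move=> mA; pose B := @tcons R m @^-1` A.
rewrite (_ : (fun t => _) = leb \o ysection B).
  apply: measurable_fun_ysection; apply: measurable_preimageT => //.
  exact: measurable_tcons.
apply/funext => t /=; congr (leb _); apply/seteqP.
by split => s /=; rewrite /ysection/= inE.
Qed.

Lemma measurable_set_sumsq_le (r t : R) :
  measurable [set s : T | s ^+ 2 + t ^+ 2 <= r]%R.
Proof.
by apply: measurable_set_ler => //; apply: measurable_funD.
Qed.

Lemma measurable_lebesgue_sumsq_le (r : R) :
  measurable_fun setT (fun t : T => leb [set s : T | s ^+ 2 + t ^+ 2 <= r]%R).
Proof.
pose E := [set z : T * T | z.1 ^+ 2 + z.2 ^+ 2 <= r]%R.
rewrite (_ : (fun t => _) = leb \o xsection E).
  apply: measurable_fun_xsection; apply: measurable_set_ler => //.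
  by apply: measurable_funD; apply: measurable_funX.
apply/funext => t /=; congr (leb _); apply/seteqP.
by split => s /=; rewrite /xsection/= inE/= addrC.
Qed.

Definition disc_area (r : R) : \bar R :=
  \int[leb]_t leb [set s : T | s ^+ 2 + t ^+ 2 <= r]%R.

Lemma disc_area_ge0 r : 0 <= disc_area r.
Proof. exact: integral_ge0. Qed.

Lemma disc_area_gt0E r : (0 < r)%R -> disc_area r = r%:E * disc_area 1.
Proof.
move=> r0; pose w := Num.sqrt r; have w0 : (0 < w)%R by rewrite sqrtr_gt0.
have ww : (w ^+ 2 = r)%R by rewrite sqr_sqrtr// ltW.
have wV0 : (0 < w^-1)%R by rewrite invr_gt0.
have slice t : leb [set s : T | s ^+ 2 + t ^+ 2 <= r]%R =
    w%:E * leb [set s : T | s ^+ 2 + (w^-1 * t + 0) ^+ 2 <= 1]%R.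
  have := lebesgue_measure_affine 0 wV0 (measurable_set_sumsq_le 1 (w^-1 * t + 0)%R).
  rewrite invrK => <-; congr (leb _); apply/seteqP; split => s /=;
  rewrite !addr0 !exprMn -mulrDr exprVn ww ler_pdivrMl// mulr1//.
rewrite /disc_area; under eq_integral do rewrite slice.
have mG : measurable_fun setT (fun t : T =>
    leb [set s : T | s ^+ 2 + (w^-1 * t + 0) ^+ 2 <= 1]%R).
  exact: (measurableT_comp (measurable_lebesgue_sumsq_le 1)
    (measurable_fun_affine _ _)).
rewrite ge0_integralZl//; last by rewrite lee_fin ltW.
rewrite (ge0_integral_image_scale (phi := fun t : T => (w^-1 * t + 0)%R : T)
   (c := w) (f := fun t : T => leb [set s : T | s ^+ 2 + t ^+ 2 <= 1]%R)).
- by rewrite muleA -EFinM -expr2 ww.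
- exact: measurable_fun_affine.
- exact: ltW.
- by move=> A mA; rewrite -[X in X%:E * _]invrK; exact: lebesgue_measure_affine.
- exact: measurable_lebesgue_sumsq_le.
- by [].
Qed.

Lemma disc_area_le0 r : (r <= 0)%R -> disc_area r = 0.
Proof.
move=> r0; apply: integral0_eq => t _; apply/le_anti/andP; split => //.
rewrite -(lebesgue_measure_set1 (0 : R)%R); apply: le_measure.
- rewrite inE; exact: measurable_set_sumsq_le.
- by rewrite inE.
move=> s /= st; apply/eqP; rewrite -sqrf_eq0 eq_le sqr_ge0 andbT.
rewrite (le_trans _ (le_trans st r0))// lerDl sqr_ge0//.
Qed.

(** [r] is the square of the radius. The area of a disc is linear in it, which is special to
    dimension two; the value pi of [disc_area 1] is never computed. *)
Lemma disc_areaE r : disc_area r = (Num.max r 0)%:E * disc_area 1.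
Proof.
have [r0|r0] := leP r 0%R; first by rewrite disc_area_le0// mul0e.
exact: disc_area_gt0E.
Qed.

(** The positive part is a convex function. For segments instead of discs one would get a square
    root, which is concave on the positive half-line; this is why the sections need two directions
    orthogonal to the x''-space. *)
Lemma disc_area_convex (c r s : R) : (0 <= c <= 1)%R ->
  disc_area (c * r + (1 - c) * s) <=
  c%:E * disc_area r + (1 - c)%:E * disc_area s.
Proof.
move=> /andP[c0 c1]; rewrite disc_areaE (disc_areaE r) (disc_areaE s).
have c1' : (0 <= 1 - c)%R by rewrite subr_ge0.
rewrite !muleA -!EFinM -ge0_muleDl ?lee_fin ?mulr_ge0 ?le_max ?lexx ?orbT//.
apply: lee_wpmul2r; first exact: disc_area_ge0.
rewrite -EFinD lee_fin ge_max; apply/andP; split.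
  by rewrite lerD// ler_wpM2l// le_max lexx.
by rewrite addr_ge0// mulr_ge0// le_max lexx orbT.
Qed.

Section bundle.
Variables (k : nat) (r0 Q Y : k.-tuple T -> R).
Hypotheses (mr0 : measurable_fun setT r0) (mQ : measurable_fun setT Q)
  (mY : measurable_fun setT Y).
Hypotheses (r0_ge0 : forall w, (0 <= r0 w)%R) (Q_ge0 : forall w, (0 <= Q w)%R).

Definition tail2 (t : k.+2.-tuple T) : k.-tuple T :=
  [tuple of behead [tuple of behead t]].

(** This is the shape of a section of B_tau once x'' has been rescaled by the square root of tau:
    the parameter enters only linearly, through |x'|^2. *)
Definition disc_bundle (tau : R) : set (k.+2.-tuple T) :=
  [set t | (tnth t ord0 ^+ 2 + tnth t (lift ord0 ord0) ^+ 2 + r0 (tail2 t)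
     + tau * Q (tail2 t)) ^+ 2 + Y (tail2 t) ^+ 2 <= 1]%R.

Lemma measurable_tail2 : measurable_fun setT tail2.
Proof.
apply: (measurableT_comp (f := fun t : k.+1.-tuple T => [tuple of behead t])
  (g := fun t : k.+2.-tuple T => [tuple of behead t])).
  exact: measurable_behead.
exact: measurable_behead.
Qed.

Lemma measurable_disc_bundle tau : measurable (disc_bundle tau).
Proof.
have mt := measurable_tail2.
apply: measurable_set_ler => //; apply: measurable_funD; last first.
  by apply: measurable_funX; exact: (measurableT_comp mY mt).
apply: measurable_funX; apply: measurable_funD.
  apply: measurable_funD; last exact: (measurableT_comp mr0 mt).
  by apply: measurable_funD; apply: measurable_funX; exact: measurable_tnth.
by apply: measurable_funM => //; exact: (measurableT_comp mQ mt).
Qed.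

(** Square of the radius of the disc above [w], affine in [tau]. The value -1, which has zero
    [disc_area], encodes an empty fibre; being independent of [tau], it preserves affinity. *)
Definition disc_radius tau w : R :=
  (if Y w ^+ 2 <= 1 then Num.sqrt (1 - Y w ^+ 2) - r0 w - tau * Q w else -1)%R.

Lemma measurable_disc_radius tau : measurable_fun setT (disc_radius tau).
Proof.
apply: measurable_fun_ifT => //.
  by apply: measurable_fun_ler => //; exact: measurable_funX.
apply: measurable_funB; last exact: measurable_funM.
apply: measurable_funB => //.
apply: (measurableT_comp (f := @Num.sqrt R)).
  apply: continuous_measurable_fun; exact: sqrt_continuous.
by apply: measurable_funB => //; exact: measurable_funX.
Qed.

Lemma lebesgue_disc_bundle tau : (0 <= tau)%R ->
  L k.+2 (disc_bundle tau) = \int[L k]_w disc_area (disc_radius tau w).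
Proof.
move=> tau0; have mb := measurable_disc_bundle tau.
rewrite lebesgue_tupleS'; last exact: mb.
rewrite ge0_integral_tupleS'; last 2 first.
- exact: measurable_fun_lebesgue_section.
- by move=> t; exact: measure_ge0.
apply: eq_integral => w _; apply: eq_integral => t _; congr (leb _).
have tl s : tail2 (tcons (s, tcons (t, w))) = w by apply/val_inj.
apply/seteqP; split => s /=; rewrite /disc_bundle/= tl /tcons tnthS !(tnth_nth 0%R)/=
  /disc_radius.
  have [Y1|Y1] := leP (Y w ^+ 2)%R 1%R => h; last first.
    suff : (Y w ^+ 2 <= 1)%R by rewrite leNgt Y1.
    by apply: le_trans h; rewrite lerDr sqr_ge0.
  set X := (_ + _ + _ + _)%R in h.
  have X0 : (0 <= X)%R.
    by rewrite !addr_ge0 ?sqr_ge0 ?mulr_ge0.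
  have : (X <= Num.sqrt (1 - Y w ^+ 2))%R.
    by rewrite -(ger0_norm X0) -sqrtr_sqr ler_wsqrtr// lerBrDr.
  by rewrite /X; lra.
have [Y1|Y1] := leP (Y w ^+ 2)%R 1%R => h; last first.
  by have := addr_ge0 (sqr_ge0 s) (sqr_ge0 t); lra.
set X := (_ + _ + _ + _)%R.
have X0 : (0 <= X)%R.
  by rewrite !addr_ge0 ?sqr_ge0 ?mulr_ge0.
rewrite -lerBrDr -[leRHS]sqr_sqrtr ?subr_ge0// lerXn2r ?nnegrE ?sqrtr_ge0//.
by rewrite /X; lra.
Qed.

(** Fibre by fibre [disc_radius] is affine in [tau], so [disc_area_convex] can be integrated over
    [w]. *)
Lemma disc_bundle_convex (c a b : R) : (0 <= c <= 1)%R -> (0 <= a)%R -> (0 <= b)%R ->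
  L k.+2 (disc_bundle (c * a + (1 - c) * b)) <=
  c%:E * L k.+2 (disc_bundle a) + (1 - c)%:E * L k.+2 (disc_bundle b).
Proof.
move=> c01 a0 b0; have /andP[c0 c1] := c01.
have c1' : (0 <= 1 - c)%R by rewrite subr_ge0.
have mJ tau : measurable_fun setT (fun w => disc_area (disc_radius tau w)).
  under eq_fun do rewrite disc_areaE muleC.
  apply: measurable_funeM; apply/measurable_EFinP.
  by apply: measurable_maxr => //; exact: measurable_disc_radius.
rewrite !lebesgue_disc_bundle// ?addr_ge0 ?mulr_ge0//.
rewrite -!ge0_integralZl ?lee_fin//; last 2 first.
  by move=> w _; exact: disc_area_ge0.
  by move=> w _; exact: disc_area_ge0.
rewrite -ge0_integralD//; first last.
- exact: measurable_funeM.
- by move=> w _; rewrite mule_ge0 ?lee_fin// disc_area_ge0.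
- exact: measurable_funeM.
- by move=> w _; rewrite mule_ge0 ?lee_fin// disc_area_ge0.
apply: ge0_le_integral => //.
- by move=> w _; exact: disc_area_ge0.
- by apply: emeasurable_funD; exact: measurable_funeM.
move=> w _; apply: le_trans (disc_area_convex _ _ c01).
rewrite le_eqVlt; apply/orP; left; apply/eqP; congr disc_area.
by rewrite /disc_radius; case: ifP => _; ring.
Qed.

End bundle.
End DiscBundle.

(** * The radial density of the body *)

Section Quartic.
Variable R : realType.
Implicit Types a c X Y : R.

(** At X = |x'|^2, Y = |x''|^2 and a = i / 4 this is the i-th power of the radial function of {X^2 +
    c Y^2 <= 1}. At the origin [powR] returns 0 when [a] is nonzero, so the origin is missing from
    {quartic >= 1} and has to be added by hand. *)
Definition quartic a c X Y : R := (X ^+ 2 + c * Y ^+ 2) `^ (- a).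

Lemma quartic_ge0 a c X Y : 0 <= quartic a c X Y.
Proof. exact: powR_ge0. Qed.

Lemma quartic_base_ge0 c X Y : 0 <= c -> 0 <= X ^+ 2 + c * Y ^+ 2.
Proof. by move=> c0; apply: addr_ge0; [|apply: mulr_ge0 => //]; exact: sqr_ge0. Qed.

Lemma quartic_base_eq0 c X Y : 0 < c -> X ^+ 2 + c * Y ^+ 2 = 0 -> X = 0 /\ Y = 0.
Proof.
move=> c0; have cY : 0 <= c * Y ^+ 2 by rewrite pmulr_rge0// sqr_ge0.
move=> /eqP; rewrite (paddr_eq0 (sqr_ge0 X) cY) sqrf_eq0 mulf_eq0 sqrf_eq0.
by rewrite (gt_eqF c0)/= => /andP[/eqP -> /eqP ->].
Qed.

Lemma quartic_ge1 a c X Y : 0 < a -> 0 <= c ->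
  (1 <= quartic a c X Y) = (0 < X ^+ 2 + c * Y ^+ 2 <= 1).
Proof.
move=> a0 c0; rewrite /quartic; set Z := _ + _.
have : 0 <= Z by exact: quartic_base_ge0.
rewrite le_eqVlt => /orP[/eqP <-|Z0].
  rewrite powR0; last by rewrite oppr_eq0 gt_eqF.
  by rewrite ltxx ler10.
have one : 1 `^ a = 1 by rewrite powR1.
rewrite Z0/= powRN -[in LHS]invr1 lef_pV2 ?posrE ?powR_gt0//.
apply/idP/idP => [|Z1]; last first.
  rewrite -[leRHS]one; apply: ge0_ler_powR; rewrite ?nnegrE//; exact: ltW.
apply: contraTT; rewrite -!ltNge => Z1.
rewrite -[ltLHS]one; apply: gt0_ltr_powR; rewrite ?nnegrE//; exact: ltW.
Qed.

Lemma quartic_le a c c' X Y : 0 <= a -> 0 < c -> c <= c' ->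
  quartic a c' X Y <= quartic a c X Y.
Proof.
move=> a0 c0 cc'; have c'0 := lt_le_trans c0 cc'.
have := quartic_base_ge0 X Y (ltW c0); rewrite le_eqVlt => /orP[/eqP/esym Z0|Z0].
  by have [-> ->] := quartic_base_eq0 c0 Z0; rewrite /quartic expr0n/= !mulr0.
have ZZ : X ^+ 2 + c * Y ^+ 2 <= X ^+ 2 + c' * Y ^+ 2.
  by rewrite lerD2l ler_wpM2r// sqr_ge0.
have Z'0 := lt_le_trans Z0 ZZ.
rewrite /quartic !powRN lef_pV2 ?posrE ?powR_gt0//.
by apply: ge0_ler_powR; rewrite ?nnegrE// ltW.
Qed.

Lemma quarticZ a c (r X Y : R) : 0 < r -> 0 <= c ->
  quartic a c (r * X) (r * Y) = r `^ (- (2 * a)) * quartic a c X Y.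
Proof.
move=> r0 c0; have r0' := ltW r0.
rewrite /quartic (_ : _ + _ = r ^+ 2 * (X ^+ 2 + c * Y ^+ 2)); last by ring.
rewrite powRM ?sqr_ge0//; last exact: quartic_base_ge0.
by rewrite -(powR_mulrn 2 r0') -powRrM mulrN.
Qed.

Lemma measurable_quartic d (S : measurableType d) a c (X Y : S -> R) :
  measurable_fun setT X -> measurable_fun setT Y ->
  measurable_fun setT (fun t => quartic a c (X t) (Y t)).
Proof.
move=> mX mY; apply: (measurableT_comp (measurable_powR (- a))).
apply: measurable_funD; first exact: measurable_funX.
by apply: measurable_funM => //; exact: measurable_funX.
Qed.

(** The point between 1 and [g] with weights [g] and [1 - g], where convexity in tau is tested; it
    is at most 2 g, hence close to 0 for small [g]. *)
Definition tmid (g : R) : R := g * 1 + (1 - g) * g.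

(* Radial density of the body: [q = i / 4], so that [quartic q c] is          *)
(* homogeneous of degree [- i] in [x], and the three terms come from the      *)
(* bodies [X ^ 2 + Y ^ 2 / tau ^ 2 <= 1] for [tau = 1], [tmid g], [g].        *)
Definition star q (l : nat) (eta g X Y : R) : R :=
  (1 - eta * g) * quartic q 1 X Y +
  eta * (Num.sqrt (tmid g) ^- l) * quartic q (tmid g ^- 2) X Y -
  eta * (1 - g) * (Num.sqrt g ^- l) * quartic q (g ^- 2) X Y.

(** The last inequality lets the first term of [star] absorb the negative one, since [g ^- 2 >= 1]
    and [quartic] decreases in its second argument. *)
Definition star_admissible (l : nat) (eta g : R) :=
  [/\ 0 < g, g < 1, 0 <= eta & eta * (1 - g) * (Num.sqrt g ^- l) <= 1 - eta * g].

Lemma tmid_gt0 g : 0 < g -> g < 1 -> 0 < tmid g.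
Proof. by move=> g0 g1; rewrite /tmid; nra. Qed.

Lemma star_ge0 q l eta g X Y : 0 <= q -> star_admissible l eta g ->
  0 <= star q l eta g X Y.
Proof.
move=> q0 [g0 g1 eta0 adm]; rewrite /star addrAC addr_ge0//; last first.
  by rewrite !mulr_ge0 ?quartic_ge0// invr_ge0 exprn_ge0// sqrtr_ge0.
rewrite subr_ge0.
have c3 : 0 <= eta * (1 - g) * Num.sqrt g ^- l.
  by rewrite !mulr_ge0 ?subr_ge0 ?invr_ge0 ?exprn_ge0 ?sqrtr_ge0 ?(ltW g1).
apply: ler_pM => //; first exact: quartic_ge0.
apply: quartic_le => //.
by rewrite invf_ge1 ?exprn_gt0// exprn_ile1// ltW.
Qed.

Lemma starZ q l eta g (r X Y : R) : 0 < r -> 0 < g ->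
  star q l eta g (r * X) (r * Y) = r `^ (- (2 * q)) * star q l eta g X Y.
Proof.
move=> r0 g0; rewrite /star !quarticZ// ?invr_ge0 ?exprn_even_ge0//; ring.
Qed.

End Quartic.

(** * Sections in adapted coordinates *)

Section AdaptedSection.
Variable R : realType.
Local Notation T := (measurableTypeR R).
Local Notation L m := (@lebesgue_tuple R m).
Local Open Scope ereal_scope.

(** Used to ignore the origin, and more generally the points of a null hyperplane, where [powR]
    takes conventional values. *)
Lemma lebesgue_tuple_hyperplane_eq m (A B : set (m.+1.-tuple T)) :
  measurable A -> measurable B -> A `<=` B ->
  B `<=` A `|` [set t | thead t = 0%R] -> L m.+1 A = L m.+1 B.
Proof.
move=> mA mB AB BA.
have mN : measurable ([set t | thead t = 0%R] : set (m.+1.-tuple T)).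
  rewrite (_ : [set t | _] = (fun t => tnth t ord0) @^-1` [set 0%R])//.
  by apply: measurable_preimageT => //; exact: measurable_tnth.
apply/le_anti/andP; split; first by apply: le_measure; rewrite ?inE.
have := @le_measure _ _ _ (L m.+1) _ _ _ _ BA.
rewrite !inE => /(_ mB (measurableU _ _ mA mN)) /le_trans; apply.
apply: le_trans (measureU2 _ mA mN) _.
by rewrite [X in _ + X]lebesgue_tuple_hyperplane adde0.
Qed.

(* [t] is the coordinate vector in an orthonormal basis of the section whose  *)
(* first [k + 2 - l] vectors are orthogonal to the [x'']-space, so that [Y]   *)
(* only involves the last [l] coordinates, which are rescaled by [s].         *)
Variables (k l : nat) (X Y : k.+2.-tuple T -> R) (r0 Q Y0 : k.-tuple T -> R).
Hypotheses (lk : (l <= k)%N).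
Hypotheses (mr0 : measurable_fun setT r0) (mQ : measurable_fun setT Q)
  (mY0 : measurable_fun setT Y0).
Hypotheses (r0_ge0 : forall w, (0 <= r0 w)%R) (Q_ge0 : forall w, (0 <= Q w)%R)
  (Y0_ge0 : forall w, (0 <= Y0 w)%R).
Hypotheses (mX : measurable_fun setT X) (mY : measurable_fun setT Y).

Definition last_scale (s : R) (j : 'I_k.+2) : R :=
  if (j < k.+2 - l)%N then 1%R else s.

Hypothesis XE : forall s t, (0 < s)%R ->
  X (taffine (last_scale s) (fun=> 0%R) t) =
  (tnth t ord0 ^+ 2 + tnth t (lift ord0 ord0) ^+ 2 + r0 (tail2 t) +
     s ^+ 2 * Q (tail2 t))%R.
Hypothesis YE : forall s t, (0 < s)%R ->
  Y (taffine (last_scale s) (fun=> 0%R) t) = (s ^+ 2 * Y0 (tail2 t))%R.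
Hypothesis XZ : forall c t, (0 < c)%R -> X (tscale c t) = (c ^+ 2 * X t)%R.
Hypothesis YZ : forall c t, (0 < c)%R -> Y (tscale c t) = (c ^+ 2 * Y t)%R.
Hypothesis XY : forall t, (X t + Y t = \sum_j tnth t j ^+ 2)%R.

Let q : R := (k.+2%:R / 4)%R.
Let V (c : R) := L k.+2 [set t | X t ^+ 2 + c * Y t ^+ 2 <= 1]%R.

Let mXY c : measurable [set t | X t ^+ 2 + c * Y t ^+ 2 <= 1]%R.
Proof.
apply: measurable_set_ler => //; apply: measurable_funD; first exact: measurable_funX.
by apply: measurable_funM => //; exact: measurable_funX.
Qed.

Lemma prod_last_scale s : (\prod_j (last_scale s j)^-1 = s ^- l)%R.
Proof.
pose F j := (if (j < k.+2 - l)%N then 1 else s^-1)%R.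
rewrite (eq_bigr (fun j : 'I_k.+2 => F j)) => [|j _]; last first.
  by rewrite /last_scale /F; case: ifP; rewrite ?invr1.
have kl : (k.+2 - l <= k.+2)%N by exact: leq_subr.
rewrite -(big_mkord xpredT F) (big_cat_nat (leq0n _) kl)/= big_nat big1 ?mul1r.
  rewrite big_nat (eq_bigr (fun=> s^-1)%R) => [|j /andP[jl _]]; last first.
    by rewrite /F ltnNge jl.
  rewrite -big_nat prodr_const_nat subKn ?exprVn//.
  by rewrite (leq_trans lk)// (leq_trans (leqnSn _)).
by move=> j /andP[_ jl]; rewrite /F jl.
Qed.

(** Scaling the last [l] coordinates by the square root of [tau] turns Y into [tau * Y0], which
    cancels [tau ^- 2], and contributes [tau * Q] to X. The prefactor is the inverse Jacobian. *)
Lemma V_disc_bundle tau : (0 < tau)%R ->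
  (Num.sqrt tau ^- l)%:E * V (tau ^- 2) = L k.+2 (disc_bundle r0 Q Y0 tau).
Proof.
move=> tau0; have s0 : (0 < Num.sqrt tau)%R by rewrite sqrtr_gt0.
have d0 j : (0 < last_scale (Num.sqrt tau) j)%R.
  by rewrite /last_scale; case: ifP.
rewrite -prod_last_scale.
rewrite -[LHS](lebesgue_tuple_affine (fun=> 0%R) d0 (mXY (tau ^- 2))).
have tauY t : (tau ^- 2 * (tau * Y0 (tail2 t)) ^+ 2 = Y0 (tail2 t) ^+ 2)%R.
  by field; rewrite gt_eqF.
congr (L _ _); apply/seteqP; split => t; rewrite /disc_bundle/=;
  by rewrite XE// YE// sqr_sqrtr ?(ltW tau0)// tauY.
Qed.

Lemma V_convex g : (0 < g)%R -> (g < 1)%R ->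
  (Num.sqrt (tmid g) ^- l)%:E * V (tmid g ^- 2) <=
  g%:E * V 1 + ((1 - g) * Num.sqrt g ^- l)%:E * V (g ^- 2).
Proof.
move=> g0 g1; have t0 := tmid_gt0 g0 g1.
rewrite V_disc_bundle//.
have g01 : (0 <= g <= 1)%R by rewrite !ltW.
have := disc_bundle_convex mr0 mQ mY0 r0_ge0 Q_ge0 g01 ler01 (ltW g0).
rewrite -/(tmid g) => /le_trans; apply.
rewrite -!V_disc_bundle// sqrtr1 !expr1n invr1 mul1e EFinM muleA//.
Qed.

Lemma V_fin c : (0 < c)%R -> V c < +oo.
Proof.
move=> c0; pose r := (1 + c^-1 + 1)%R.
have cV0 : (0 < c^-1)%R by rewrite invr_gt0.
have rr : (- r <= r)%R by rewrite /r; lra.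
apply: (@le_lt_trans _ _ (L k.+2 (tcube (- r) r))); last first.
  by rewrite lebesgue_tuple_cube// ltry.
apply: le_measure; rewrite ?inE//; first exact: measurable_tcube.
move=> t /= h j; rewrite -ler_norml.
have tj : (tnth t j ^+ 2 <= X t + Y t)%R.
  by rewrite XY (bigD1 j)//= lerDl sumr_ge0// => i _; exact: sqr_ge0.
have c1 : (c * c^-1 = 1)%R by rewrite mulfV// gt_eqF.
have X1 : (X t <= 1)%R.
  by have := sqr_ge0 (Y t); nra.
have Y1 : (Y t <= 1 + c^-1)%R.
  have : (c * Y t ^+ 2 <= 1)%R by have := sqr_ge0 (X t); lra.
  have := sqr_ge0 (Y t - 1)%R; nra.
have tr : (tnth t j ^+ 2 <= r ^+ 2)%R by apply: le_trans tj _; rewrite /r; nra.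
have rge0 : (0 <= r)%R by rewrite /r; lra.
by rewrite -sqrtr_sqr -[leRHS](ger0_norm rge0) -[leRHS]sqrtr_sqr ler_wsqrtr.
Qed.

Lemma powR_neg_half_dim (m : nat) (c : R) : (0 < c)%R ->
  ((c ^+ 2) `^ (- (2 * (m%:R / 4))) * c ^+ m = 1)%R.
Proof.
move=> c0; have c0' := ltW c0; rewrite -(powR_mulrn 2 c0') -powRrM.
rewrite (_ : 2%:R * - _ = - m%:R)%R; last by field.
by rewrite powR_invn// mulVf// expf_neq0// gt_eqF.
Qed.

(** The gauge for the polar formula in a section: the shell is 1 <= |t_0| < 2. *)
Let p (t : k.+2.-tuple T) : R := `|thead t|.

Let mp : measurable_fun setT p.
Proof.
apply: (measurableT_comp (@normr_measurable _ _)).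
exact: (@measurable_tnth _ _ _ ord0).
Qed.

Let polar (f : k.+2.-tuple T -> R) : measurable_fun setT f ->
  (forall t, 0 <= f t)%R ->
  (forall c t, 0 < c -> f (tscale c t) * c ^+ k.+2 = f t)%R ->
  \int[L k.+2]_(t in [set t | 1 <= p t < 2]%R) (f t)%:E =
  (ln 2 *+ k.+2)%:E * L k.+2 [set t | 1 <= f t]%R.
Proof.
move=> mf f0 fZ; apply: polar_integral => //.
- by move=> t; exact: normr_ge0.
- move=> c t c0; rewrite /p (_ : thead (tscale c t) = c * thead t)%R.
    by rewrite normrM gtr0_norm.
  by rewrite /thead tnth_mktuple.
- by move=> t /eqP; rewrite normr_eq0 => /eqP.
Qed.

Lemma cancel_convex_bound (C b1 b2 b3 v1 v2 v3 : R) (a : \bar R) :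
  (0 < C)%R -> 0 <= a ->
  C%:E * a + (b3 * C * v3)%:E = (b1 * C * v1 + b2 * C * v2)%:E ->
  (b1 * v1 + b2 * v2 <= v1 + b3 * v3)%R -> a <= v1%:E.
Proof.
move=> C0; case: a => [a| |]//; last by rewrite gt0_muley ?lte_fin.
rewrite -EFinM -EFinD !lee_fin => _ [] E h; rewrite -(ler_pM2l C0); nra.
Qed.

Lemma ln2_mulrn_gt0 (m : nat) : (0 < (ln 2 *+ m.+1 : R))%R.
Proof. by rewrite pmulrn_lgt0// ln_gt0// ltr1n. Qed.

Lemma quartic_polar c : (0 < c)%R ->
  \int[L k.+2]_(t in [set t | 1 <= p t < 2]%R) (quartic q c (X t) (Y t))%:E =
  (ln 2 *+ k.+2)%:E * V c.
Proof.
move=> c0; have q0 : (0 < q)%R by rewrite divr_gt0.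
have mg : measurable_fun setT (fun t => quartic q c (X t) (Y t)).
  exact: measurable_quartic.
have g0 t : (0 <= quartic q c (X t) (Y t))%R by exact: quartic_ge0.
have gZ (s : R) t : (0 < s)%R ->
    (quartic q c (X (tscale s t)) (Y (tscale s t)) * s ^+ k.+2 =
     quartic q c (X t) (Y t))%R.
  move=> s0; rewrite XZ// YZ// quarticZ ?exprn_gt0//; last exact: ltW.
  by rewrite mulrAC powR_neg_half_dim// mul1r.
suff E : L k.+2 [set t | 1 <= quartic q c (X t) (Y t)]%R = V c.
  by rewrite (polar mg g0 gZ) E.
apply: lebesgue_tuple_hyperplane_eq.
- exact: measurable_set_ler.
- exact: mXY.
- by move=> t /=; rewrite (quartic_ge1 _ _ q0 (ltW c0)) => /andP[].
move=> t /= h; have := quartic_base_ge0 (X t) (Y t) (ltW c0).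
rewrite le_eqVlt => /orP[/eqP/esym Z0|Z0]; last first.
  by left; rewrite /= (quartic_ge1 _ _ q0 (ltW c0)) Z0.
right; have [X0 Yt0] := quartic_base_eq0 c0 Z0.
have := XY t; rewrite X0 Yt0 addr0 => /esym/eqP.
rewrite psumr_eq0 => [/allP/(_ ord0)|j _]; last exact: sqr_ge0.
by rewrite mem_index_enum sqrf_eq0 => /(_ isT)/eqP.
Qed.

(** In polar form the left side is [b1 * V 1 + b2 * V (tmid g ^- 2) - b3 * V (g ^- 2)]. Multiplying
    [V_convex] by [eta] bounds this by [V 1], because [b1 = 1 - eta * g]. *)
Lemma adapted_section_le eta g : star_admissible l eta g ->
  L k.+2 [set t | 1 <= star q l eta g (X t) (Y t)]%R <=
  L k.+2 [set t | X t ^+ 2 + Y t ^+ 2 <= 1]%R.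
Proof.
move=> adm; have [g0 g1 eta0 adm'] := adm.
have q0 : (0 < q)%R by rewrite divr_gt0.
have t0 := tmid_gt0 g0 g1.
have c2 : (0 < tmid g ^- 2)%R by rewrite invr_gt0 exprn_gt0.
have c3 : (0 < g ^- 2)%R by rewrite invr_gt0 exprn_gt0.
have mq c : measurable_fun setT (fun t => quartic q c (X t) (Y t)).
  exact: measurable_quartic.
set b1 := (1 - eta * g)%R; set b2 := (eta * (Num.sqrt (tmid g) ^- l))%R.
set b3 := (eta * (1 - g) * (Num.sqrt g ^- l))%R.
have b30 : (0 <= b3)%R.
  by rewrite !mulr_ge0 ?subr_ge0 ?invr_ge0 ?exprn_ge0 ?sqrtr_ge0 ?(ltW g1).
have b20 : (0 <= b2)%R.
  by rewrite !mulr_ge0 ?invr_ge0 ?exprn_ge0 ?sqrtr_ge0.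
have b10 : (0 <= b1)%R by apply: le_trans adm'.
pose f t := star q l eta g (X t) (Y t).
have f0 t : (0 <= f t)%R by apply: star_ge0 => //; exact: ltW.
have mf : measurable_fun setT f.
  apply: measurable_funB; last exact: measurable_funM.
  by apply: measurable_funD; exact: measurable_funM.
have fZ (c : R) t : (0 < c)%R -> (f (tscale c t) * c ^+ k.+2 = f t)%R.
  move=> c0; rewrite /f XZ// YZ// starZ ?exprn_gt0//.
  by rewrite mulrAC powR_neg_half_dim// mul1r.
pose S := [set t | 1 <= p t < 2]%R.
have mS : measurable S.
  rewrite (_ : S = [set t | 1 <= p t]%R `&` [set t | p t < 2]%R).
    by apply: measurableI; [apply: measurable_set_ler|apply: measurable_set_ltr].
  by apply/seteqP; split => t /= /andP.
have mfS (h : k.+2.-tuple T -> R) : measurable_fun setT h ->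
    measurable_fun S (fun t => (h t)%:E).
  by move=> mh; apply/measurable_EFinP; exact: measurable_funTS.
have polarZ b c : (0 <= b)%R -> (0 < c)%R ->
    \int[L k.+2]_(t in S) (b * quartic q c (X t) (Y t))%:E =
    (b * (ln 2 *+ k.+2))%:E * V c.
  move=> b0 c0; rewrite EFinM -muleA -quartic_polar//.
  rewrite -ge0_integralZl//; last 2 first.
  - exact: mfS.
  - by move=> t _; rewrite lee_fin quartic_ge0.
(* The negative term is moved to the other side, so that only integrals of nonnegative functions are
   added. *)
have : \int[L k.+2]_(t in S) ((f t)%:E + (b3 * quartic q (g ^- 2) (X t) (Y t))%:E) =
  \int[L k.+2]_(t in S) ((b1 * quartic q 1 (X t) (Y t))%:E +
     (b2 * quartic q (tmid g ^- 2) (X t) (Y t))%:E).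
  by apply: eq_integral => t _; rewrite -!EFinD /f /star subrK.
have nn b c t : (0 <= b)%R -> 0 <= (b * quartic q c (X t) (Y t))%:E.
  by move=> b0; rewrite lee_fin mulr_ge0// quartic_ge0.
have mqS b c : measurable_fun S (fun t => (b * quartic q c (X t) (Y t))%:E).
  by apply: mfS; exact: measurable_funM.
have fS t : S t -> 0 <= (f t)%:E by rewrite lee_fin.
rewrite (ge0_integralD _ mS fS (mfS _ mf) (fun t _ => nn _ _ t b30) (mqS _ _)).
rewrite (ge0_integralD _ mS (fun t _ => nn _ _ t b10) (mqS _ _)
  (fun t _ => nn _ _ t b20) (mqS _ _)).
rewrite (polar mf f0 fZ) (polarZ _ _ b30 c3) (polarZ _ _ b10 ltr01) (polarZ _ _ b20 c2).
have := V_convex g0 g1.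
have V1E : L k.+2 [set t | X t ^+ 2 + Y t ^+ 2 <= 1]%R = V 1.
  by congr (L _ _); apply/seteqP; split => t /=; rewrite mul1r.
rewrite V1E -/(f _).
have Vfin c : (0 < c)%R -> exists2 v, V c = v%:E & (0 <= v)%R.
  move=> c0; have V0 : 0 <= V c by exact: measure_ge0.
  have Vf : V c \is a fin_num by rewrite (ge0_fin_numE V0); exact: V_fin.
  by exists (fine (V c)); [exact: (esym (fineK Vf))|exact: fine_ge0].
have [v1 -> v10] := Vfin _ ltr01; have [v2 -> v20] := Vfin _ c2.
have [v3 -> v30] := Vfin _ c3.
rewrite -!EFinM -!EFinD lee_fin => conv E.
apply: (cancel_convex_bound (ln2_mulrn_gt0 k.+1) _ E); first exact: measure_ge0.
have := ler_wpM2l eta0 conv; rewrite /b1 /b2 /b3.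
move: (Num.sqrt (tmid g) ^- l) (Num.sqrt g ^- l) => s2 s3.
lra.
Qed.

End AdaptedSection.

(** * Orthonormal bases adapted to the x''-space *)

Section AdaptedBasis.
Variables (R : realType) (n : nat).
Local Notation V := 'rV[R]_n.
Local Notation T := (measurableTypeR R).
Local Notation L m := (@lebesgue_tuple R m).

Definition tcomb m (b : 'I_m -> V) (t : m.-tuple T) : V :=
  \sum_a (tnth t a : R) *: b a.

Lemma dotZr (c : R) (x z : V) : dot z (c *: x) = c * dot z x.
Proof. by rewrite dotC dotZl (dotC z). Qed.

Lemma dot_sumr (I : finType) (F : I -> V) (z : V) :
  dot z (\sum_i F i) = \sum_i dot z (F i).
Proof. by rewrite dotC dot_suml; apply: eq_bigr => i _; rewrite dotC. Qed.

Definition orthonormal_family m (b : 'I_m -> V) :=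
  forall a c, dot (b a) (b c) = (a == c)%:R.

Lemma orthonormal_family_expand (U : {vspace V}) (b : 'I_(\dim U) -> V) :
  orthonormal_family b -> (forall a, b a \in U) ->
  forall x, x \in U -> x = \sum_a dot x (b a) *: b a.
Proof.
move=> ob bU; pose e := [tuple b a | a < \dim U].
have oe : Defs.orthonormal e by move=> a c; rewrite !tnth_mktuple.
have eU : {subset e <= U} by move=> x /mapP[a _ ->].
have be : basis_of U e.
  rewrite basisEfree (Defs.orthonormal_free oe) size_tuple leqnn andbT/=.
  exact/span_subvP.
move=> x xU; have xE := coord_basis be xU.
rewrite {1}xE; apply: eq_bigr => a _.
have eE (c : 'I_(\dim U)) : e`_c = b c by rewrite -tnth_nth tnth_mktuple.
rewrite eE; congr (_ *: _); rewrite {2}xE dot_suml (bigD1 a)//= big1 ?addr0.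
  by rewrite dotZl eE ob eqxx mulr1.
by move=> c ca; rewrite dotZl eE ob (negbTE ca) mulr0.
Qed.

(** The two orthonormal bases differ by an invertible matrix, so [lebesgue_tuple_linear] applies.
    The factor [c] is the same for every set, which is enough to compare two bodies in one
    subspace. *)
Lemma vol_in_change_basis (U : {vspace V}) (b : 'I_(\dim U) -> V) :
  orthonormal_family b -> (forall a, b a \in U) ->
  exists2 c : \bar R, (0 <= c)%E & forall A : set V,
    measurable [set t | A (tcomb b t)] ->
    vol_in U (A `&` [set` U]) = (c * L _ [set t | A (tcomb b t)])%E.
Proof.
move=> ob bU.
have [be oe] := svalP (cid (orthonormal_basis_exists U)); rewrite -/(onb U) in be oe.
have eU a : tnth (onb U) a \in U by rewrite (basis_mem be)// mem_tnth.
pose N := \matrix_(a, c) dot (tnth (onb U) a) (b c).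
have uN : N \in unitmx.
  suff NN : N *m N^T = 1%:M by case/mulmx1_unit: NN.
  apply/matrixP => a c; rewrite !mxE -(oe a c).
  rewrite {1}(orthonormal_family_expand ob bU (eU a)) dot_suml.
  by apply: eq_bigr => d _; rewrite !mxE dotZl (dotC (b d)).
have [c c0 cE] := lebesgue_tuple_linear uN.
exists c => // A mA; rewrite -(cE _ mA); congr (L _ _).
have key t : \sum_(a < \dim U) (tnth t a : R) *: tnth (onb U) a =
    tcomb b (tmulmx N t).
  rewrite /tcomb; under eq_bigr => a _.
    rewrite (orthonormal_family_expand ob bU (eU a)) scaler_sumr; over.
  rewrite exchange_big/=; apply: eq_bigr => d _; rewrite tnth_mktuple scaler_suml.
  by apply: eq_bigr => a _; rewrite scalerA mxE.
apply/seteqP; split => t /=; rewrite key; first by case.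
move=> At; split => //; rewrite -key; apply: rpred_sum => a _.
by rewrite rpredZ.
Qed.

Lemma dim_lker_ge (U : {vspace V}) k (f : {linear V -> 'rV[R]_k}) :
  (\dim U - k <= \dim (U :&: lker (linfun f)))%N.
Proof.
have := limg_ker_dim (linfun f) U => <-.
rewrite leq_subLR addnC leq_add2r (leq_trans (dimvS (subvf _)))//.
by rewrite dimvf dim_matrix mul1r.
Qed.

(** Rank-nullity for the [k] linear forms given by the inner products with [g]. *)
Lemma vanishing_subspace (U : {vspace V}) k (g : 'I_k -> V) :
  exists W : {vspace V}, [/\ (\dim U - k <= \dim W)%N, (W <= U)%VS &
    forall x, x \in W -> forall a, dot x (g a) = 0].
Proof.
pose f (x : V) : 'rV[R]_k := \row_a dot x (g a).
have lf : linear f.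
  by move=> c x y; apply/rowP => a; rewrite !mxE dotDl dotZl.
pose F : {linear V -> 'rV[R]_k} := HB.pack f (GRing.isLinear.Build _ _ _ _ f lf).
exists (U :&: lker (linfun F))%VS; split; [exact: dim_lker_ge|exact: capvSl|].
move=> x; rewrite memv_cap memv_ker lfunE => /andP[_ /eqP/rowP fx] a.
by have := fx a; rewrite !mxE.
Qed.

(** The vectors of [U] orthogonal to the last [l] coordinate vectors form a subspace of dimension at
    least [\dim U - l]. Orthonormal vectors of that number are taken there, then completed by [l]
    vectors from their orthogonal complement in [U]. *)
Lemma adapted_basis l (U : {vspace V}) : (l <= n)%N -> (l <= \dim U)%N ->
  exists b : 'I_(\dim U) -> V,
    [/\ orthonormal_family b, forall a, b a \in U &
        forall (a : 'I_(\dim U)) (j : 'I_n), (a < \dim U - l)%N -> (n - l <= j)%N ->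
          b a 0 j = 0].
Proof.
move=> ln lU; set i : nat := \dim U.
have hj (j : 'I_l) : (n - l + j < n)%N.
  by rewrite -[ltnRHS](subnK ln) ltn_add2l.
have [W1 [dW1 W1U W1z]] :=
  vanishing_subspace U (fun j : 'I_l => basis_vec R (Ordinal (hj j))).
have [e [oe eW]] := orthonormal_extend dW1.
have [W2 [dW2 W2U W2z]] := vanishing_subspace U (tnth e).
have il : (l <= \dim W2)%N by rewrite (leq_trans _ dW2)// subKn.
have [f [of_ fW]] := orthonormal_extend il.
have ei : (i - l + l = i)%N by rewrite subnK.
pose b (a : 'I_i) : V := match fintype.split (cast_ord (esym ei) a) with
  inl c => tnth e c | inr c => tnth f c end.
exists b; split.
- move=> a c; rewrite -(inj_eq (@cast_ord_inj _ _ (esym ei))) /b.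
  move: (cast_ord _ a) (cast_ord _ c) => {}a {}c.
  case: (splitP a) => a' aa'; case: (splitP c) => c' cc'.
  + by rewrite oe -!val_eqE/= aa' cc'.
  + rewrite dotC W2z ?fW ?mem_tnth// (_ : (a == c) = false)//.
    by apply/negbTE; rewrite -val_eqE/= aa' cc' neq_ltn (leq_trans (ltn_ord a'))// leq_addr.
  + rewrite W2z ?fW ?mem_tnth// (_ : (a == c) = false)//.
    by apply/negbTE; rewrite -val_eqE/= aa' cc' neq_ltn orbC (leq_trans (ltn_ord c'))// leq_addr.
  + by rewrite of_ -!val_eqE/= aa' cc' eqn_add2l.
- move=> a; rewrite /b; case: splitP => c _.
    by apply: (subvP W1U); rewrite eW// mem_tnth.
  by apply: (subvP W2U); rewrite fW// mem_tnth.
- move=> a j ad nj; rewrite /b; case: splitP => c /= ac; last first.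
    by move: ad; rewrite ac ltnNge leq_addr.
  have jl : (j - (n - l) < l)%N by rewrite ltn_subLR// subnK.
  have jE : Ordinal (hj (Ordinal jl)) = j by apply/val_inj; rewrite /= subnKC.
  have := W1z _ (eW _ (mem_tnth c e)) (Ordinal jl); rewrite jE.
  rewrite /dot (bigD1 j)//= big1 ?addr0 => [|k kj].
    by rewrite /basis_vec mxE !eqxx mulr1.
  by rewrite /basis_vec mxE (negbTE kj) andbF mulr0.
Qed.

End AdaptedBasis.

(** * Sections of the body *)

Section StarBody.
Variables (R : realType) (n l : nat).
Local Notation V := 'rV[R]_n.
Local Notation T := (measurableTypeR R).
Local Notation L m := (@lebesgue_tuple R m).

Definition fst_dot (x y : V) : R := \sum_(j < n | (j < n - l)%N) x 0 j * y 0 j.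
Definition snd_dot (x y : V) : R := \sum_(j < n | ~~ (j < n - l)%N) x 0 j * y 0 j.
Definition fst_sq (x : V) : R := fst_dot x x.
Definition snd_sq (x : V) : R := snd_dot x x.

Lemma dot_split (x y : V) : dot x y = fst_dot x y + snd_dot x y.
Proof. by rewrite /dot (bigID (fun j : 'I_n => (j < n - l)%N)). Qed.

Lemma fst_sq_ge0 x : 0 <= fst_sq x.
Proof. by apply: sumr_ge0 => j _; rewrite -expr2 sqr_ge0. Qed.

Lemma snd_sq_ge0 x : 0 <= snd_sq x.
Proof. by apply: sumr_ge0 => j _; rewrite -expr2 sqr_ge0. Qed.

Lemma fst_sq_comb (c : R) x y :
  fst_sq (x + c *: y) = fst_sq x + 2 * c * fst_dot x y + c ^+ 2 * fst_sq y.
Proof.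
rewrite /fst_sq /fst_dot !mulr_sumr -!big_split/=; apply: eq_bigr => j _.
by rewrite !mxE; ring.
Qed.

Lemma snd_sq_comb (c : R) x y :
  snd_sq (x + c *: y) = snd_sq x + 2 * c * snd_dot x y + c ^+ 2 * snd_sq y.
Proof.
rewrite /snd_sq /snd_dot !mulr_sumr -!big_split/=; apply: eq_bigr => j _.
by rewrite !mxE; ring.
Qed.

Lemma fst_sqZ (c : R) x : fst_sq (c *: x) = c ^+ 2 * fst_sq x.
Proof.
by rewrite /fst_sq/fst_dot mulr_sumr; apply: eq_bigr => j _; rewrite !mxE; ring.
Qed.

Lemma snd_sqZ (c : R) x : snd_sq (c *: x) = c ^+ 2 * snd_sq x.
Proof.
by rewrite /snd_sq/snd_dot mulr_sumr; apply: eq_bigr => j _; rewrite !mxE; ring.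
Qed.

Lemma enorm_fst_part x : enorm (fst_part l x) ^+ 4 = fst_sq x ^+ 2.
Proof.
rewrite -[4%N]/(2 * 2)%N exprM /enorm sqr_sqrtr ?sumr_ge0//; last first.
  by move=> j _; exact: sqr_ge0.
congr (_ ^+ 2); rewrite /fst_sq /fst_dot [RHS]big_mkcond; apply: eq_bigr => j _.
by rewrite mxE; case: ifP => _; rewrite ?expr0n// expr2.
Qed.

Lemma enorm_snd_part x : enorm (snd_part l x) ^+ 4 = snd_sq x ^+ 2.
Proof.
rewrite -[4%N]/(2 * 2)%N exprM /enorm sqr_sqrtr ?sumr_ge0//; last first.
  by move=> j _; exact: sqr_ge0.
congr (_ ^+ 2); rewrite /snd_sq /snd_dot [RHS]big_mkcond; apply: eq_bigr => j _.
by rewrite mxE; case: ifP => _; rewrite ?expr0n// expr2.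
Qed.

Lemma B4E x : B4 R n l x = (fst_sq x ^+ 2 + snd_sq x ^+ 2 <= 1).
Proof. by rewrite /B4/= enorm_fst_part enorm_snd_part. Qed.

(** The origin is added because [star] is 0 there for nonzero [q], by the convention of [powR]. *)
Definition star_body q eta g : set V :=
  [set x | x = 0 \/ 1 <= star q l eta g (fst_sq x) (snd_sq x)].

Lemma measurable_sumT d (S : measurableType d) (I : finType) (P : pred I)
    (h : I -> S -> R) :
  (forall i, measurable_fun setT (h i)) ->
  measurable_fun setT (fun s => \sum_(i | P i) h i s).
Proof.
move=> mh; under eq_fun do rewrite big_mkcond.
by apply: measurable_sum => i; case: (P i).
Qed.

Lemma tcombE m (b : 'I_m -> V) t j :
  tcomb b t 0 j = \sum_a (tnth t a : R) * b a 0 j.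
Proof. by rewrite summxE; apply: eq_bigr => a _; rewrite mxE. Qed.

Lemma measurable_tcomb m (b : 'I_m -> V) j :
  measurable_fun setT (fun t : m.-tuple T => tcomb b t 0 j).
Proof.
under eq_fun do rewrite tcombE.
apply: measurable_sum => a; apply: measurable_funM => //; exact: measurable_tnth.
Qed.

Lemma measurable_fst_sq m (b : 'I_m -> V) :
  measurable_fun setT (fun t : m.-tuple T => fst_sq (tcomb b t)).
Proof.
by apply: measurable_sumT => j; apply: measurable_funM; exact: measurable_tcomb.
Qed.

Lemma measurable_snd_sq m (b : 'I_m -> V) :
  measurable_fun setT (fun t : m.-tuple T => snd_sq (tcomb b t)).
Proof.
by apply: measurable_sumT => j; apply: measurable_funM; exact: measurable_tcomb.
Qed.

Section coordinates.
Variables (k : nat) (b : 'I_k.+2 -> V).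
Hypotheses (ob : orthonormal_family b) (lk : (l <= k)%N).
Hypothesis bz : forall (a : 'I_k.+2) (j : 'I_n),
  (a < k.+2 - l)%N -> (n - l <= j)%N -> b a 0 j = 0.

Let X (t : k.+2.-tuple T) : R := fst_sq (tcomb b t).
Let Y (t : k.+2.-tuple T) : R := snd_sq (tcomb b t).

Let U (t : k.+2.-tuple T) : V :=
  \sum_(a < k.+2 | (a < k.+2 - l)%N) (tnth t a : R) *: b a.

Let up (a : 'I_k) : 'I_k.+2 := lift ord0 (lift ord0 a).

Let b2 (a : 'I_k) : V := if (up a < k.+2 - l)%N then 0 else b (up a).

Let r0 (w : k.-tuple T) : R :=
  \sum_(a < k | (up a < k.+2 - l)%N) (tnth w a : R) ^+ 2.

Lemma dot_tcomb t a : dot (tcomb b t) (b a) = tnth t a.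
Proof.
rewrite dot_suml (bigD1 a)//= big1 ?addr0 => [|c ca].
  by rewrite dotZl ob eqxx mulr1.
by rewrite dotZl ob (negbTE ca) mulr0.
Qed.

Let up_tail t a : tnth (tail2 t) a = tnth t (up a) :> R.
Proof. by rewrite !(tnth_nth 0) /= !nth_behead. Qed.

Let lt0d : (1 < k.+2 - l)%N.
Proof. by rewrite ltn_subRL addn1 !ltnS. Qed.

(** [U t] collects the basis vectors orthogonal to the x''-space, which are not scaled. There are at
    least two of them, so the scaled part depends on [tail2 t] only. *)
Lemma tcomb_last_scale s t :
  tcomb b (taffine (last_scale l s) (fun=> 0) t) = U t + s *: tcomb b2 (tail2 t).
Proof.
rewrite /tcomb (bigID (fun a : 'I_k.+2 => (a < k.+2 - l)%N))/=; congr (_ + _).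
  by apply: eq_bigr => a al; rewrite tnth_mktuple /last_scale al addr0 mul1r.
rewrite big_mkcond big_ord_recl/= (ltnW lt0d) add0r big_ord_recl/= lt0d add0r.
rewrite scaler_sumr; apply: eq_bigr => a _; rewrite -/(up a) /b2.
case: ifP => [/negbTE h|/negbFE ->]; last by rewrite !scaler0.
by rewrite h tnth_mktuple addr0 /last_scale h up_tail scalerA.
Qed.

Lemma fst_dot_U t x : fst_dot (U t) x = dot (U t) x.
Proof.
rewrite dot_split [X in _ + X]big1 ?addr0// => j; rewrite -leqNgt => nj.
by rewrite summxE big1 ?mul0r// => a al; rewrite mxE bz ?mulr0.
Qed.

Lemma snd_dot_U t x : snd_dot (U t) x = 0.
Proof. by have := dot_split (U t) x; rewrite fst_dot_U; lra. Qed.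

Lemma dot_U t : dot (U t) (U t) =
  tnth t ord0 ^+ 2 + tnth t (lift ord0 ord0) ^+ 2 + r0 (tail2 t).
Proof.
transitivity (\sum_(a < k.+2 | (a < k.+2 - l)%N) (tnth t a : R) ^+ 2).
  rewrite {1}/U big_mkcond dot_suml [RHS]big_mkcond; apply: eq_bigr => a _.
  case: ifP => al; last by rewrite -(scale0r 0) dotZl mul0r.
  rewrite dotZl expr2; congr (_ * _).
  rewrite dotC /U big_mkcond dot_suml (bigD1 a)//= al big1 ?addr0.
    by rewrite dotZl ob eqxx mulr1.
  move=> c ca; case: ifP => _; last by rewrite -(scale0r 0) dotZl mul0r.
  by rewrite dotZl ob (negbTE ca) mulr0.
rewrite big_mkcond big_ord_recl/= (ltnW lt0d) big_ord_recl/= lt0d addrA.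
congr (_ + _); rewrite /r0 [RHS]big_mkcond; apply: eq_bigr => a _.
by rewrite -/(up a) up_tail.
Qed.

Lemma dot_U_tail t w : dot (U t) (tcomb b2 w) = 0.
Proof.
rewrite /U big_mkcond dot_suml big1// => a _.
case: ifP => al; last by rewrite -(scale0r 0) dotZl mul0r.
rewrite dotZl dot_sumr big1 ?mulr0// => c _; rewrite dotZr /b2.
case: ifP => cl; first by rewrite dotC -(scale0r 0) dotZl mul0r mulr0.
rewrite ob (_ : a == up c = false) ?mulr0//.
by apply/negbTE; apply: contraTneq al => ->; rewrite cl.
Qed.

Lemma tcombZ (c : R) t : tcomb b (tscale c t) = c *: tcomb b t.
Proof.
rewrite /tcomb scaler_sumr; apply: eq_bigr => a _.
by rewrite tnth_mktuple scalerA.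
Qed.

Lemma enorm_tcomb t : X t + Y t = \sum_a (tnth t a : R) ^+ 2.
Proof.
rewrite /X /Y /fst_sq /snd_sq -dot_split {2}/tcomb dot_sumr.
by apply: eq_bigr => a _; rewrite dotZr dot_tcomb expr2.
Qed.

(** [U t] has no x''-component and is orthogonal to the scaled part. Hence the cross terms vanish in
    |x'|^2 and |x''|^2, and both have the form required by [adapted_section_le]. *)
Lemma coordinate_section_le eta g : star_admissible l eta g ->
  (L k.+2 [set t | star_body (k.+2%:R / 4) eta g (tcomb b t)] <=
   L k.+2 [set t | B4 R n l (tcomb b t)])%E /\
  (measurable [set t | star_body (k.+2%:R / 4) eta g (tcomb b t)] /\
   measurable [set t | B4 R n l (tcomb b t)]).
Proof.
move=> adm; have mX := measurable_fst_sq b; have mY := measurable_snd_sq b.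
have mstar : measurable_fun setT (fun t => star (k.+2%:R / 4) l eta g (X t) (Y t)).
  apply: measurable_funB; last by apply: measurable_funM => //; exact: measurable_quartic.
  by apply: measurable_funD; apply: measurable_funM => //; exact: measurable_quartic.
have BE : [set t | B4 R n l (tcomb b t)] = [set t | X t ^+ 2 + Y t ^+ 2 <= 1].
  by apply/seteqP; split => t; rewrite /= B4E.
have mB : measurable [set t | X t ^+ 2 + Y t ^+ 2 <= 1].
  by apply: measurable_set_ler => //; apply: measurable_funD; apply: measurable_funX.
pose A1 := [set t | 1 <= star (k.+2%:R / 4) l eta g (X t) (Y t)].
pose A0 := [set t | X t + Y t <= 0].
have mA1 : measurable A1 by apply: measurable_set_ler.
have mA0 : measurable A0 by apply: measurable_set_ler => //; exact: measurable_funD.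
have x0 t : (X t + Y t <= 0) <-> tcomb b t = 0.
  rewrite enorm_tcomb; split => [t0|tz]; last first.
    by rewrite -enorm_tcomb /X/Y tz -(scale0r 0) fst_sqZ snd_sqZ expr0n/= !mul0r addr0.
  have : \sum_a (tnth t a : R) ^+ 2 == 0.
    by rewrite eq_le t0 sumr_ge0// => a _; exact: sqr_ge0.
  rewrite psumr_eq0 => [/allP h|a _]; last exact: sqr_ge0.
  rewrite /tcomb big1// => a _.
  have := h a; rewrite mem_index_enum sqrf_eq0 => /(_ isT)/eqP ->.
  by rewrite scale0r.
have SE : [set t | star_body (k.+2%:R / 4) eta g (tcomb b t)] = A0 `|` A1.
  apply/seteqP; split => t /=.
    by case=> [h|h]; [left; apply/x0|right].
  by case=> [/x0 h|h]; [left|right].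
have mS : measurable (A0 `|` A1) by exact: measurableU.
rewrite SE BE; split; last by split; [exact: mS|exact: mB].
have -> : L k.+2 (A0 `|` A1) = L k.+2 A1.
  apply/esym; apply: lebesgue_tuple_hyperplane_eq.
  - exact: mA1.
  - exact: mS.
  - by move=> t h; right.
  move=> t [h|h]; last by left.
  by right; move: h => /x0 h; rewrite /= /thead -dot_tcomb h -(scale0r 0) dotZl mul0r.
apply: (@adapted_section_le _ _ _ X Y r0 (fun w => fst_sq (tcomb b2 w))
  (fun w => snd_sq (tcomb b2 w))) => //.
- by apply: measurable_sumT => a; apply: measurable_funX; exact: measurable_tnth.
- exact: measurable_fst_sq.
- exact: measurable_snd_sq.
- by move=> w; apply: sumr_ge0 => a _; exact: sqr_ge0.
- by move=> w; exact: fst_sq_ge0.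
- by move=> s t s0; rewrite /X tcomb_last_scale fst_sq_comb fst_dot_U dot_U_tail
    mulr0 addr0 /fst_sq fst_dot_U dot_U.
- move=> s t s0; rewrite /Y tcomb_last_scale snd_sq_comb snd_dot_U mulr0 addr0.
  by rewrite /snd_sq snd_dot_U add0r.
- by move=> c t c0; rewrite /X tcombZ fst_sqZ.
- by move=> c t c0; rewrite /Y tcombZ snd_sqZ.
- exact: enorm_tcomb.
Qed.

End coordinates.

Lemma star_body_section_le i eta g (xi : {vspace V}) :
  (l <= n)%N -> (l + 2 <= i)%N -> \dim xi = i -> star_admissible l eta g ->
  (vol_in xi (star_body (i%:R / 4) eta g `&` [set` xi]) <=
   vol_in xi (B4 R n l `&` [set` xi]))%E.
Proof.
move=> ln li dxi adm.
have lxi : (l <= \dim xi)%N by rewrite dxi (leq_trans _ li)// leq_addr.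
have [b [ob bxi bz]] := adapted_basis ln lxi.
have [c c0 cE] := vol_in_change_basis ob bxi.
suff [le [mS mB]] : (L _ [set t | star_body (i%:R / 4) eta g (tcomb b t)] <=
   L _ [set t | B4 R n l (tcomb b t)])%E /\
  (measurable [set t | star_body (i%:R / 4) eta g (tcomb b t)] /\
   measurable [set t | B4 R n l (tcomb b t)]).
  by rewrite !cE//; apply: lee_wpmul2l.
move: b ob bz {cE bxi}; rewrite dxi => b ob bz.
case: i li dxi b ob bz => [|[|k]] li dxi b ob bz.
- by exfalso; move: li; rewrite addn2.
- by exfalso; move: li; rewrite addn2.
by apply: coordinate_section_le => //; move: li; rewrite addn2 !ltnS.
Qed.

End StarBody.

(** * Volume *)

Section Kernel.
Variable R : realType.
Implicit Types a q X Y z tau : R.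

(** Integrand of K tau after rescaling x'', with a = (n - i) / 4 and q = i / 4: the first factor
    comes from rho_B^(n-i), the second from rho_(B_tau)^i. Only the first depends on [tau], and
    [tau = 0] makes sense. *)
Definition kernel a q tau X Y : R :=
  quartic a (tau ^+ 2) X Y * quartic q 1 X Y.

Lemma kernel_ge0 a q tau X Y : 0 <= kernel a q tau X Y.
Proof. by rewrite mulr_ge0// quartic_ge0. Qed.

Lemma powR_le1n a z : 0 <= a -> 1 <= z -> z `^ (- a) <= 1.
Proof.
move=> a0 z1; have -> : 1 = z `^ 0 by rewrite powRr0.
by apply: ler_powR => //; rewrite oppr_le0.
Qed.

Lemma powR_ge1p a z : 0 <= a -> 1 <= z -> 1 <= z `^ a.
Proof.
move=> a0 z1; have -> : 1 = z `^ 0 by rewrite powRr0.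
exact: ler_powR.
Qed.

Lemma powR_neg_bernoulli a z : 0 <= a -> 0 <= z -> 1 - a * z <= (1 + z) `^ (- a).
Proof.
move=> a0 z0; have z1 : 0 < 1 + z by rewrite ltr_pwDl.
rewrite /powR gt_eqF//; apply: le_trans (expR_ge1Dx _).
rewrite lerD2l mulNr lerN2 ler_wpM2l//.
have := expR_ge1Dx (ln (1 + z)); rewrite lnK ?posrE//; lra.
Qed.

(** For [z <= 1] this follows from the linear Bernoulli bound, since [z] is then below its power
    5/8; for [z >= 1] the right side is at least 1. *)
Lemma powR_neg_holder a z : 0 <= a -> 0 <= z ->
  1 - (1 + z) `^ (- a) <= (a + 1) * z `^ (5 / 8).
Proof.
move=> a0 z0; have b := powR_neg_bernoulli a0 z0.
have [z1|z1] := leP z 1.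
  have zz : z <= z `^ (5 / 8).
    move: z0; rewrite le_eqVlt => /orP[/eqP <-|z0]; first exact: powR_ge0.
    rewrite -[leLHS](powRr1 (ltW z0)); apply: ger_powR; first by rewrite z0.
    lra.
  have := powR_ge0 z (5 / 8); nra.
have zz : 1 <= z `^ (5 / 8) by apply: powR_ge1p; [lra|exact: ltW].
have := powR_ge0 (1 + z) (- a); nra.
Qed.

Lemma ge0_ler_powRn a z z' : 0 <= a -> 0 < z -> z <= z' -> z' `^ (- a) <= z `^ (- a).
Proof.
move=> a0 z0 zz'; have z'0 := lt_le_trans z0 zz'.
rewrite !powRN lef_pV2 ?posrE ?powR_gt0//.
by apply: ge0_ler_powR; rewrite ?nnegrE// ltW.
Qed.

Lemma ltr_powRn a z z' : 0 < a -> 0 < z -> z < z' -> z' `^ (- a) < z `^ (- a).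
Proof.
move=> a0 z0 zz'; have z'0 := lt_trans z0 zz'.
rewrite !powRN ltf_pV2 ?posrE ?powR_gt0//.
by apply: gt0_ltr_powR; rewrite ?nnegrE// ltW.
Qed.

Lemma kernel_nonincreasing a q tau tau' X Y : 0 <= a -> 0 < X -> 0 <= tau <= tau' ->
  kernel a q tau' X Y <= kernel a q tau X Y.
Proof.
move=> a0 X0 /andP[t0 tt']; rewrite ler_wpM2r ?quartic_ge0//.
apply: ge0_ler_powRn => //.
  by rewrite ltr_pwDl ?exprn_gt0// mulr_ge0 ?sqr_ge0.
rewrite lerD2l ler_wpM2r ?sqr_ge0//.
by rewrite ler_sqr ?nnegrE ?(le_trans t0 tt').
Qed.

Lemma kernel_gap_gt0 a q X Y : 0 < a -> 0 < X -> 0 < Y ->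
  kernel a q 1 X Y < kernel a q 0 X Y.
Proof.
move=> a0 X0 Y0; rewrite /kernel ltr_pM2r; last first.
  by rewrite powR_gt0// ltr_pwDl ?exprn_gt0// mulr_ge0 ?sqr_ge0.
rewrite /quartic expr0n/= mul0r addr0 expr1n mul1r; apply: ltr_powRn => //.
  by rewrite exprn_gt0.
by rewrite ltrDl exprn_gt0.
Qed.

(** The majorant decays like |x''|^(-l-1/2), which is integrable at infinity in R^l. *)
Lemma kernel_le_majorant (l : nat) a q tau X Y : 0 <= a -> (2 * l%:R + 1) / 8 <= q ->
  1 <= X -> kernel a q tau X Y <= (1 + Y ^+ 2) `^ (- ((2 * l%:R + 1) / 8)).
Proof.
move=> a0 lq X1; have Y0 := sqr_ge0 Y; have X21 : 1 <= X ^+ 2 by rewrite exprn_ege1.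
have l0 : 0 <= l%:R :> R by [].
have q0 : 0 <= q by lra.
rewrite -[leRHS]mul1r; apply: ler_pM; rewrite ?quartic_ge0//.
  apply: powR_le1n => //; apply: le_trans X21 _.
  by rewrite lerDl mulr_ge0 ?sqr_ge0.
apply: (@le_trans _ _ ((1 + Y ^+ 2) `^ (- q))).
  by apply: ge0_ler_powRn => //; [lra|rewrite mul1r lerD2r].
by apply: ler_powR; lra.
Qed.

(* The exponent 5/8 is chosen in (1/2, 3/4): above 1/2 the gap is [o(tau)] as *)
(* [tau] tends to 0, below 3/4 the majorant is integrable over the slab.      *)
Lemma kernel_gap_le (l : nat) a q tau X Y :
  0 <= a -> (2 * l%:R + 1) / 8 + 5 / 8 <= q -> 1 <= X ->
  kernel a q 0 X Y - kernel a q tau X Y <=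
  (a + 1) * (tau ^+ 2) `^ (5 / 8) * (1 + Y ^+ 2) `^ (- ((2 * l%:R + 1) / 8)).
Proof.
move=> a0 lq X1; have Y0 := sqr_ge0 Y; have X21 : 1 <= X ^+ 2 by rewrite exprn_ege1.
have l0 : 0 <= l%:R :> R by [].
have q0 : 0 <= q by lra.
have X20 : 0 < X ^+ 2 by lra.
set z := tau ^+ 2 * Y ^+ 2 / X ^+ 2.
have w0 : 0 <= tau ^+ 2 * Y ^+ 2 by rewrite mulr_ge0 ?sqr_ge0.
have z0 : 0 <= z by rewrite divr_ge0// ltW.
have zw : z <= tau ^+ 2 * Y ^+ 2.
  by rewrite ler_pdivrMr// ler_peMr.
have h1 : quartic a 0 X Y - quartic a (tau ^+ 2) X Y <=
    (a + 1) * ((tau ^+ 2) `^ (5 / 8) * (Y ^+ 2) `^ (5 / 8)).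
  have -> : quartic a 0 X Y = (X ^+ 2) `^ (- a).
    by rewrite /quartic mul0r addr0.
  have -> : quartic a (tau ^+ 2) X Y = (X ^+ 2) `^ (- a) * (1 + z) `^ (- a).
    rewrite /quartic -powRM ?ltW//; last by rewrite ltr_pwDl.
    by congr (_ `^ _); rewrite /z; field; rewrite gt_eqF// (lt_le_trans _ X1).
  have := powR_neg_holder a0 z0.
  have Xa1 : (X ^+ 2) `^ (- a) <= 1 by exact: powR_le1n.
  have Xa0 := powR_ge0 (X ^+ 2) (- a).
  have za1 : (1 + z) `^ (- a) <= 1 by apply: powR_le1n => //; lra.
  have : z `^ (5 / 8) <= (tau ^+ 2) `^ (5 / 8) * (Y ^+ 2) `^ (5 / 8).
    rewrite -powRM ?sqr_ge0//; apply: ge0_ler_powR; rewrite ?nnegrE//; lra.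
  move: ((1 + z) `^ (- a)) (z `^ (5 / 8)) (_ * _) ((X ^+ 2) `^ (- a)) Xa1 Xa0 za1.
  by move=> u v w s s1 s0 u1 vw h; nra.
rewrite /kernel expr0n/= -mulrBl.
apply: (@le_trans _ _ ((a + 1) * ((tau ^+ 2) `^ (5 / 8) * (Y ^+ 2) `^ (5 / 8)) *
  quartic q 1 X Y)).
  by rewrite ler_wpM2r ?quartic_ge0.
rewrite -!mulrA; do 2 (rewrite ler_wpM2l ?powR_ge0 ?addr_ge0//).
apply: (@le_trans _ _ ((1 + Y ^+ 2) `^ (5 / 8) * (1 + Y ^+ 2) `^ (- q))).
  apply: ler_pM; rewrite ?powR_ge0//.
    apply: ge0_ler_powR; rewrite ?nnegrE//; lra.
  by apply: ge0_ler_powRn => //; [lra|rewrite mul1r lerD2r].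
rewrite -powRD; last by apply/implyP => _; rewrite gt_eqF//; lra.
by apply: ler_powR; lra.
Qed.

End Kernel.

(** * Integrability over a slab *)

Section VolumeCoordinates.
Variable R : realType.
Local Notation T := (measurableTypeR R).
Local Notation L m := (@lebesgue_tuple R m).
Variables (k l : nat).
Hypotheses (lk : (l <= k)%N).

Definition row_of_tuple (t : k.+2.-tuple T) : 'rV[R]_k.+2 := \row_j tnth t j.

Definition vfst (t : k.+2.-tuple T) : R := fst_sq l (row_of_tuple t).
Definition vsnd (t : k.+2.-tuple T) : R := snd_sq l (row_of_tuple t).
(** The shell 1 <= |x'| < 2 for the gauge |x'|. It is unbounded in x'', so integrability has to be
    proved, but it is invariant under the rescaling of x''. *)
Definition slab : set (k.+2.-tuple T) := [set t | 1 <= Num.sqrt (vfst t) < 2].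

Lemma vfstE t : vfst t = \sum_(j < k.+2 | (j < k.+2 - l)%N) (tnth t j : R) ^+ 2.
Proof. by apply: eq_bigr => j _; rewrite mxE expr2. Qed.

Lemma vsndE t : vsnd t = \sum_(j < k.+2 | ~~ (j < k.+2 - l)%N) (tnth t j : R) ^+ 2.
Proof. by apply: eq_bigr => j _; rewrite mxE expr2. Qed.

Lemma vfst_ge0 t : 0 <= vfst t. Proof. exact: fst_sq_ge0. Qed.

Lemma measurable_vfst : measurable_fun setT vfst.
Proof.
rewrite (funext vfstE).
by apply: measurable_sumT => j; apply: measurable_funX; exact: measurable_tnth.
Qed.

Lemma measurable_vsnd : measurable_fun setT vsnd.
Proof.
rewrite (funext vsndE).
by apply: measurable_sumT => j; apply: measurable_funX; exact: measurable_tnth.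
Qed.

Lemma vfst_last_scale s t : vfst (taffine (last_scale l s) (fun=> 0) t) = vfst t.
Proof.
rewrite !vfstE; apply: eq_bigr => j jl.
by rewrite tnth_mktuple /last_scale jl mul1r addr0.
Qed.

Lemma vsnd_last_scale s t :
  vsnd (taffine (last_scale l s) (fun=> 0) t) = s ^+ 2 * vsnd t.
Proof.
rewrite !vsndE mulr_sumr; apply: eq_bigr => j /negbTE jl.
by rewrite tnth_mktuple /last_scale jl addr0 exprMn.
Qed.

Lemma measurable_sqrt_vfst : measurable_fun setT (fun t => Num.sqrt (vfst t)).
Proof.
apply: (measurableT_comp (f := @Num.sqrt R)); last exact: measurable_vfst.
by apply: continuous_measurable_fun; exact: sqrt_continuous.
Qed.

Lemma measurable_slab : measurable slab.
Proof.
have mp := measurable_sqrt_vfst.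
rewrite (_ : slab = [set t | 1 <= Num.sqrt (vfst t)] `&` [set t | Num.sqrt (vfst t) < 2]).
  by apply: measurableI; [apply: measurable_set_ler|apply: measurable_set_ltr].
by apply/seteqP; split => t /= /andP.
Qed.

Lemma slabP t : slab t -> 1 <= vfst t < 4.
Proof.
move=> /andP[s1 s2]; have s0 : 0 <= Num.sqrt (vfst t) by exact: sqrtr_ge0.
have := sqr_sqrtr (vfst_ge0 t).
by move: (Num.sqrt _) s1 s2 s0 => s s1 s2 s0 <-; apply/andP; split; nra.
Qed.

Definition majorant (t : k.+2.-tuple T) : R :=
  (1 + vsnd t ^+ 2) `^ (- ((2 * l%:R + 1) / 8)).

Lemma measurable_majorant : measurable_fun setT majorant.
Proof.
apply: (measurableT_comp (measurable_powR _)); apply: measurable_funD => //.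
by apply: measurable_funX; exact: measurable_vsnd.
Qed.

Let N j := slab `&` [set t | vsnd t <= 16 ^+ j.+1].

Let mN j : measurable (N j).
Proof.
apply: measurableI; first exact: measurable_slab.
by apply: measurable_set_ler => //; exact: measurable_vsnd.
Qed.

(** On [N j] one has |x'| < 2 and |x''| <= 4^(j+1); shrinking x'' by [s] puts [N j] inside the cube
    of side 4. *)
Let lebesgue_N j : (L k.+2 (N j) <= ((2 * 4 ^+ j) ^+ l * 4 ^+ k.+2)%:E)%E.
Proof.
set s : R := 2 * 4 ^+ j; have s0 : 0 < s by rewrite mulr_gt0 ?exprn_gt0.
have d0 i : 0 < last_scale l s^-1 i :> R.
  by rewrite /last_scale; case: ifP; rewrite ?invr_gt0.
have mC : measurable (tcube (-2) 2 : set (k.+2.-tuple T)) by exact: measurable_tcube.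
apply: (@le_trans _ _ (L k.+2 (taffine (last_scale l s^-1) (fun=> 0) @^-1` tcube (-2) 2))).
  apply: le_measure; rewrite ?inE//.
    by apply: measurable_preimageT => //; exact: measurable_taffine.
  move=> t [/slabP/andP[_ X4] /= Y16] i.
  rewrite -ler_norml tnth_mktuple addr0 /last_scale.
  have sq (x y : R) : 0 <= y -> x ^+ 2 <= y ^+ 2 -> `|x| <= y.
    by move=> y0 xy; rewrite -sqrtr_sqr -[leRHS](ger0_norm y0) -[leRHS]sqrtr_sqr ler_wsqrtr.
  apply: sq => //; case: ifPn => il.
    rewrite mul1r (le_trans _ (ltW (lt_le_trans X4 _)))//; last by rewrite -natrX ler_nat.
    by rewrite vfstE (bigD1 i)//= lerDl sumr_ge0// => ? _; exact: sqr_ge0.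
  rewrite exprMn exprVn ler_pdivrMl ?exprn_gt0//.
  have -> : s ^+ 2 * 2 ^+ 2 = 16 ^+ j.+1.
    have e : (4 ^+ j) ^+ 2 = 16 ^+ j :> R by rewrite -exprM mulnC exprM -natrX.
    by rewrite /s exprMn e [in RHS]exprS; ring.
  apply: le_trans Y16; rewrite vsndE (bigD1 i)//= lerDl sumr_ge0// => ? _.
  exact: sqr_ge0.
rewrite lebesgue_tuple_affine// prod_last_scale// lebesgue_tuple_cube; last by lra.
by rewrite -EFinM lee_fin exprVn invrK opprK -natrD.
Qed.

Let term (j : nat) (t : k.+2.-tuple T) : R := (2^-1) ^+ (j * (2 * l + 1)) * \1_(N j) t.

(** Take the least [j] with [vsnd t <= 16 ^+ j.+1]. If [j > 0], minimality gives [vsnd t > 16 ^+ j],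
    and [256 ^+ j] to the power -(2l+1)/8 is [2] to the power -j(2l+1). *)
Let majorant_le_term t : slab t -> exists j, majorant t <= term j t.
Proof.
move=> St.
have [j0 Yj0] : exists j, vsnd t <= 16 ^+ j.+1.
  exists (Num.truncn (vsnd t)); apply: (@le_trans _ _ ((Num.truncn (vsnd t)).+1%:R)).
    exact/ltW/truncnS_gt.
  by rewrite -(natrX R 16) ler_nat; apply/ltnW/ltn_expl.
have ex : exists j, (vsnd t <= 16 ^+ j.+1) by exists j0.
have [j Yj jmin] := ex_minnP ex; exists j.
rewrite /term indicE mem_set ?mulr1; last by split.
have l0 : 0 <= l%:R :> R by [].
have Y0 := sqr_ge0 (vsnd t).
case: j Yj jmin => [_ _|j Yj jmin].
  rewrite mul0n expr0; apply: powR_le1n; lra.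
have Yj' : 16 ^+ j.+1 < vsnd t.
  by rewrite ltNge; apply/negP => /jmin; rewrite ltnn.
have p16 : 0 < 16 ^+ j.+1 :> R by rewrite exprn_gt0.
apply: (@le_trans _ _ ((256 ^+ j.+1) `^ (- ((2 * l%:R + 1) / 8)))).
  apply: ge0_ler_powRn; [lra|by rewrite exprn_gt0|].
  have -> : 256 ^+ j.+1 = (16 ^+ j.+1) ^+ 2 :> R.
    by rewrite -exprM mulnC exprM; congr (_ ^+ _); rewrite -natrX.
  by nra.
rewrite (_ : 256 ^+ j.+1 = 2 `^ (8 * j.+1%:R)); last first.
  rewrite powRrM powR_mulrn ?powR_ge0//; congr (_ ^+ _).
  by rewrite (powR_mulrn 8)// -natrX.
rewrite -powRrM (_ : 8 * _ * _ = - (j.+1 * (2 * l + 1))%:R); last first.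
  by rewrite natrM natrD natrM; field.
by rewrite powR_invn// exprVn.
Qed.

(** Dyadic decomposition in |x''|: the integral of [term j] is at most 2^(-j(2l+1)) (2 * 4^j)^l
    4^(k+2), a constant times 2^(-j). *)
Lemma integral_majorant_fin : (\int[L k.+2]_(t in slab) (majorant t)%:E < +oo)%E.
Proof.
have mS := measurable_slab.
have term0 j t : 0 <= term j t by rewrite mulr_ge0 ?exprn_ge0 ?invr_ge0.
have mI j : measurable_fun setT (\1_(N j) : k.+2.-tuple T -> R).
  exact: measurable_indic.
have mterm j : measurable_fun slab (fun t => (term j t)%:E).
  by apply/measurable_EFinP/measurable_funTS; exact: measurable_funM.
apply: (@le_lt_trans _ _ (\int[L k.+2]_(t in slab) \sum_(j <oo) (term j t)%:E)%E).
  apply: ge0_le_integral => //.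
  - by move=> t _; rewrite lee_fin powR_ge0.
  - by apply/measurable_EFinP/measurable_funTS; exact: measurable_majorant.
  - apply: ge0_emeasurable_sum => [j t _ _|j _]; [by rewrite lee_fin|exact: mterm].
  move=> t St; have [j h] := majorant_le_term St.
  apply: (@le_trans _ _ (term j t)%:E); first by rewrite lee_fin.
  apply: le_trans (nneseries_lim_ge j.+1 _); last by move=> i _ _; rewrite lee_fin.
  rewrite big_nat_recr//=; apply: leeDr; apply: sume_ge0 => i _.
  by rewrite lee_fin.
rewrite integral_nneseries//; last by move=> j t _; rewrite lee_fin.
pose C : R := 2 ^+ l * 4 ^+ k.+2.
have C0 : 0 <= C by rewrite mulr_ge0 ?exprn_ge0.
have bd j : (\int[L k.+2]_(t in slab) (term j t)%:E <= (C * 2^-1 ^+ j)%:E)%E.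
  under eq_integral do rewrite EFinM.
  rewrite ge0_integralZl//; last first.
    by apply/measurable_EFinP/measurable_funTS; exact: mI.
  rewrite integral_indic//.
  have -> : N j `&` slab = N j by rewrite setIC; apply/setIidPr => t [].
  apply: (@le_trans _ _ ((2^-1 ^+ (j * (2 * l + 1)))%:E *
      ((2 * 4 ^+ j) ^+ l * 4 ^+ k.+2)%:E)%E).
    by apply: lee_wpmul2l; [rewrite lee_fin exprn_ge0|exact: lebesgue_N].
  rewrite -EFinM lee_fin /C le_eqVlt; apply/orP; left; apply/eqP.
  rewrite (_ : j * (2 * l + 1) = 2 * (j * l) + j)%N; last first.
    by rewrite mulnDr muln1 mulnCA.
  rewrite exprD exprM [(2 * _) ^+ l]exprMn -[4 ^+ j ^+ l]exprM.
  have h : (2^-1 ^+ 2) ^+ (j * l) * 4 ^+ (j * l) = 1 :> R.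
    by rewrite -exprMn (_ : 2^-1 ^+ 2 * 4 = 1) ?expr1n//; field.
  transitivity ((2^-1 ^+ 2) ^+ (j * l) * 4 ^+ (j * l) *
    (2 ^+ l * 4 ^+ k.+2 * 2^-1 ^+ j) : R); last by rewrite h mul1r.
  by ring.
apply: (@le_lt_trans _ _ (2 * C)%:E); last by rewrite ltry.
apply: lime_le; first by apply: is_cvg_nneseries => j _ _; apply: integral_ge0 => t _; rewrite lee_fin.
apply: nearW => M.
apply: (@le_trans _ _ (\sum_(0 <= j < M) (C * 2^-1 ^+ j)%:E)%E).
  by apply: lee_sum.
rewrite sumEFin lee_fin -mulr_sumr mulrC ler_wpM2r//.
rewrite big_mkord; have := subrX1 (2^-1 : R) M.
have : 0 <= 2^-1 ^+ M :> R by rewrite exprn_ge0// invr_ge0.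
move: (\sum_(_ < _) _) => s; lra.
Qed.

End VolumeCoordinates.

(** * Failure of convexity of K *)

Section KernelGap.
Variable R : realType.
Local Notation T := (measurableTypeR R).
Local Notation L m := (@lebesgue_tuple R m).
Variables (k l : nat) (a q : R).
Hypotheses (l0 : (0 < l)%N) (lk : (l <= k)%N) (a0 : 0 < a)
  (lq : (2 * l%:R + 1) / 8 + 5 / 8 <= q).

Local Notation X := (@vfst R k l).
Local Notation Y := (@vsnd R k l).
Local Notation S := (@slab R k l).

Definition kernel_integral (tau : R) : \bar R :=
  \int[L k.+2]_(t in S) (kernel a q tau (X t) (Y t))%:E.

Lemma measurable_kernel tau : measurable_fun setT (fun t => kernel a q tau (X t) (Y t)).
Proof.
by apply: measurable_funM; apply: measurable_quartic;
  [exact: measurable_vfst|exact: measurable_vsnd|exact: measurable_vfst|exact: measurable_vsnd].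
Qed.

Let mS : measurable S. Proof. exact: measurable_slab. Qed.

Let mfS (h : k.+2.-tuple T -> R) : measurable_fun setT h ->
  measurable_fun S (fun t => (h t)%:E).
Proof. by move=> mh; apply/measurable_EFinP; exact: measurable_funTS. Qed.

Let Xge1 t : S t -> 1 <= X t.
Proof. by case/slabP/andP. Qed.

Lemma kernel_integral_fin tau : exists2 v, kernel_integral tau = v%:E & 0 <= v.
Proof.
have K0 : (0 <= kernel_integral tau)%E.
  by apply: integral_ge0 => t _; rewrite lee_fin kernel_ge0.
have Koo : (kernel_integral tau < +oo)%E.
  apply: le_lt_trans (integral_majorant_fin R lk); apply: ge0_le_integral.
  - exact: mS.
  - by move=> t _; rewrite lee_fin kernel_ge0.
  - exact: (mfS (measurable_kernel _)).
  - exact: (mfS (@measurable_majorant R k l)).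
  - move=> t /Xge1 X1; rewrite lee_fin.
    by apply: kernel_le_majorant; [exact: ltW|apply: le_trans lq; rewrite lerDl; lra|exact: X1].
have Kf : kernel_integral tau \is a fin_num by rewrite (ge0_fin_numE K0).
by exists (fine (kernel_integral tau)); [rewrite fineK|exact: fine_ge0].
Qed.

Lemma kernel_integral_le0 tau : 0 <= tau ->
  (kernel_integral tau <= kernel_integral 0)%E.
Proof.
move=> t0; apply: ge0_le_integral.
- exact: mS.
- by move=> t _; rewrite lee_fin kernel_ge0.
- exact: (mfS (measurable_kernel _)).
- exact: (mfS (measurable_kernel _)).
- move=> t /Xge1 X1; rewrite lee_fin; apply: kernel_nonincreasing; [exact: ltW|lra|].
  by rewrite lexx.
Qed.

(** Integrates [kernel_gap_le]; [D] is [a + 1] times the integral of the majorant. The power of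
    [tau] is 5/4, which exceeds 1. *)
Lemma kernel_integral_gap_le : exists2 D : R, 0 <= D & forall tau,
  (kernel_integral 0 <= kernel_integral tau + (D * (tau ^+ 2) `^ (5 / 8))%:E)%E.
Proof.
have M0 : (0 <= \int[L k.+2]_(t in S) (majorant l t)%:E)%E.
  by apply: integral_ge0 => t _; rewrite lee_fin powR_ge0.
have Mf : (\int[L k.+2]_(t in S) (majorant l t)%:E)%E \is a fin_num.
  by rewrite (ge0_fin_numE M0); exact: integral_majorant_fin.
pose D0 := fine (\int[L k.+2]_(t in S) (majorant l t)%:E)%E.
have D00 : 0 <= D0 by exact: fine_ge0.
exists ((a + 1) * D0) => [|tau]; first by rewrite mulr_ge0// addr_ge0// ltW.
have c0 : 0 <= (a + 1) * (tau ^+ 2) `^ (5 / 8).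
  by rewrite mulr_ge0 ?powR_ge0// addr_ge0// ltW.
rewrite (_ : ((a + 1) * D0 * _)%:E = ((a + 1) * (tau ^+ 2) `^ (5 / 8))%:E *
    \int[L k.+2]_(t in S) (majorant l t)%:E)%E; last first.
  by rewrite -(fineK Mf) -EFinM mulrAC.
have mm : measurable_fun S (fun t => (majorant l t)%:E).
  exact: (mfS (@measurable_majorant R k l)).
have m0 t : S t -> (0 <= (majorant l t)%:E)%E by rewrite lee_fin powR_ge0.
rewrite -(ge0_integralZl _ mS mm m0); last by rewrite lee_fin.
rewrite -(ge0_integralD _ mS); first last.
- exact: measurable_funeM.
- by move=> t St; apply: mule_ge0; [rewrite lee_fin|exact: m0].
- exact: (mfS (measurable_kernel _)).
- by move=> t _; rewrite lee_fin kernel_ge0.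
apply: ge0_le_integral.
- exact: mS.
- by move=> t _; rewrite lee_fin kernel_ge0.
- exact: (mfS (measurable_kernel _)).
- apply: emeasurable_funD; last exact: measurable_funeM.
  exact: (mfS (measurable_kernel _)).
- move=> t /Xge1 X1; rewrite -EFinM -EFinD lee_fin -lerBlDl.
  by apply: kernel_gap_le; [exact: ltW| |].
Qed.

(** The integrand strictly decreases from [tau = 0] to [tau = 1] wherever x'' is nonzero. If the
    integrals agreed, a null set would contain all such points of the slab, in particular a cube of
    positive volume. *)
Lemma kernel_integral_lt : (kernel_integral 1 < kernel_integral 0)%E.
Proof.
pose d t := kernel a q 0 (X t) (Y t) - kernel a q 1 (X t) (Y t).
have md : measurable_fun setT d by apply: measurable_funB; exact: measurable_kernel.
have d0 t : S t -> 0 <= d t.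
  move=> /Xge1 X1; rewrite subr_ge0; apply: kernel_nonincreasing; [exact: ltW|lra|].
  by rewrite lexx ler01.
have K0E : kernel_integral 0 = (kernel_integral 1 + \int[L k.+2]_(t in S) (d t)%:E)%E.
  rewrite -(ge0_integralD _ mS).
  - by apply: eq_integral => t _; rewrite -EFinD addrC subrK.
  - by move=> t _; rewrite lee_fin kernel_ge0.
  - exact: (mfS (measurable_kernel _)).
  - by move=> t St; rewrite lee_fin d0.
  - exact: mfS.
have dge0 : (0 <= \int[L k.+2]_(t in S) (d t)%:E)%E.
  by apply: integral_ge0 => t St; rewrite lee_fin d0.
suff dn0 : (\int[L k.+2]_(t in S) (d t)%:E != 0)%E.
  rewrite K0E; have [v -> v0] := kernel_integral_fin 1.
  rewrite -[ltLHS]adde0 lteD2lE//.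
  by rewrite lt_neqAle dge0 andbT eq_sym.
apply/eqP => dI0.
have dabs : (\int[L k.+2]_(t in S) `|(d t)%:E| = 0)%E.
  rewrite -[RHS]dI0; apply: eq_integral => t; rewrite inE => St.
  by rewrite gee0_abs// lee_fin d0.
have /(ae_eq_integral_abs (L k.+2) mS (mfS md)) := dabs.
move=> [B [mB B0 SB]].
pose P (j : 'I_k.+2) := (j < k.+2 - l)%N.
pose N : R := \sum_(j | P j) 1.
have P0 : P ord0 by rewrite /P subn_gt0 (leq_ltn_trans lk).
have N1 : 1 <= N.
  by rewrite /N (bigD1 ord0)//= lerDl sumr_ge0.
have s0 : 0 < Num.sqrt N by rewrite sqrtr_gt0; lra.
have sN : Num.sqrt N ^+ 2 = N by rewrite sqr_sqrtr//; lra.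
set s := Num.sqrt N in s0 sN.
have sV0 : 0 < s^-1 by rewrite invr_gt0.
(* [s ^+ 2] is the number of coordinates of x', so on this cube |x'|^2 lies between 1 and 9/4, and
   x'' is nonzero since [l > 0]. *)
have sub : tcube s^-1 (3 / 2 * s^-1) `<=` B.
  move=> t ht; apply: SB => /= h.
  have lb j : s ^- 2 <= (tnth t j : R) ^+ 2.
    have /andP[t1 _] := ht j.
    by rewrite -exprVn ler_sqr ?nnegrE ?(le_trans _ t1)// ltW.
  have ub j : (tnth t j : R) ^+ 2 <= 9 / 4 * s ^- 2.
    have /andP[t1 t2] := ht j.
    have -> : 9 / 4 * s ^- 2 = (3 / 2 * s^-1) ^+ 2 by rewrite exprMn exprVn; field; rewrite gt_eqF.
    by rewrite ler_sqr ?nnegrE ?(le_trans _ t1) ?mulr_ge0// ltW.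
  have NN : s ^- 2 * N = 1 by rewrite sN mulVf// gt_eqF//; lra.
  have X1 : 1 <= X t.
    rewrite -NN vfstE /N mulr_sumr; apply: ler_sum => j _; rewrite mulr1; exact: lb.
  have X2 : X t <= 9 / 4.
    have -> : 9 / 4 = 9 / 4 * s ^- 2 * N by rewrite -mulrA NN mulr1.
    rewrite vfstE /N mulr_sumr; apply: ler_sum => j _; rewrite mulr1; exact: ub.
  have Y0 : 0 < Y t.
    rewrite vsndE (bigD1 ord_max)/=.
      apply: ltr_pwDl; last by apply: sumr_ge0 => j _; exact: sqr_ge0.
      by apply: lt_le_trans (lb _); rewrite invr_gt0 exprn_gt0.
    by rewrite -leqNgt leq_subLR -[k.+2]add1n leq_add2r.
  have St : S t.
    have q0 := sqrtr_ge0 (X t); have := sqr_sqrtr (vfst_ge0 l t).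
    rewrite /slab/=; move: (Num.sqrt (X t)) q0 => u u0 uu.
    by apply/andP; split; nra.
  have := h St => -[] /eqP; rewrite subr_eq0 => /eqP E.
  have := kernel_gap_gt0 q a0 (lt_le_trans ltr01 X1) Y0.
  by rewrite E ltxx.
have : (L k.+2 (tcube s^-1 (3 / 2 * s^-1)) <= L k.+2 B)%E.
  by apply: le_measure; rewrite ?inE//; exact: measurable_tcube.
rewrite lebesgue_tuple_cube; last by lra.
rewrite [X in (_ <= X)%E]B0 lee_fin leNgt exprn_gt0//; lra.
Qed.

(** Since [tmid g <= 2 * g], K at [tmid g] is at least K 0 minus a constant times g^(5/4). For small
    [g] the loss is below g (K 0 - K 1), so the value exceeds g K 1 + (1 - g) K 0, and K g <= K
    0. *)
Lemma kernel_gap : exists g : R, [/\ 0 < g, g < 1 &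
  (g%:E * kernel_integral 1 + (1 - g)%:E * kernel_integral g <
   kernel_integral (tmid g))%E].
Proof.
have [D D0 HD] := kernel_integral_gap_le.
have := kernel_integral_lt.
have [k0 k0E _] := kernel_integral_fin 0.
have [k1 k1E _] := kernel_integral_fin 1.
rewrite k0E k1E lte_fin => k10.
pose del := k0 - k1; have del0 : 0 < del by rewrite subr_gt0.
pose C := D * 4 `^ (5 / 8).
have C0 : 0 <= C by rewrite mulr_ge0 ?powR_ge0.
(* With g = e^4 the loss C g^(5/4) becomes e^4 (C e); the choice of [e] ensures [C * e < del] and
   [e < 1]. *)
pose e := del / (C + del + 1).
have den0 : 0 < C + del + 1 by lra.
have e0 : 0 < e by rewrite divr_gt0.
have e1 : e < 1 by rewrite ltr_pdivrMr//; lra.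
have Ce : C * e < del.
  rewrite mulrA ltr_pdivrMr// mulrC ltr_pM2l//; lra.
have g0 : 0 < e ^+ 4 by rewrite exprn_gt0.
have g1 : e ^+ 4 < 1 by rewrite exprn_ilt1// ltW.
exists (e ^+ 4); split => //.
have [kg kgE _] := kernel_integral_fin (e ^+ 4).
have [kt ktE _] := kernel_integral_fin (tmid (e ^+ 4)).
have := kernel_integral_le0 (ltW g0).
have := HD (tmid (e ^+ 4)).
rewrite k0E kgE ktE -EFinD !lee_fin => h1 h2.
have t0 := tmid_gt0 g0 g1.
have t2 : (tmid (e ^+ 4) ^+ 2) `^ (5 / 8) <= 4 `^ (5 / 8) * e ^+ 5.
  have -> : 4 `^ (5 / 8) * e ^+ 5 = (4 * e ^+ 8) `^ (5 / 8).
    rewrite powRM ?exprn_ge0 ?ltW//; congr (_ * _).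
    rewrite -(powR_mulrn 8 (ltW e0)) -powRrM -(powR_mulrn 5 (ltW e0)).
    by congr (_ `^ _); field.
  have p1 : tmid (e ^+ 4) ^+ 2 \in Num.nneg by rewrite nnegrE sqr_ge0.
  have p2 : 4 * e ^+ 8 \in Num.nneg.
    by rewrite nnegrE mulr_ge0//; exact: exprn_ge0 (ltW e0).
  have p12 : tmid (e ^+ 4) ^+ 2 <= 4 * e ^+ 8.
    have -> : 4 * e ^+ 8 = (2 * e ^+ 4) ^+ 2 by ring.
    have t2g : tmid (e ^+ 4) <= 2 * e ^+ 4 by rewrite /tmid; nra.
    by rewrite ler_sqr// nnegrE; [exact: ltW|exact: le_trans (ltW t0) t2g].
  by apply: ge0_ler_powR => //; lra.
have h3 : D * (tmid (e ^+ 4) ^+ 2) `^ (5 / 8) <= e ^+ 4 * (C * e).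
  have -> : e ^+ 4 * (C * e) = D * (4 `^ (5 / 8) * e ^+ 5) by rewrite /C; ring.
  by rewrite ler_wpM2l.
have h4 : e ^+ 4 * (C * e) < e ^+ 4 * del by rewrite ltr_pM2l.
rewrite -!EFinM -EFinD lte_fin.
have h5 : (1 - e ^+ 4) * kg <= (1 - e ^+ 4) * k0 by rewrite ler_wpM2l// subr_ge0 ltW.
move: h1 h3 h4 h5; rewrite /del.
move: (e ^+ 4) (C * e) (D * _) => g u v; nra.
Qed.

End KernelGap.

(** * Volume of the body *)

Section StarBodyVolume.
Variable R : realType.
Local Notation T := (measurableTypeR R).
Local Notation L m := (@lebesgue_tuple R m).
Variables (k l : nat).
Hypotheses (lk : (l <= k)%N).

Local Notation X := (@vfst R k l).
Local Notation Y := (@vsnd R k l).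
Local Notation S := (@slab R k l).

Let mS : measurable S. Proof. exact: measurable_slab. Qed.

Let mfS (h : k.+2.-tuple T -> R) : measurable_fun setT h ->
  measurable_fun S (fun t => (h t)%:E).
Proof. by move=> mh; apply/measurable_EFinP; exact: measurable_funTS. Qed.

Let mq b c : measurable_fun setT (fun t => quartic b c (X t) (Y t)).
Proof.
by apply: measurable_quartic; [exact: measurable_vfst|exact: measurable_vsnd].
Qed.

Lemma vfst_tscale c t : X (tscale c t) = c ^+ 2 * X t.
Proof.
rewrite !vfstE mulr_sumr; apply: eq_bigr => j _.
by rewrite tnth_mktuple exprMn.
Qed.

Lemma vsnd_tscale c t : Y (tscale c t) = c ^+ 2 * Y t.
Proof.
rewrite !vsndE mulr_sumr; apply: eq_bigr => j _.
by rewrite tnth_mktuple exprMn.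
Qed.

Lemma vfst_eq0 t : X t = 0 -> thead t = 0.
Proof.
rewrite vfstE => /eqP; rewrite psumr_eq0 => [/allP/(_ ord0)|j _]; last exact: sqr_ge0.
rewrite mem_index_enum => /(_ isT)/implyP; rewrite subn_gt0 (leq_ltn_trans lk)//.
by rewrite sqrf_eq0 => /(_ isT)/eqP.
Qed.

Lemma slab_polar (f : k.+2.-tuple T -> R) : measurable_fun setT f ->
  (forall t, 0 <= f t) ->
  (forall c t, 0 < c -> f (tscale c t) * c ^+ k.+2 = f t) ->
  (\int[L k.+2]_(t in S) (f t)%:E =
   (ln 2 *+ k.+2)%:E * L k.+2 [set t | (1 <= f t)%R])%E.
Proof.
move=> mf f0 fZ.
apply: (@polar_integral _ _ (fun t => Num.sqrt (X t)) f).
- exact: measurable_sqrt_vfst.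
- exact: mf.
- by move=> t; exact: sqrtr_ge0.
- exact: f0.
- move=> c t c0; rewrite vfst_tscale sqrtrM ?sqr_ge0// sqrtr_sqr gtr0_norm//.
- exact: fZ.
- move=> t /eqP; rewrite sqrtr_eq0 => X0; apply: vfst_eq0.
  by apply/le_anti; rewrite X0 vfst_ge0.
Qed.

Lemma integral_slab_indic (h : k.+2.-tuple T -> R) :
  (\int[L k.+2]_(t in S) (h t)%:E = \int[L k.+2]_t (h t * \1_S t)%:E)%E.
Proof.
rewrite integral_mkcond; apply: eq_integral => t _.
by rewrite patchE indicE; case: (t \in S); rewrite ?mulr1 ?mulr0.
Qed.

(** Substitution of sqrt(tau) x'' for x'': the slab restricts x' only, hence is unchanged, and [tau]
    moves from the second factor to the first. *)
Lemma kernel_integral_scale a q tau : 0 < tau ->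
  ((Num.sqrt tau ^- l)%:E *
    \int[L k.+2]_(t in S) (quartic a 1 (X t) (Y t) * quartic q (tau ^- 2) (X t) (Y t))%:E =
   kernel_integral k l a q tau)%E.
Proof.
move=> tau0; rewrite /kernel_integral !integral_slab_indic.
have d0 (j : 'I_k.+2) : 0 < last_scale l (Num.sqrt tau) j :> R.
  by rewrite /last_scale; case: ifP => _ //; rewrite sqrtr_gt0.
rewrite -(prod_last_scale lk).
have m1S : measurable_fun setT (\1_S : k.+2.-tuple T -> R) by exact: measurable_indic.
rewrite -(ge0_integral_tuple_affine (fun=> 0) d0); last 2 first.
- apply/measurable_EFinP; apply: measurable_funM => //.
  by apply: measurable_funM; exact: mq.
- by move=> t; rewrite lee_fin !mulr_ge0 ?quartic_ge0.
apply: eq_integral => t _; congr EFin.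
have -> : \1_S (taffine (last_scale l (Num.sqrt tau)) (fun=> 0) t) = \1_S t :> R.
  rewrite !indicE; congr (nat_of_bool _)%:R.
  by apply/idP/idP; rewrite !inE /slab/= vfst_last_scale.
congr (_ * _); rewrite vfst_last_scale vsnd_last_scale sqr_sqrtr ?ltW//.
rewrite /kernel /quartic; congr (_ `^ _ * _ `^ _); first by rewrite exprMn mul1r.
by rewrite exprMn mulrA mulVf ?expf_neq0// gt_eqF.
Qed.

Variables (i : nat) (eta g : R).
Hypotheses (i0 : (0 < i)%N) (ik : (i <= k.+1)%N).
Let m := (k.+2 - i)%N.
Let q : R := i%:R / 4.
Let a : R := m%:R / 4.
Hypotheses (adm : star_admissible l eta g) (eta0 : 0 < eta).
Local Notation K := (kernel_integral k l a q).
Hypothesis Kfin : forall tau, exists2 v, K tau = v%:E & 0 <= v.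
Hypothesis gap : (g%:E * K 1 + (1 - g)%:E * K g < K (tmid g))%E.

Let u t := star q l eta g (X t) (Y t).
Let v t := quartic a 1 (X t) (Y t).

Let m0 : (0 < m)%N. Proof. by rewrite subn_gt0 ltnS. Qed.
Let mi : m%:R + i%:R = k.+2%:R :> R.
Proof. by rewrite -natrD subnK// ltnW. Qed.
Let q0 : 0 < q. Proof. by rewrite divr_gt0// ltr0n. Qed.
Let a0 : 0 < a. Proof. by rewrite divr_gt0// ltr0n. Qed.
Let aq : a + q = k.+2%:R / 4. Proof. by rewrite /a /q -mi; field. Qed.

Let u0 t : 0 <= u t.
Proof. by apply: star_ge0 => //; exact: ltW. Qed.

Let mu : measurable_fun setT u.
Proof.
apply: measurable_funB; last by apply: measurable_funM => //; exact: mq.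
by apply: measurable_funD; apply: measurable_funM => //; exact: mq.
Qed.

(** By linearity and [kernel_integral_scale] the right side is K 1 + eta (K (tmid g) - g K 1 - (1 -
    g) K g). *)
Lemma integral_product_gt : (K 1 < \int[L k.+2]_(t in S) (u t * v t)%:E)%E.
Proof.
have [g0 g1 _ _] := adm; have t0 := tmid_gt0 g0 g1.
pose w c t := quartic a 1 (X t) (Y t) * quartic q c (X t) (Y t).
have w0 c t : 0 <= w c t by rewrite mulr_ge0 ?quartic_ge0.
have mw c : measurable_fun S (fun t => (w c t)%:E).
  by apply: mfS; apply: measurable_funM; exact: mq.
have muv : measurable_fun S (fun t => (u t * v t)%:E).
  by apply: mfS; apply: measurable_funM => //; exact: mq.
have uv0 t : S t -> (0 <= (u t * v t)%:E)%E.
  by rewrite lee_fin mulr_ge0 ?quartic_ge0.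
have wS b c t : 0 <= b -> S t -> (0 <= (b%:E * (w c t)%:E))%E.
  by move=> b0 _; rewrite mule_ge0 ?lee_fin.
have mwS b c : measurable_fun S (fun t => b%:E * (w c t)%:E)%E.
  exact: measurable_funeM.
set b1 := 1 - eta * g.
have b10 : 0 <= b1.
  case: adm => _ _ _; apply: le_trans.
  by rewrite !mulr_ge0 ?subr_ge0 ?invr_ge0 ?exprn_ge0 ?sqrtr_ge0 ?(ltW g1) ?ltW.
set b2 := eta * (Num.sqrt (tmid g) ^- l).
have b20 : 0 <= b2 by rewrite !mulr_ge0 ?invr_ge0 ?exprn_ge0 ?sqrtr_ge0 ?ltW.
set b3 := eta * (1 - g) * (Num.sqrt g ^- l).
have b30 : 0 <= b3.
  by rewrite !mulr_ge0 ?subr_ge0 ?invr_ge0 ?exprn_ge0 ?sqrtr_ge0 ?(ltW g1) ?ltW.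
have : (\int[L k.+2]_(t in S) ((u t * v t)%:E + b3%:E * (w (g ^- 2) t)%:E) =
  \int[L k.+2]_(t in S) (b1%:E * (w 1 t)%:E + b2%:E * (w (tmid g ^- 2) t)%:E))%E.
  apply: eq_integral => t _; rewrite -!EFinM -!EFinD /w /u /v /star -/b1 -/b2 -/b3.
  by congr EFin; ring.
rewrite (ge0_integralD _ mS uv0 muv (fun t => wS _ _ t b30) (mwS _ _)).
rewrite (ge0_integralD _ mS (fun t => wS _ _ t b10) (mwS _ _)
  (fun t => wS _ _ t b20) (mwS _ _)).
have wZ b c : 0 <= b -> (\int[L k.+2]_(t in S) (b%:E * (w c t)%:E) =
    b%:E * \int[L k.+2]_(t in S) (w c t)%:E)%E.
  move=> b0; apply: ge0_integralZl => //.
  by move=> t _; rewrite lee_fin.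
rewrite (wZ _ _ b10) (wZ _ _ b20) (wZ _ _ b30).
have -> : (b2%:E * \int[L k.+2]_(t in S) (w (tmid g ^- 2) t)%:E = eta%:E * K (tmid g))%E.
  by rewrite -(kernel_integral_scale _ _ t0) muleA -EFinM.
have -> : (b3%:E * \int[L k.+2]_(t in S) (w (g ^- 2) t)%:E =
    (eta * (1 - g))%:E * K g)%E.
  by rewrite -(kernel_integral_scale _ _ g0) muleA -EFinM.
have -> : (\int[L k.+2]_(t in S) (w 1 t)%:E = K 1)%E.
  by apply: eq_integral => t _; rewrite /w /kernel expr1n.
move: gap; have [k1 -> _] := Kfin 1; have [kg -> _] := Kfin g.
have [kt -> _] := Kfin (tmid g).
have : (0 <= \int[L k.+2]_(t in S) (u t * v t)%:E)%E by exact: integral_ge0.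
case: (integral _ _ _) => [I| |] I0.
- rewrite -!EFinM -!EFinD !lte_fin => gp [] E.
  have := ltr_pM2l eta0 (g * k1 + (1 - g) * kg) kt; rewrite gp.
  by rewrite /b1 in E; nra.
- by move=> _ _; rewrite ltry.
- by [].
Qed.

(** Young's inequality with exponents n / i and n / (n - i). The power of [v] integrates to K 1, so
    K 1 < (i / n) I + ((n - i) / n) K 1, where I is the right side. *)
Lemma integral_powR_gt :
  (K 1 < \int[L k.+2]_(t in S) (u t `^ (k.+2%:R / i%:R))%:E)%E.
Proof.
have ii : 0 < i%:R :> R by rewrite ltr0n.
have mm : 0 < m%:R :> R by rewrite ltr0n.
have kk : 0 < k.+2%:R :> R by rewrite ltr0n.
have young t : u t * v t <= i%:R / k.+2%:R * u t `^ (k.+2%:R / i%:R) +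
    m%:R / k.+2%:R * kernel a q 1 (X t) (Y t).
  have pq : (k.+2%:R / i%:R)^-1 + (k.+2%:R / m%:R)^-1 = 1 :> R.
    by rewrite !invf_div -mulrDl addrC mi mulfV// gt_eqF.
  have := conjugate_powR (u0 t) (quartic_ge0 a 1 (X t) (Y t))
    (divr_gt0 kk ii) (divr_gt0 kk mm) pq.
  move=> /le_trans; apply; rewrite !invf_div [X in _ <= X + _]mulrC lerD2l.
  rewrite mulrC ler_wpM2l ?divr_ge0//.
  rewrite /kernel /quartic expr1n -powRrM -powRD; last first.
    by apply/implyP; rewrite -opprD aq oppr_eq0 gt_eqF// divr_gt0.
  rewrite (_ : - a * (k.+2%:R / m%:R) = - a - q)//.
  by rewrite -opprD aq /a; field; rewrite gt_eqF.
have mup : measurable_fun setT (fun t => u t `^ (k.+2%:R / i%:R)).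
  exact: (measurableT_comp (measurable_powR _) mu).
have := integral_product_gt.
have le : (\int[L k.+2]_(t in S) (u t * v t)%:E <=
  (i%:R / k.+2%:R)%:E * \int[L k.+2]_(t in S) (u t `^ (k.+2%:R / i%:R))%:E +
  (m%:R / k.+2%:R)%:E * K 1)%E.
  have c1 : (0 <= (i%:R / k.+2%:R)%:E :> \bar R)%E by rewrite lee_fin divr_ge0.
  have c2 : (0 <= (m%:R / k.+2%:R)%:E :> \bar R)%E by rewrite lee_fin divr_ge0.
  have mk := mfS (@measurable_kernel R k l a q 1).
  have f1 t : S t -> (0 <= (u t `^ (k.+2%:R / i%:R))%:E)%E by rewrite lee_fin powR_ge0.
  have f2 t : S t -> (0 <= (kernel a q 1 (X t) (Y t))%:E)%E by rewrite lee_fin kernel_ge0.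
  rewrite -(ge0_integralZl _ mS (mfS mup) f1 c1) -(ge0_integralZl _ mS mk f2 c2).
  rewrite -(ge0_integralD _ mS); first last.
  - exact: measurable_funeM.
  - by move=> t St; rewrite mule_ge0// f2.
  - by apply: measurable_funeM; exact: mfS.
  - by move=> t St; rewrite mule_ge0// f1.
  apply: ge0_le_integral.
  - exact: mS.
  - by move=> t _; rewrite lee_fin mulr_ge0// quartic_ge0.
  - by apply: mfS; apply: measurable_funM => //; exact: mq.
  - by apply: emeasurable_funD; apply: measurable_funeM => //; exact: mfS.
  - by move=> t _; rewrite -!EFinM -EFinD lee_fin.
move=> /lt_le_trans/(_ le); have [k1 -> k10] := Kfin 1.
have : (0 <= \int[L k.+2]_(t in S) (u t `^ (k.+2%:R / i%:R))%:E)%E.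
  by apply: integral_ge0 => t _; rewrite lee_fin powR_ge0.
case: (integral _ _ _) => [I| |] I0 //; last by rewrite ltry.
rewrite -!EFinM -EFinD !lte_fin => h.
have : k1 * k.+2%:R < i%:R * I + m%:R * k1.
  have -> : i%:R * I + m%:R * k1 =
      (i%:R / k.+2%:R * I + m%:R / k.+2%:R * k1) * k.+2%:R.
    by field; rewrite gt_eqF.
  by rewrite ltr_pM2r.
by rewrite -mi mulrDr addrC [k1 * m%:R]mulrC ltrD2r mulrC ltr_pM2l.
Qed.

(** Both sides of [integral_powR_gt] have integrands homogeneous of degree -n, so the polar formula
    turns them into volumes with the same factor. *)
Lemma lebesgue_star_gt :
  (L k.+2 [set t | (X t ^+ 2 + Y t ^+ 2 <= 1)%R] < L k.+2 [set t | (1 <= u t)%R])%E.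
Proof.
have l2e : (0 < (ln 2 *+ k.+2 : R)%:E)%E.
  rewrite lte_fin; exact: ln2_mulrn_gt0.
have l2f : (ln 2 *+ k.+2 : R)%:E \is a fin_num by [].
have ii : 0 < i%:R :> R by rewrite ltr0n.
have kk : 0 < k.+2%:R :> R by rewrite ltr0n.
pose f t := u t `^ (k.+2%:R / i%:R).
pose h t := quartic (k.+2%:R / 4) 1 (X t) (Y t).
have mf : measurable_fun setT f.
  exact: (measurableT_comp (measurable_powR _) mu).
have f0 t : 0 <= f t by exact: powR_ge0.
have h0 t : 0 <= h t by exact: quartic_ge0.
have fZ (c : R) t : 0 < c -> f (tscale c t) * c ^+ k.+2 = f t.
  move=> c0; have [g0 _ _ _] := adm; have c0' := ltW c0.
  rewrite /f /u vfst_tscale vsnd_tscale starZ ?exprn_gt0//.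
  rewrite powRM ?powR_ge0//; last exact: u0.
  rewrite mulrAC -powRrM.
  rewrite (_ : - (2 * q) * _ = - (2 * (k.+2%:R / 4))); last first.
    by rewrite /q; field; rewrite gt_eqF.
  by rewrite powR_neg_half_dim// mul1r.
have hZ (c : R) t : 0 < c -> h (tscale c t) * c ^+ k.+2 = h t.
  move=> c0; rewrite /h vfst_tscale vsnd_tscale quarticZ ?exprn_gt0//.
  by rewrite mulrAC powR_neg_half_dim// mul1r.
have fE : [set t | 1 <= f t] = [set t | 1 <= u t].
  have p0 : 0 < k.+2%:R / i%:R :> R by rewrite divr_gt0.
  have one : 1 `^ (k.+2%:R / i%:R) = 1 :> R by rewrite powR1.
  apply/seteqP; split => t /= h1; last first.
    by rewrite /f -[leLHS]one; apply: ge0_ler_powR; rewrite ?nnegrE ?u0// ltW.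
  rewrite leNgt; apply/negP => ut; move: h1; rewrite leNgt => /negP; apply.
  by rewrite /f -[ltRHS]one; apply: gt0_ltr_powR; rewrite ?nnegrE ?u0.
have := integral_powR_gt; rewrite -/f (slab_polar mf f0 fZ) fE.
have -> : K 1 = (\int[L k.+2]_(t in S) (h t)%:E)%E.
  apply: eq_integral => t _; rewrite /kernel /h /quartic expr1n -powRD.
    by rewrite -opprD aq.
  by apply/implyP; rewrite -opprD aq oppr_eq0 gt_eqF// divr_gt0.
rewrite (slab_polar (mq _ _) h0 hZ) (lte_pmul2l l2f l2e).
suff -> : L k.+2 [set t | 1 <= h t] = L k.+2 [set t | X t ^+ 2 + Y t ^+ 2 <= 1] by [].
have k40 : 0 < k.+2%:R / 4 :> R by rewrite divr_gt0.
apply: lebesgue_tuple_hyperplane_eq.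
- by apply: measurable_set_ler => //; exact: mq.
- apply: measurable_set_ler => //; apply: measurable_funD; apply: measurable_funX.
    exact: measurable_vfst.
  exact: measurable_vsnd.
- by move=> t /=; rewrite /h (quartic_ge1 _ _ k40 ler01) mul1r => /andP[].
move=> t /= XY1.
have := vfst_ge0 l t; rewrite le_eqVlt => /orP[/eqP/esym X0|X0].
  by right; exact: vfst_eq0.
left; rewrite /= /h (quartic_ge1 _ _ k40 ler01) mul1r XY1 andbT.
by rewrite ltr_pwDl ?exprn_gt0// sqr_ge0.
Qed.

End StarBodyVolume.

(** * Convexity *)

Section SupportLines.
Variable R : realType.

(** The mean value theorem is applied to [psi], then to [dpsi]. *)
Lemma convex_tangent (psi dpsi ddpsi : R -> R) :
  (forall t : R, 0 <= t <= 1 -> is_derive t (1 : R) psi (dpsi t)) ->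
  (forall t : R, 0 <= t <= 1 -> is_derive t (1 : R) dpsi (ddpsi t)) ->
  (forall t : R, 0 <= t <= 1 -> 0 <= ddpsi t) ->
  psi 0 + dpsi 0 <= psi 1.
Proof.
move=> d1 d2 dd0.
have sub (c d t : R) : 0 <= c -> d <= 1 -> t \in `[c, d]%R -> 0 <= t <= 1.
  by move=> c0 d01; rewrite in_itv/= => /andP[ct td]; rewrite (le_trans c0 ct) (le_trans td d01).
have cont (f df : R -> R) (c d : R) : 0 <= c -> d <= 1 ->
    (forall t : R, 0 <= t <= 1 -> is_derive t (1 : R) f (df t)) ->
    {within `[c, d]%classic, continuous f}.
  move=> c0 d01 fd; apply: derivable_within_continuous => t tcd.
  by have [] := fd _ (sub _ _ _ c0 d01 tcd).
have oo (c d t : R) : t \in `]c, d[%R -> t \in `[c, d]%R.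
  by rewrite !in_itv/= => /andP[/ltW -> /ltW ->].
have [] := @MVT_segment R psi dpsi 0 1 ler01.
- by move=> t /oo tc; apply: d1; exact: sub tc.
- exact: (cont _ dpsi).
move=> c c01; rewrite subr0 mulr1 => E.
have /andP[c0 c1] := sub _ _ _ (lexx _) (lexx _) c01.
have [] := @MVT_segment R dpsi ddpsi 0 c c0.
- by move=> t /oo tc; apply: d2; exact: sub tc.
- exact: (cont _ ddpsi).
move=> e e01 E2.
have := dd0 _ (sub _ _ _ (lexx _) c1 e01).
rewrite -lerBrDl E => e0; rewrite -subr_ge0 E2 subr0; exact: mulr_ge0.
Qed.

Lemma is_derive1D (f g : R -> R) (x df dg : R) : is_derive x 1 f df -> is_derive x 1 g dg ->
  is_derive x 1 (fun t => f t + g t) (df + dg).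
Proof. by move=> hf hg; exact: is_deriveD. Qed.

Lemma is_derive1M (f g : R -> R) (x df dg : R) : is_derive x 1 f df -> is_derive x 1 g dg ->
  is_derive x 1 (fun t => f t * g t) (df * g x + f x * dg).
Proof.
move=> hf hg; have := is_deriveM hf hg.
by move=> /is_derive_eq; apply; rewrite addrC [X in X + _]mulrC.
Qed.

Lemma is_derive1Ml (c : R) (f : R -> R) (x df : R) : is_derive x 1 f df ->
  is_derive x 1 (fun t => c * f t) (c * df).
Proof.
by move=> hf; have := is_derive1M (is_derive_cst c x 1) hf; rewrite mul0r add0r.
Qed.

Lemma is_derive_affine (x u t : R) : is_derive t (1 : R) (fun s => x + s * u) u.
Proof.
have := is_derive1D (is_derive_cst x t 1)
  (is_derive1M (is_derive_id t (1 : R)) (is_derive_cst u t 1)).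
by move=> /is_derive_eq; apply; rewrite /cst/= mulr0 addr0 add0r mul1r.
Qed.

Lemma is_derive_affine_sq (x u t : R) :
  is_derive t (1 : R) (fun s => (x + s * u) ^+ 2) (2 * u * (x + t * u)).
Proof.
rewrite (_ : (fun s => _) = (fun s => (x + s * u) * (x + s * u))); last first.
  by apply/funext => s; rewrite expr2.
have := is_derive1M (is_derive_affine x u t) (is_derive_affine x u t).
by move=> /is_derive_eq; apply; ring.
Qed.

Lemma powRS (x p : R) : 0 < x -> x `^ (p - 1) * x = x `^ p.
Proof.
move=> x0; rewrite -{2}[x]powRr1 ?ltW// -powRD ?subrK//.
by apply/implyP => _; rewrite gt_eqF.
Qed.

Lemma is_derive1_powR_comp (a : R) (f : R -> R) (x df : R) : 0 < f x ->
  is_derive x 1 f df -> is_derive x 1 (fun t => f t `^ a) (a * f x `^ (a - 1) * df).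
Proof.
move=> f0 hf; have hp := is_derive1_powR a f0.
exact: (@is_derive1_comp _ (fun y => y `^ a) f).
Qed.

End SupportLines.

(** * Convexity of the radial functional in (X, Y) *)

Section SupportFunctional.
Variables (R : realType) (q b1 b2 b3 k2 k3 K : R).
Hypotheses (q0 : 0 < q) (b1_gt0 : 0 < b1) (b2_ge0 : 0 <= b2) (b3_ge0 : 0 <= b3).
Hypotheses (k21 : 1 <= k2) (k2K : k2 <= K) (k31 : 1 <= k3) (k3K : k3 <= K).
Hypotheses (b3_small : 2 * K ^+ 2 * b3 <= b1)
  (b2_small : 4 * (2 * q + 1) * K ^+ 2 * b2 <= b1).

Let K1 : 1 <= K. Proof. exact: le_trans k2K. Qed.

(** [star] with abstract coefficients. The hypotheses on [b2] and [b3] say that the perturbation is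
    small compared with the term of B. *)
Definition quartic_comb (X Y : R) : R :=
  b1 * quartic q 1 X Y + b2 * quartic q k2 X Y - b3 * quartic q k3 X Y.

Let base_gt0 (k X Y : R) : 1 <= k -> 0 <= X -> 0 <= Y -> 0 < X + Y ->
  0 < X ^+ 2 + k * Y ^+ 2.
Proof.
move=> k1 X0 Y0 XY; have h : 0 < (X + Y) ^+ 2 by rewrite exprn_gt0.
have h2 : 0 <= (k - 1) * Y ^+ 2 by rewrite mulr_ge0 ?sqr_ge0// subr_ge0.
by have h3 := sqr_ge0 (X - Y); nra.
Qed.

Let b3_le : b3 <= b1 / 2.
Proof.
have K2 : 1 <= K ^+ 2 by rewrite exprn_ege1// K1.
have := ler_wpM2r b3_ge0 K2; have := b3_small; rewrite ler_pdivlMr//; lra.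
Qed.

Let Kb3_le : K * b3 <= b1 / 2.
Proof.
have K2 : K <= K ^+ 2 by have := K1; nra.
have := ler_wpM2r b3_ge0 K2; have := b3_small; rewrite ler_pdivlMr//; lra.
Qed.

Let pow_mono (k X Y p : R) : 0 <= p -> 1 <= k -> 0 <= X -> 0 <= Y -> 0 < X + Y ->
  (X ^+ 2 + k * Y ^+ 2) `^ (- p) <= (X ^+ 2 + 1 * Y ^+ 2) `^ (- p).
Proof.
move=> p0 k1 X0 Y0 XY; apply: ge0_ler_powRn => //; first exact: base_gt0.
by rewrite lerD2l ler_wpM2r// sqr_ge0.
Qed.

Lemma quartic_comb_gt0 (X Y : R) : 0 <= X -> 0 <= Y -> 0 < X + Y -> 0 < quartic_comb X Y.
Proof.
move=> X0 Y0 XY; have h3 := pow_mono (ltW q0) k31 X0 Y0 XY.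
have g1 : 0 < quartic q 1 X Y by rewrite powR_gt0//; exact: base_gt0.
have g2 : 0 <= quartic q k2 X Y by exact: quartic_ge0.
have g3 : 0 <= quartic q k3 X Y by exact: quartic_ge0.
have b2g : 0 <= b2 * quartic q k2 X Y by rewrite mulr_ge0.
have := b3_le; have := b1_gt0; have := b3_ge0.
rewrite /quartic_comb; rewrite -/(quartic q k3 X Y) -/(quartic q 1 X Y) in h3.
move: (quartic q 1 X Y) (quartic q k2 X Y) (quartic q k3 X Y) g1 g2 g3 h3 b2g.
by move=> u v w u0 v0 w0 wu; nra.
Qed.

(* Lagrange's identity: the left-hand side is [D ^ 2] times a form in the     *)
(* coefficients in which the first coefficient dominates.                     *)
Lemma discriminant_ge0 (X Y U V e1 e2 e3 : R) :
  let r k := X ^+ 2 + k * Y ^+ 2 in let rho k := X * U + k * Y * V in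
  let sigma k := U ^+ 2 + k * V ^+ 2 in
  0 <= e1 -> 0 <= e2 -> e2 <= e1 -> 0 <= e3 -> e3 <= e1 ->
  0 <= (2 * q + 1) * (b1 * (e1 * r 1 * rho 1) + b2 * (e2 * r k2 * rho k2) -
      b3 * (e3 * r k3 * rho k3)) ^+ 2 +
    (b1 * (e1 * r 1 ^+ 2) + b2 * (e2 * r k2 ^+ 2) - b3 * (e3 * r k3 ^+ 2)) *
    (b1 * (e1 * (sigma 1 * r 1 - 2 * (q + 1) * rho 1 ^+ 2)) +
     b2 * (e2 * (sigma k2 * r k2 - 2 * (q + 1) * rho k2 ^+ 2)) -
     b3 * (e3 * (sigma k3 * r k3 - 2 * (q + 1) * rho k3 ^+ 2))).
Proof.
move=> r rho sigma e10 e20 e21 e30 e31.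
pose A1 := b1 * (e1 * r 1 ^+ 2) + b2 * (e2 * r k2 ^+ 2) - b3 * (e3 * r k3 ^+ 2).
pose A2 := b1 * e1 + b2 * e2 * k2 - b3 * e3 * k3.
pose C := b1 * b2 * (e1 * e2) * (k2 - 1) ^+ 2 - b1 * b3 * (e1 * e3) * (k3 - 1) ^+ 2
   - b2 * b3 * (e2 * e3) * (k2 - k3) ^+ 2.
set N := (X in 0 <= X).
have -> : N = (X * V - Y * U) ^+ 2 * (A1 * A2 - (2 * q + 1) * C * (X * Y) ^+ 2).
  by rewrite /N /A1 /A2 /C /r /rho /sigma; ring.
apply: mulr_ge0; first exact: sqr_ge0.
have k20 : 0 <= k2 := le_trans ler01 k21.
have k30 : 0 <= k3 := le_trans ler01 k31.
have K0 : 0 <= K := le_trans ler01 K1.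
have [bp k2' k3' k2K' k3K'] := And5 b1_gt0 k21 k31 k2K k3K.
have r0 : 0 <= r 1 by rewrite /r mul1r addr_ge0// sqr_ge0.
have r3K : 0 <= r k3 <= K * r 1.
  rewrite /r; have := sqr_ge0 X; have := sqr_ge0 Y => Y0 X0; apply/andP; split.
    by rewrite addr_ge0// mulr_ge0//; lra.
  by have : k3 * Y ^+ 2 <= K * Y ^+ 2 by [rewrite ler_wpM2r]; nra.
(* [b3_small] keeps half of the first terms of [A1] and [A2], so [A1 * A2] is at least a quarter of
   the square of [b1 * e1 * r 1]; [b2_small] is what makes this dominate the term with [C]. *)
have E1 : e1 * r 1 ^+ 2 * (b1 / 2) <= A1.
  have h : b3 * (e3 * r k3 ^+ 2) <= e1 * r 1 ^+ 2 * (b1 / 2).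
    have /andP[r30 r31] := r3K.
    have rr : r k3 ^+ 2 <= K ^+ 2 * r 1 ^+ 2.
      by rewrite -exprMn ler_sqr ?nnegrE ?mulr_ge0.
    apply: (@le_trans _ _ (b3 * (e1 * (K ^+ 2 * r 1 ^+ 2)))).
      by rewrite ler_wpM2l// ler_pM ?sqr_ge0.
    have K2b3 : K ^+ 2 * b3 <= b1 / 2.
      by have := b3_small; rewrite ler_pdivlMr//; lra.
    rewrite (_ : b3 * _ = e1 * r 1 ^+ 2 * (K ^+ 2 * b3)); last by ring.
    by rewrite ler_wpM2l// mulr_ge0// sqr_ge0.
  have : 0 <= b2 * (e2 * r k2 ^+ 2) by rewrite mulr_ge0// mulr_ge0// sqr_ge0.
  by rewrite /A1; move: (r 1 ^+ 2) (b3 * _) (b2 * _) h => z w3 w2 h w20; lra.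
have E2 : e1 * (b1 / 2) <= A2.
  have h : b3 * e3 * k3 <= e1 * (b1 / 2).
    apply: (@le_trans _ _ (b3 * e1 * K)).
      by apply: ler_pM => //; [exact: mulr_ge0|exact: ler_wpM2l].
    rewrite (_ : b3 * e1 * K = e1 * (K * b3)); last by ring.
    by rewrite ler_wpM2l.
  have : 0 <= b2 * e2 * k2 by rewrite !mulr_ge0.
  by rewrite /A2; move: (b3 * e3 * k3) (b2 * e2 * k2) h => w3 w2 h w20; lra.
have E12 : (e1 * r 1 * (b1 / 2)) ^+ 2 <= A1 * A2.
  apply: le_trans (ler_pM _ _ E1 E2); first by rewrite le_eqVlt; apply/orP; left; apply/eqP; ring.
    apply: mulr_ge0; last by rewrite divr_ge0// ltW.
    by apply: mulr_ge0 => //; exact: sqr_ge0.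
  by apply: mulr_ge0 => //; rewrite divr_ge0// ltW.
have XY2 : (X * Y) ^+ 2 <= r 1 ^+ 2.
  by have := sqr_ge0 X; have := sqr_ge0 Y; rewrite /r mul1r exprMn => Y0 X0; nra.
have C1 : C <= b1 * b2 * (e1 * e1) * K ^+ 2.
  have h1 : 0 <= b1 * b3 * (e1 * e3) * (k3 - 1) ^+ 2.
    by rewrite mulr_ge0 ?sqr_ge0// !mulr_ge0// ltW.
  have h2 : 0 <= b2 * b3 * (e2 * e3) * (k2 - k3) ^+ 2.
    by rewrite mulr_ge0 ?sqr_ge0// !mulr_ge0.
  have h3 : b1 * b2 * (e1 * e2) * (k2 - 1) ^+ 2 <= b1 * b2 * (e1 * e1) * K ^+ 2.
    apply: ler_pM; rewrite ?sqr_ge0//; first by rewrite !mulr_ge0// ltW.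
      by apply: ler_wpM2l; [apply: mulr_ge0 => //; exact: ltW|exact: ler_wpM2l].
    by rewrite ler_sqr ?nnegrE//; lra.
  by rewrite /C; lra.
have q1 : 0 <= 2 * q + 1 by have := q0; lra.
rewrite subr_ge0; apply: le_trans E12.
apply: (@le_trans _ _ ((2 * q + 1) * (b1 * b2 * (e1 * e1) * K ^+ 2) * r 1 ^+ 2)).
  apply: (@le_trans _ _ ((2 * q + 1) * (b1 * b2 * (e1 * e1) * K ^+ 2) * (X * Y) ^+ 2)).
    by rewrite ler_wpM2r ?sqr_ge0// ler_wpM2l.
  rewrite ler_wpM2l// mulr_ge0// mulr_ge0 ?sqr_ge0//.
  by rewrite mulr_ge0// mulr_ge0// ltW.
rewrite (_ : _ * r 1 ^+ 2 = e1 ^+ 2 * r 1 ^+ 2 * b1 * ((2 * q + 1) * K ^+ 2 * b2)); last by ring.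
rewrite (_ : (e1 * _ * _) ^+ 2 = e1 ^+ 2 * r 1 ^+ 2 * b1 * (b1 / 4)); last by field.
rewrite ler_wpM2l//.
  by apply: mulr_ge0; [apply: mulr_ge0; exact: sqr_ge0|exact: ltW].
by have := b2_small; rewrite ler_pdivlMr//; lra.
Qed.

(** G^(-1/(2q)) is homogeneous of degree 1 and convex on the quadrant, so its gradient at a point is
    a supporting functional, with equality there by Euler's relation. Nonnegativity of [a] and [b]
    makes a |x'|^2 + b |x''|^2 convex in x. *)
Lemma quartic_comb_support (X0 Y0 : R) : 0 <= X0 -> 0 <= Y0 -> 0 < X0 + Y0 ->
  exists a b, [/\ 0 <= a, 0 <= b,
    a * X0 + b * Y0 = quartic_comb X0 Y0 `^ (- (2 * q)^-1) &
    forall X1 Y1, 0 <= X1 -> 0 <= Y1 -> 0 < X1 + Y1 ->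
      a * X1 + b * Y1 <= quartic_comb X1 Y1 `^ (- (2 * q)^-1)].
Proof.
move=> X00 Y00 XY0; set s := (2 * q)^-1.
have sq : s * (2 * q) = 1 by rewrite mulVf// gt_eqF// mulr_gt0.
pose w k X Y := (X ^+ 2 + k * Y ^+ 2) `^ (- q - 1) : R.
have wE k X Y : 1 <= k -> 0 <= X -> 0 <= Y -> 0 < X + Y ->
    quartic q k X Y = w k X Y * (X ^+ 2 + k * Y ^+ 2).
  move=> k1 Xp Yp XYp; have r0 := base_gt0 k1 Xp Yp XYp.
  by rewrite /quartic /w powRS.
pose g0 := quartic_comb X0 Y0 `^ (- s - 1).
have G0 := quartic_comb_gt0 X00 Y00 XY0.
(* The gradient of G at the base point is -2q times (A, B), so that of G^(-s) is [g0] times (A, B),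
   because [s * (2 * q) = 1]. *)
pose A := X0 * (b1 * w 1 X0 Y0 + b2 * w k2 X0 Y0 - b3 * w k3 X0 Y0).
pose B := Y0 * (b1 * w 1 X0 Y0 + b2 * k2 * w k2 X0 Y0 - b3 * k3 * w k3 X0 Y0).
have w0 k : 0 <= w k X0 Y0 by exact: powR_ge0.
have w3 : w k3 X0 Y0 <= w 1 X0 Y0.
  by rewrite /w -opprD; apply: pow_mono => //; have := q0; lra.
have A0 : 0 <= A.
  rewrite mulr_ge0// subr_ge0 (@le_trans _ _ (b1 * w 1 X0 Y0))//.
    by apply: ler_pM => //; have := b3_le; have := b1_gt0; lra.
  by rewrite lerDl mulr_ge0.
have B0 : 0 <= B.
  rewrite mulr_ge0// subr_ge0 (@le_trans _ _ (b1 * w 1 X0 Y0))//.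
    apply: ler_pM => //; first by rewrite mulr_ge0//; have := k31; lra.
    apply: (@le_trans _ _ (b3 * K)); first by rewrite ler_wpM2l.
    by have := Kb3_le; have := b1_gt0; lra.
  by rewrite lerDl mulr_ge0// mulr_ge0//; have := k21; lra.
have E0 : g0 * A * X0 + g0 * B * Y0 = quartic_comb X0 Y0 `^ (- s).
  transitivity (g0 * (A * X0 + B * Y0)); first by ring.
  have -> : A * X0 + B * Y0 = quartic_comb X0 Y0.
    by rewrite /quartic_comb !wE// /A /B; ring.
  by rewrite /g0 powRS.
exists (g0 * A), (g0 * B); split.
- by rewrite mulr_ge0// powR_ge0.
- by rewrite mulr_ge0// powR_ge0.
- exact: E0.
move=> X1 Y1 X10 Y10 XY1.
pose U := X1 - X0; pose V := Y1 - Y0.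
pose x t := X0 + t * U; pose y t := Y0 + t * V.
have xy (t : R) : 0 <= t <= 1 -> [/\ 0 <= x t, 0 <= y t & 0 < x t + y t].
  move=> /andP[t0 t1]; have t1' : 0 <= 1 - t by rewrite subr_ge0.
  have conv (c d : R) : c + t * (d - c) = (1 - t) * c + t * d by ring.
  rewrite /x /y /U /V; split; [by rewrite conv addr_ge0// mulr_ge0..|].
  rewrite addrACA -mulrDr addrACA -opprD.
  have [h|h] := leP (X0 + Y0) (X1 + Y1).
    by rewrite ltr_pwDl// mulr_ge0// subr_ge0.
  have -> : X0 + Y0 + t * (X1 + Y1 - (X0 + Y0)) =
    X1 + Y1 + (1 - t) * (X0 + Y0 - (X1 + Y1)) by ring.
  by rewrite ltr_pwDl// mulr_ge0// subr_ge0 ltW.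
pose r k t := x t ^+ 2 + k * y t ^+ 2.
pose rho k t := x t * U + k * y t * V.
pose sigma (k : R) := U ^+ 2 + k * V ^+ 2.
have r0 k t : 1 <= k -> 0 <= t <= 1 -> 0 < r k t.
  by move=> k1 /xy[xt yt xyt]; exact: base_gt0.
have dr (k t : R) : is_derive t (1 : R) (r k) (2 * rho k t).
  have := is_derive1D (is_derive_affine_sq X0 U t)
    (is_derive1Ml k (is_derive_affine_sq Y0 V t)).
  by move=> /is_derive_eq; apply; rewrite /rho /x /y; ring.
have drho (k t : R) : is_derive t (1 : R) (rho k) (sigma k).
  rewrite (_ : rho k = (fun u => U * x u + k * V * y u)); last first.
    by apply/funext => u; rewrite /rho; ring.
  have := is_derive1D (is_derive1Ml U (is_derive_affine X0 U t))
    (is_derive1Ml (k * V) (is_derive_affine Y0 V t)).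
  by move=> /is_derive_eq; apply; rewrite /sigma; ring.
have dpow (p k t : R) : 1 <= k -> 0 <= t <= 1 ->
    is_derive t (1 : R) (fun u => r k u `^ p) (p * r k t `^ (p - 1) * (2 * rho k t)).
  by move=> k1 t01; exact: is_derive1_powR_comp (r0 _ _ k1 t01) (dr k t).
pose g t := quartic_comb (x t) (y t).
pose H t := b1 * (rho 1 t * r 1 t `^ (- q - 1)) + b2 * (rho k2 t * r k2 t `^ (- q - 1))
  - b3 * (rho k3 t * r k3 t `^ (- q - 1)).
pose hd k t := sigma k * r k t `^ (- q - 1) +
  rho k t * ((- q - 1) * r k t `^ (- q - 1 - 1) * (2 * rho k t)).
pose dH t := b1 * hd 1 t + b2 * hd k2 t - b3 * hd k3 t.
have g0' (t : R) : 0 <= t <= 1 -> 0 < g t.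
  by move=> /xy[xt yt xyt]; exact: quartic_comb_gt0.
have dg (t : R) : 0 <= t <= 1 -> is_derive t (1 : R) g (- (2 * q) * H t).
  move=> t01.
  have := is_derive1D (is_derive1D (is_derive1Ml b1 (dpow (- q) 1 t (lexx _) t01))
    (is_derive1Ml b2 (dpow (- q) k2 t k21 t01)))
    (is_derive1Ml (- b3) (dpow (- q) k3 t k31 t01)).
  rewrite (_ : (fun _ => _) = g); last first.
    by apply/funext => u; rewrite /g /quartic_comb mulNr.
  by move=> /is_derive_eq; apply; rewrite /H; ring.
have dHd (t : R) : 0 <= t <= 1 -> is_derive t (1 : R) H (dH t).
  move=> t01.
  have := is_derive1D (is_derive1D
     (is_derive1Ml b1 (is_derive1M (drho 1 t) (dpow (- q - 1) 1 t (lexx _) t01)))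
     (is_derive1Ml b2 (is_derive1M (drho k2 t) (dpow (- q - 1) k2 t k21 t01))))
    (is_derive1Ml (- b3) (is_derive1M (drho k3 t) (dpow (- q - 1) k3 t k31 t01))).
  rewrite (_ : (fun _ => _) = H); last by apply/funext => u; rewrite /H mulNr.
  by move=> /is_derive_eq; apply; rewrite /dH /hd; ring.
pose psi t := g t `^ (- s).
pose dpsi t := g t `^ (- s - 1) * H t.
pose ddpsi t := (- s - 1) * g t `^ (- s - 1 - 1) * (- (2 * q) * H t) * H t +
  g t `^ (- s - 1) * dH t.
have d1 (t : R) : 0 <= t <= 1 -> is_derive t (1 : R) psi (dpsi t).
  move=> t01; have := is_derive1_powR_comp (- s) (g0' t t01) (dg t t01).
  move=> /is_derive_eq; apply; rewrite /dpsi.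
  rewrite (_ : - s * _ * _ = s * (2 * q) * (g t `^ (- s - 1) * H t)); last by ring.
  by rewrite sq mul1r.
have d2 (t : R) : 0 <= t <= 1 -> is_derive t (1 : R) dpsi (ddpsi t).
  move=> t01; exact: is_derive1M
    (is_derive1_powR_comp (- s - 1) (g0' t t01) (dg t t01)) (dHd t t01).
have dd0 (t : R) : 0 <= t <= 1 -> 0 <= ddpsi t.
  move=> t01; have [xt yt xyt] := xy t t01.
  (* Every power of [r k] is written as [e k] times a polynomial. After a power of [g] is factored
     out, the second derivative of [psi] is the expression of [discriminant_ge0]. *)
  pose e k := r k t `^ (- q - 1 - 1).
  have e0 k : 0 <= e k by exact: powR_ge0.
  have eE k : 1 <= k -> r k t `^ (- q - 1) = e k * r k t.
    move=> k1; have rk := r0 k t k1 t01.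
    by rewrite /e powRS.
  have eE2 k : 1 <= k -> quartic q k (x t) (y t) = e k * r k t ^+ 2.
    by move=> k1; rewrite wE// /w -/(r k t) eE// expr2 mulrA.
  have em k : 1 <= k -> e k <= e 1.
    move=> k1; rewrite /e -!opprD; apply: pow_mono => //; have := q0; lra.
  have GE : g t `^ (- s - 1) = g t `^ (- s - 1 - 1) * g t.
    have gt0 := g0' t t01.
    exact: (esym (powRS _ gt0)).
  have -> : ddpsi t = g t `^ (- s - 1 - 1) *
      ((2 * q + 1) * H t ^+ 2 + g t * dH t).
    rewrite /ddpsi GE (_ : (- s - 1) * _ * _ * _ =
       g t `^ (- s - 1 - 1) * ((s * (2 * q) + 2 * q) * H t ^+ 2)); last by ring.
    by rewrite sq; ring.
  rewrite mulr_ge0 ?powR_ge0//.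
  have := @discriminant_ge0 (x t) (y t) U V (e 1) (e k2) (e k3) (e0 _) (e0 _)
    (em _ k21) (e0 _) (em _ k31).
  rewrite /g /quartic_comb !eE2// /H /dH /hd !eE// -/(e 1) -/(e k2) -/(e k3).
  set z1 := (X in 0 <= X); set z2 := (X in _ -> 0 <= X).
  suff -> : z2 = z1 by [].
  by rewrite /z1 /z2 /sigma /rho /r; ring.
have := convex_tangent d1 d2 dd0.
have x1 : x 1 = X1 by rewrite /x /U; ring.
have y1 : y 1 = Y1 by rewrite /y /V; ring.
have x00 : x 0 = X0 by rewrite /x mul0r addr0.
have y00 : y 0 = Y0 by rewrite /y mul0r addr0.
have H0 : H 0 = A * U + B * V.
  by rewrite /H /rho /r x00 y00 -/(w 1 X0 Y0) -/(w k2 X0 Y0) -/(w k3 X0 Y0) /A /B; ring.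
rewrite /psi /dpsi /g x1 y1 x00 y00 -/g0 H0 => h; apply: le_trans h.
by rewrite -E0 le_eqVlt; apply/orP; left; apply/eqP; rewrite /U /V; ring.
Qed.

End SupportFunctional.

(** * Smoothness and symmetry *)

Section SmoothExpressions.
Variables (R : realType) (n : nat) (U : set 'rV[R]_n).
Local Notation V := 'rV[R]_n.

(** A syntactic class closed under partial derivatives on [U], so that smoothness of all orders
    reduces to differentiability of its members. Positivity under a power is asked only on [U]. *)
Inductive smooth_expr : (V -> R) -> Prop :=
| smooth_cst c : smooth_expr (fun=> c)
| smooth_coord j : smooth_expr (fun x => x 0 j)
| smooth_add f g : smooth_expr f -> smooth_expr g -> smooth_expr (fun x => f x + g x)
| smooth_mul f g : smooth_expr f -> smooth_expr g -> smooth_expr (fun x => f x * g x)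
| smooth_powR a f : smooth_expr f -> (forall x, U x -> 0 < f x) ->
    smooth_expr (fun x => f x `^ a).

Lemma smooth_expr_differentiable f x : smooth_expr f -> U x -> differentiable f x.
Proof.
move=> sf Ux; elim: sf => {f} [c|j|f g _ df _ dg|f g _ df _ dg|a f _ df f0].
- exact: differentiable_cst.
- exact: differentiable_coord.
- exact: differentiableD.
- exact: differentiableM.
- apply: (@differentiable_comp _ _ _ _ f (fun y => y `^ a)) => //.
  by apply/derivable1_diffP; have [] := is_derive1_powR a (f0 x Ux).
Qed.

Lemma smooth_expr_derivable f x v : smooth_expr f -> U x -> derivable f x v.
Proof. by move=> sf Ux; exact/diff_derivable/smooth_expr_differentiable. Qed.

Lemma derive_coord (j : 'I_n) (x v : V) : 'D_v (fun x : V => x 0 j) x = v 0 j.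
Proof.
pose f (x : V) : R := x 0 j.
have lf : linear f by move=> c y z; rewrite /f !mxE.
pose F : {linear V -> R} := HB.pack f (GRing.isLinear.Build _ _ _ _ f lf).
have cF : continuous F by exact: coord_continuous.
rewrite deriveE; last exact: differentiable_coord.
by rewrite -[fun y : V => y 0 j]/(F : V -> R) diff_lin.
Qed.

Lemma derive_powR_comp a (f : V -> R) x v : differentiable f x -> 0 < f x ->
  'D_v (fun x => f x `^ a) x = a * f x `^ (a - 1) * 'D_v f x.
Proof.
move=> df f0; have [dp Dp] := is_derive1_powR a f0.
have dp' : differentiable (fun y : R => y `^ a) (f x) by exact/derivable1_diffP.
rewrite (@deriveE _ _ _ (fun x => f x `^ a)); last first.
  exact: (@differentiable_comp _ _ _ _ f (fun y => y `^ a)).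
rewrite (_ : (fun x => f x `^ a) = (fun y : R => y `^ a) \o f)// diff_comp//=.
by rewrite diff1E// derive1E Dp -deriveE// /GRing.scale/= mulrC.
Qed.

Lemma smooth_expr_derive f (j : 'I_n) : smooth_expr f ->
  exists2 f', smooth_expr f' & forall x, U x -> 'D_(basis_vec R j) f x = f' x.
Proof.
elim=> {f} [c|i|f g sf [f' sf' ff'] sg [g' sg' gg']
  |f g sf [f' sf' ff'] sg [g' sg' gg']|a f sf [f' sf' ff'] f0].
- by exists (fun=> 0) => [|x _]; [exact: smooth_cst|exact: derive_cst].
- exists (fun=> basis_vec R j 0 i) => [|x _]; first exact: smooth_cst.
  exact: derive_coord.
- exists (fun x => f' x + g' x) => [|x Ux]; first exact: smooth_add.
  by rewrite -ff'// -gg'// -deriveD//; exact: smooth_expr_derivable.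
- exists (fun x => f x * g' x + g x * f' x) => [|x Ux].
    by apply: smooth_add; exact: smooth_mul.
  by rewrite -ff'// -gg'//; apply: deriveM; exact: smooth_expr_derivable.
- exists (fun x => a * f x `^ (a - 1) * f' x) => [|x Ux].
    apply: smooth_mul => //; apply: smooth_mul; first exact: smooth_cst.
    exact: smooth_powR.
  rewrite -ff'//; apply: derive_powR_comp; last exact: f0.
  exact: smooth_expr_differentiable.
Qed.

(** The partial derivative agrees with an expression of the class only on [U]; openness of [U] lets
    the next derivative be taken. *)
Lemma smooth_expr_partials f (s : seq 'I_n) : open U -> smooth_expr f ->
  exists2 f', smooth_expr f' & forall x, U x -> partials s f x = f' x.
Proof.
move=> oU sf; elim: s => [|j s [g sg fg]]; first by exists f.
have [g' sg' gg'] := smooth_expr_derive j sg; exists g' => // x Ux /=.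
rewrite -gg'//; apply: near_eq_derive.
by apply: filterS (open_nbhs_nbhs (conj oU Ux)) => y Uy; exact: fg.
Qed.

Lemma smooth_expr_Cinfty f : open U -> smooth_expr f -> Cinfty_on U f.
Proof.
move=> oU sf s x Ux; have [g sg fg] := smooth_expr_partials s oU sf.
have nU : nbhs x U by exact: open_nbhs_nbhs.
have gf : \forall y \near x, g y = partials s f y.
  by apply: filterS nU => y Uy; rewrite fg.
split=> [|j].
  have cg := differentiable_continuous (smooth_expr_differentiable sg Ux).
  have cgf : g y @[y --> x] --> partials s f x by rewrite (fg _ Ux).
  move=> A nA; have h : nbhs x (g @^-1` A) by exact: cgf.
  suff : nbhs x (partials s f @^-1` A) by [].
  by apply: filterS2 nU h => y Uy /=; rewrite fg.
by apply: near_eq_derivable gf _; exact: smooth_expr_derivable.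
Qed.

Lemma smooth_expr_continuous f : U = setT -> smooth_expr f -> continuous f.
Proof.
move=> UT sf x; apply: differentiable_continuous.
by apply: smooth_expr_differentiable => //; rewrite UT.
Qed.

Lemma smooth_sum (I : Type) (r : seq I) (P : pred I) (F : I -> V -> R) :
  (forall i, smooth_expr (F i)) -> smooth_expr (fun x => \sum_(i <- r | P i) F i x).
Proof.
move=> sF; elim: r => [|i r IH].
  by under eq_fun do rewrite big_nil; exact: smooth_cst.
under eq_fun do rewrite big_cons.
by case: (P i) => //; exact: smooth_add.
Qed.

Lemma smooth_fst_sq l : smooth_expr (@fst_sq R n l).
Proof. by apply: smooth_sum => j; apply: smooth_mul; exact: smooth_coord. Qed.

Lemma smooth_snd_sq l : smooth_expr (@snd_sq R n l).
Proof. by apply: smooth_sum => j; apply: smooth_mul; exact: smooth_coord. Qed.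

Lemma smooth_quartic l a c :
  (forall x, U x -> 0 < fst_sq l x ^+ 2 + c * snd_sq l x ^+ 2) ->
  smooth_expr (fun x => quartic a c (fst_sq l x) (snd_sq l x)).
Proof.
move=> pos; apply: smooth_powR => //.
have s1 := smooth_fst_sq l; have s2 := smooth_snd_sq l.
under eq_fun do rewrite !expr2.
apply: smooth_add; first exact: smooth_mul.
by apply: smooth_mul; [exact: smooth_cst|exact: smooth_mul].
Qed.

End SmoothExpressions.

(** * Invariance under block-orthogonal matrices *)

Section OrthogonalBlocks.
Variable R : realType.

Lemma orthogonal_sum_sq m (g : 'M[R]_m) (v : 'rV[R]_m) : orthogonal_group g ->
  \sum_j (v *m g^T) 0 j ^+ 2 = \sum_j v 0 j ^+ 2.
Proof.
move=> /= gg; have sq (w : 'rV[R]_m) : \sum_j w 0 j ^+ 2 = (w *m w^T) 0 0.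
  by rewrite mxE; apply: eq_bigr => j _; rewrite mxE expr2.
have ggT : g^T *m g = 1%:M by exact: mulmx1C.
by rewrite !sq trmx_mul trmxK mulmxA -(mulmxA v) ggT mulmx1.
Qed.

Lemma block_sum_sq p r n (e : (p + r)%N = n) (alpha : 'M[R]_p) (beta : 'M[R]_r)
    (x : 'rV[R]_n) :
  orthogonal_group alpha -> orthogonal_group beta ->
  let y := x *m (castmx (e, e) (block_mx alpha 0 0 beta))^T in
  \sum_(j < n | (j < p)%N) y 0 j * y 0 j = \sum_(j < n | (j < p)%N) x 0 j * x 0 j /\
  \sum_(j < n | ~~ (j < p)%N) y 0 j * y 0 j =
    \sum_(j < n | ~~ (j < p)%N) x 0 j * x 0 j.
Proof.
move=> oa ob; case: n / e x => x /=; rewrite castmx_id.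
have fst (z : 'rV[R]_(p + r)) : \sum_(j < p + r | (j < p)%N) z 0 j * z 0 j =
    \sum_j lsubmx z 0 j ^+ 2.
  rewrite big_mkcond big_split_ord/= [X in _ + X]big1 ?addr0 => [|j _].
    by apply: eq_bigr => j _; rewrite ltn_ord mxE expr2.
  by rewrite ltnNge leq_addr.
have snd (z : 'rV[R]_(p + r)) : \sum_(j < p + r | ~~ (j < p)%N) z 0 j * z 0 j =
    \sum_j rsubmx z 0 j ^+ 2.
  rewrite big_mkcond big_split_ord/= [X in X + _]big1 ?add0r => [|j _].
    by apply: eq_bigr => j _; rewrite ltnNge leq_addr mxE expr2.
  by rewrite ltn_ord.
rewrite !fst !snd tr_block_mx !trmx0 -[x]hsubmxK mul_row_block !mulmx0 addr0 add0r.
by rewrite !row_mxKl !row_mxKr !orthogonal_sum_sq.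
Qed.

Lemma K_group_sq n l (g : 'M[R]_n) x : K_group l g ->
  fst_sq l (x *m g^T) = fst_sq l x /\ snd_sq l (x *m g^T) = snd_sq l x.
Proof. by move=> [e [alpha [beta [oa ob ->]]]]; exact: block_sum_sq. Qed.

Lemma block_orthogonal p r n (e : (p + r)%N = n) (alpha : 'M[R]_p) (beta : 'M[R]_r) :
  orthogonal_group alpha -> orthogonal_group beta ->
  orthogonal_group (castmx (e, e) (block_mx alpha 0 0 beta)).
Proof.
move=> /= oa ob; case: n / e; rewrite /orthogonal_group/= castmx_id tr_block_mx mulmx_block.
by rewrite !trmx0 !mul0mx !mulmx0 !addr0 add0r oa ob -scalar_mx_block.
Qed.

Lemma K_group_orthogonal n l (g : 'M[R]_n) : K_group l g -> g *m g^T = 1%:M.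
Proof. by move=> [e [alpha [beta [oa ob ->]]]]; exact: block_orthogonal. Qed.

End OrthogonalBlocks.

(** * Geometry of the body *)

Section StarGeometry.
Variables (R : realType) (n l : nat) (q b1 b2 b3 k2 k3 K : R).
Hypotheses (q0 : 0 < q) (b1_gt0 : 0 < b1) (b2_ge0 : 0 <= b2) (b3_ge0 : 0 <= b3).
Hypotheses (k21 : 1 <= k2) (k2K : k2 <= K) (k31 : 1 <= k3) (k3K : k3 <= K).
Hypotheses (b3_small : 2 * K ^+ 2 * b3 <= b1)
  (b2_small : 4 * (2 * q + 1) * K ^+ 2 * b2 <= b1).
Local Notation V := 'rV[R]_n.
Local Notation X := (@fst_sq R n l).
Local Notation Y := (@snd_sq R n l).
Local Notation G := (quartic_comb q b1 b2 b3 k2 k3).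

Definition comb_body : set V := [set x | x = 0 \/ 1 <= G (X x) (Y x)].

Let G_gt0 := quartic_comb_gt0 q0 b1_gt0 b2_ge0 b3_ge0 k21 k2K k31 b3_small.

Let support := quartic_comb_support q0 b1_gt0 b2_ge0 b3_ge0 k21 k2K k31 k3K
  b3_small b2_small.

Let K1 : 1 <= K. Proof. exact: le_trans k2K. Qed.

Lemma sq_gt0 (x : V) : x != 0 -> 0 < X x + Y x.
Proof. by move=> x0; rewrite /fst_sq /snd_sq -dot_split dot_gt0. Qed.

Lemma sq0 : X 0 = 0 /\ Y 0 = 0.
Proof. by rewrite -(scale0r 0) fst_sqZ snd_sqZ expr0n/= !mul0r. Qed.

Lemma coord_sq_le (x : V) j : x 0 j ^+ 2 <= X x + Y x.
Proof.
rewrite /fst_sq /snd_sq -dot_split /dot (bigD1 j)//= -expr2 lerDl sumr_ge0// => i _.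
by rewrite -expr2 sqr_ge0.
Qed.

Let s : R := (2 * q)^-1.
Let s0 : 0 < s. Proof. by rewrite invr_gt0 mulr_gt0. Qed.

Lemma G_ge1 (x : V) : x != 0 -> (1 <= G (X x) (Y x)) = (G (X x) (Y x) `^ (- s) <= 1).
Proof.
move=> x0; have g0 := G_gt0 (fst_sq_ge0 l x) (snd_sq_ge0 l x) (sq_gt0 x0).
apply/idP/idP => [g1|]; first by apply: powR_le1n => //; exact: ltW.
apply: contraTT; rewrite -!ltNge => g1.
have := ltr_powRn s0 g0 g1; rewrite powR1//.
Qed.

Let is_support (ab : R * R) := [/\ 0 <= ab.1, 0 <= ab.2 &
  forall X1 Y1, 0 <= X1 -> 0 <= Y1 -> 0 < X1 + Y1 ->
    ab.1 * X1 + ab.2 * Y1 <= G X1 Y1 `^ (- s)].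

(** G >= 1 means G^(-s) <= 1, and G^(-s) is the maximum of its supporting functionals. Each set in
    the intersection is a closed sublevel set of a convex quadratic form, which yields closedness
    and convexity. *)
Lemma comb_bodyE : comb_body =
  \bigcap_(ab in [set ab | is_support ab]) [set x | ab.1 * X x + ab.2 * Y x <= 1].
Proof.
apply/seteqP; split => x /=.
  move=> Ax [a b] [/= a0 b0 ab].
  have [->|x0] := eqVneq x 0; first by have [-> ->] := sq0; rewrite !mulr0 addr0.
  case: Ax => [/eqP|]; first by rewrite (negbTE x0).
  rewrite G_ge1// => /(le_trans _); apply; apply: ab (sq_gt0 x0).
    exact: fst_sq_ge0.
  exact: snd_sq_ge0.
move=> h; have [->|x0] := eqVneq x 0; [by left|right].
have [a [b [a0 b0 E ab]]] := support (fst_sq_ge0 l x) (snd_sq_ge0 l x) (sq_gt0 x0).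
by rewrite G_ge1// -E; exact: (h (a, b)).
Qed.

Lemma comb_body_closed : closed comb_body.
Proof.
rewrite comb_bodyE; apply: closed_bigI => ab _.
rewrite (_ : [set x | _] =
    ~` ((fun x => ab.1 * X x + ab.2 * Y x) @^-1` [set y | 1 < y])); last first.
  by apply/seteqP; split => x /=; rewrite leNgt => /negP.
apply: open_closedC; apply: open_comp; last exact: open_gt.
move=> x _; apply: smooth_expr_continuous erefl _ _.
apply: smooth_add; apply: smooth_mul; try exact: smooth_cst.
  exact: smooth_fst_sq.
exact: smooth_snd_sq.
Qed.

Lemma comb_body_convex : convex_set comb_body.
Proof.
move=> x y t; rewrite !comb_bodyE !inE => Ax Ay ab Hab.
have ax := Ax ab Hab; have ay := Ay ab Hab; case: Hab => a0 b0 _.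
rewrite /= in ax ay *.
have p0 : 0 <= t%:num :> R by [].
have p1' : t%:num <= 1 :> R by [].
set p : R := t%:num in p0 p1' *.
have -> : conv t x y = p *: x + (1 - p) *: y by [].
have p1 : 0 <= 1 - p by rewrite subr_ge0.
have sqc (c d : R) : (p * c + (1 - p) * d) * (p * c + (1 - p) * d) <=
    p * (c * c) + (1 - p) * (d * d).
  rewrite -subr_ge0 (_ : _ - _ = p * (1 - p) * (c - d) ^+ 2); last by ring.
  by apply: mulr_ge0; [exact: mulr_ge0|exact: sqr_ge0].
have hX : X (p *: x + (1 - p) *: y) <= p * X x + (1 - p) * X y.
  rewrite /fst_sq /fst_dot !mulr_sumr -big_split/=; apply: ler_sum => j _.
  by rewrite !mxE.
have hY : Y (p *: x + (1 - p) *: y) <= p * Y x + (1 - p) * Y y.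
  rewrite /snd_sq /snd_dot !mulr_sumr -big_split/=; apply: ler_sum => j _.
  by rewrite !mxE.
have := ler_wpM2l a0 hX; have := ler_wpM2l b0 hY.
have := ler_wpM2l p0 ax; have := ler_wpM2l p1 ay.
by move: (X (_ + _)) (Y (_ + _)) => z w; lra.
Qed.

(** G is at most (b1 + b2) (X^2 + Y^2)^(-q), so G >= 1 bounds X^2 + Y^2. *)
Lemma comb_body_bounded : exists2 C : R, 0 <= C & forall x, comb_body x -> X x + Y x <= C.
Proof.
pose B := b1 + b2; have B0 : 0 < B by rewrite ltr_pwDl.
pose D := B `^ q^-1; have D0 : 0 <= D by exact: powR_ge0.
exists (1 + D) => [|x Ax]; first by lra.
have [->|x0] := eqVneq x 0; first by have [-> ->] := sq0; lra.
case: Ax => [/eqP|]; first by rewrite (negbTE x0).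
have X0 := fst_sq_ge0 l x; have Y0 := snd_sq_ge0 l x; have XY := sq_gt0 x0.
set u := X x in X0 XY *; set v := Y x in Y0 XY * => Gx.
have z0 : 0 < u ^+ 2 + 1 * v ^+ 2.
  have h : 0 < (u + v) ^+ 2 by rewrite exprn_gt0.
  by have := sqr_ge0 (u - v); nra.
have q1 : 1 <= B * quartic q 1 u v.
  apply: (le_trans Gx); rewrite /quartic_comb /B mulrDl.
  have h2 : quartic q k2 u v <= quartic q 1 u v by apply: quartic_le => //; exact: ltW.
  have h3 := quartic_ge0 q k3 u v.
  have := ler_wpM2l b2_ge0 h2; have := mulr_ge0 b3_ge0 h3; lra.
have zD : u ^+ 2 + 1 * v ^+ 2 <= D.
  have zq : (u ^+ 2 + 1 * v ^+ 2) `^ q <= B.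
    by move: q1; rewrite /quartic powRN ler_pdivlMr ?powR_gt0// [X in X <= _]mul1r.
  have -> : u ^+ 2 + 1 * v ^+ 2 = ((u ^+ 2 + 1 * v ^+ 2) `^ q) `^ q^-1.
    by rewrite -powRrM mulfV ?gt_eqF// powRr1// ltW.
  apply: ge0_ler_powR => //; first by rewrite invr_ge0 ltW.
    by rewrite nnegrE powR_ge0.
  by rewrite nnegrE ltW.
have := sqr_ge0 (u - v); have := sqr_ge0 (u - 1); have := sqr_ge0 (v - 1).
nra.
Qed.

Lemma comb_body_compact : compact comb_body.
Proof.
have [C C0 hC] := comb_body_bounded.
apply: (subclosed_compact comb_body_closed
  (rV_compact (fun=> @segment_compact R (- (1 + C)) (1 + C)))).
move=> x /hC xC j /=; rewrite in_itv/= -ler_norml.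
have := coord_sq_le x j => xj.
have h : x 0 j ^+ 2 <= (1 + C) ^+ 2 by nra.
have C1 : 0 <= 1 + C by lra.
by rewrite -sqrtr_sqr -[leRHS](ger0_norm C1) -[leRHS]sqrtr_sqr ler_wsqrtr.
Qed.

(** Since [b3 <= b1 / 2], G is at least (b1 / 2) (X^2 + Y^2)^(-q), which is at least 1 near the
    origin. *)
Lemma comb_body_interior : interior comb_body !=set0.
Proof.
pose B := b1 / 2; have B0 : 0 < B by rewrite divr_gt0.
pose D := B `^ (2 * q)^-1; have D0 : 0 < D by rewrite powR_gt0.
exists 0; rewrite /interior.
pose W := (fun x => X x + Y x) @^-1` [set y | y < D].
have oW : open W.
  apply: open_comp; last exact: open_lt.
  move=> x _; apply: smooth_expr_continuous erefl _ _.
  by apply: smooth_add; [exact: smooth_fst_sq|exact: smooth_snd_sq].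
have W0 : W 0 by rewrite /W/=; have [-> ->] := sq0; rewrite addr0.
apply: filterS (open_nbhs_nbhs (conj oW W0)) => x; rewrite /W/= => xD.
have [->|x0] := eqVneq x 0; [by left|right].
have X0 := fst_sq_ge0 l x; have Y0 := snd_sq_ge0 l x; have XY := sq_gt0 x0.
move: (X x) (Y x) X0 Y0 XY xD => u v u0 v0 uv uD.
have z0 : 0 < u ^+ 2 + 1 * v ^+ 2.
  have h : 0 < (u + v) ^+ 2 by rewrite exprn_gt0.
  by have := sqr_ge0 (u - v); nra.
have zD : u ^+ 2 + 1 * v ^+ 2 <= D ^+ 2 by nra.
have q1 : 1 <= B * quartic q 1 u v.
  have := ge0_ler_powRn (ltW q0) z0 zD.
  rewrite -(powR_mulrn 2 (ltW D0)) /D -!powRrM.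
  rewrite (_ : (2 * q)^-1 * (2%:R * - q) = -1); last by field; rewrite gt_eqF.
  rewrite (powR_inv1 (ltW B0)) => /(ler_wpM2l (ltW B0)).
  by rewrite mulfV// gt_eqF.
apply: (le_trans q1); rewrite /quartic_comb.
have h3 : quartic q k3 u v <= quartic q 1 u v by apply: quartic_le => //; exact: ltW.
have h2 := quartic_ge0 q k2 u v.
have b3h : b3 <= b1 / 2.
  have K2 : 1 <= K ^+ 2 by rewrite exprn_ege1// K1.
  have := ler_wpM2r b3_ge0 K2; have := b3_small; rewrite ler_pdivlMr//; lra.
have h1 := quartic_ge0 q 1 u v.
have := ler_pM b3_ge0 (quartic_ge0 q k3 u v) b3h h3; have := mulr_ge0 b2_ge0 h2.
by rewrite /B; lra.
Qed.

Lemma comb_body_convex_body : convex_body comb_body.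
Proof.
by split; [exact: comb_body_compact|exact: comb_body_convex|exact: comb_body_interior].
Qed.

Lemma comb_body_symmetric : origin_symmetric comb_body.
Proof.
have oppA x : comb_body x -> comb_body (- x).
  rewrite /comb_body/= -scaleN1r fst_sqZ snd_sqZ sqrrN expr1n !mul1r.
  by case=> [->|]; [left; rewrite scaler0|right].
apply/seteqP; split => [_ [x Ax <-]|x Ax]; first exact: oppA.
by exists (- x); [exact: oppA|rewrite opprK].
Qed.

Lemma comb_body_K_symmetric : K_symmetric l comb_body.
Proof.
move=> g Kg; have ggT := K_group_orthogonal Kg.
have gTg : g^T *m g = 1%:M by exact: mulmx1C.
apply/seteqP; split => [_ [x Ax <-]|y Ay].
  have [EX EY] := K_group_sq x Kg; rewrite /comb_body/= EX EY.
  by case: Ax => [->|]; [left; rewrite mul0mx|right].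
have yE : y *m g *m g^T = y by rewrite -mulmxA ggT mulmx1.
exists (y *m g) => //; have [EX EY] := K_group_sq (y *m g) Kg.
rewrite yE in EX EY; rewrite /comb_body/= -EX -EY.
by case: Ay => [->|]; [left; rewrite mul0mx|right].
Qed.

Lemma G_homogeneous (r u v : R) : 0 < r -> G (r * u) (r * v) = r `^ (- (2 * q)) * G u v.
Proof.
move=> r0; have k20 : 0 <= k2 := le_trans ler01 k21.
have k30 : 0 <= k3 := le_trans ler01 k31.
by rewrite /quartic_comb !quarticZ//; ring.
Qed.

(** Replacing x by r x multiplies G by r^(-4q), so r x lies in the body exactly for r up to
    G^(1/(4q)). *)
Lemma comb_body_radial (x : V) : x != 0 ->
  radial comb_body x = G (X x) (Y x) `^ (4 * q)^-1.
Proof.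
move=> x0; have g0 := G_gt0 (fst_sq_ge0 l x) (snd_sq_ge0 l x) (sq_gt0 x0).
set m := _ `^ _; have m0 : 0 < m by rewrite powR_gt0.
have mG : m `^ (4 * q) = G (X x) (Y x).
  by rewrite /m -powRrM mulVf ?powRr1 ?(ltW g0)// mulf_neq0// gt_eqF.
rewrite /radial (_ : [set r | _] = `[0, m]%classic); last first.
  apply/seteqP; split => r /=; rewrite in_itv/=.
    move=> [r0]; rewrite r0/=; have [-> _|rn0] := eqVneq r 0; first exact: ltW.
    have {}r0 : 0 < r by rewrite lt_neqAle eq_sym rn0.
    case=> [/eqP|]; first by rewrite scaler_eq0 (negbTE x0) (negbTE rn0).
    have rr : 0 < r ^+ 2 by rewrite exprn_gt0.
    rewrite fst_sqZ snd_sqZ G_homogeneous// -mG powRN -(powR_mulrn 2 (ltW r0)) -powRrM.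
    rewrite (_ : 2%:R * (2 * q) = 4 * q); last by ring.
    rewrite mulrC ler_pdivlMr ?powR_gt0// mul1r => rm.
    rewrite leNgt; apply/negP => mr; move: rm; rewrite leNgt => /negP; apply.
    by apply: gt0_ltr_powR; rewrite ?nnegrE ?mulr_gt0// ltW.
  move=> /andP[r0 rm]; split => //; have [->|rn0] := eqVneq r 0.
    by left; rewrite scale0r.
  have {}r0 : 0 < r by rewrite lt_neqAle eq_sym rn0.
  right; have rr : 0 < r ^+ 2 by rewrite exprn_gt0.
  rewrite fst_sqZ snd_sqZ G_homogeneous// -mG powRN -(powR_mulrn 2 (ltW r0)) -powRrM.
  rewrite (_ : 2%:R * (2 * q) = 4 * q); last by ring.
  rewrite mulrC ler_pdivlMr ?powR_gt0// mul1r.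
  have q4 : 0 <= 4 * q by rewrite mulr_ge0// ltW.
  by apply: ge0_ler_powR => //; rewrite nnegrE; exact: ltW.
by rewrite sup_itv// ?bnd_simp ltW.
Qed.

Lemma comb_body_smooth : infinitely_smooth comb_body.
Proof.
split; first exact: comb_body_symmetric.
move=> p Sp; pose U := [set x : V | 0 < X x + Y x].
have oU : open U.
  rewrite (_ : U = (fun x => X x + Y x) @^-1` [set y | 0 < y])//.
  apply: open_comp; last exact: open_gt.
  move=> x _; apply: smooth_expr_continuous erefl _ _.
  by apply: smooth_add; [exact: smooth_fst_sq|exact: smooth_snd_sq].
have US x : unit_sphere x -> U x.
  move=> Sx; apply: sq_gt0; apply/eqP => x0; move: Sx; rewrite /unit_sphere/= /enorm x0.
  rewrite big1 ?sqrtr0; first by move=> /eqP; rewrite eq_sym oner_eq0.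
  by move=> j _; rewrite mxE expr0n.
exists U, (fun x => G (X x) (Y x) `^ (4 * q)^-1); split => //; first exact: US.
  apply: smooth_expr_Cinfty => //; apply: smooth_powR; last first.
    by move=> x Ux; apply: G_gt0 => //; [exact: fst_sq_ge0|exact: snd_sq_ge0].
  have sq k : 1 <= k -> smooth_expr U (fun x => quartic q k (X x) (Y x)).
    move=> k1; apply: smooth_quartic => x; rewrite /U/=.
    have := fst_sq_ge0 l x; have := snd_sq_ge0 l x.
    move: (X x) (Y x) => u v v0 u0 uv.
    have h : 0 < (u + v) ^+ 2 by rewrite exprn_gt0.
    have h2 : 0 <= (k - 1) * v ^+ 2 by rewrite mulr_ge0 ?sqr_ge0// subr_ge0.
    by have := sqr_ge0 (u - v); nra.
  rewrite (_ : (fun x => G (X x) (Y x)) = (fun x => b1 * quartic q 1 (X x) (Y x) +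
     b2 * quartic q k2 (X x) (Y x) + (- b3) * quartic q k3 (X x) (Y x))); last first.
    by apply/funext => x; rewrite mulNr.
  apply: smooth_add; last by apply: smooth_mul; [exact: smooth_cst|exact: sq].
  by apply: smooth_add; apply: smooth_mul; [exact: smooth_cst|exact: sq|exact: smooth_cst|exact: sq].
move=> x Ux _; rewrite comb_body_radial//; apply/eqP => x0.
by move: Ux; rewrite /U/= x0; have [-> ->] := sq0; rewrite addr0 ltxx.
Qed.

End StarGeometry.

(** * Choice of parameters and conclusion *)

Section Assembly.
Variable R : realType.
Local Notation T := (measurableTypeR R).

Lemma vol_B4_lt_star_body (k l i : nat) (eta g : R) : (l <= k)%N -> (0 < i)%N -> (i <= k.+1)%N ->
  star_admissible l eta g -> 0 < eta ->
  let q : R := i%:R / 4 in let K := kernel_integral k l ((k.+2 - i)%:R / 4) q in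
  (forall tau, exists2 v, K tau = v%:E & 0 <= v) ->
  (g%:E * K 1%R + (1 - g)%:E * K g < K (tmid g))%E ->
  (vol (B4 R k.+2 l) < vol (star_body l q eta g : set 'rV[R]_k.+2))%E.
Proof.
move=> lk i0 ik adm eta0 q K Kfin gap; have [g0 g1 _ _] := adm.
have := lebesgue_star_gt lk i0 ik adm eta0 Kfin gap; rewrite -/q.
pose u (t : k.+2.-tuple T) := star q l eta g (vfst l t) (vsnd l t).
have mX := @measurable_vfst R k l; have mY := @measurable_vsnd R k l.
have mu : measurable_fun setT u.
  apply: measurable_funB; last by apply: measurable_funM => //; exact: measurable_quartic.
  by apply: measurable_funD; apply: measurable_funM => //; exact: measurable_quartic.
pose A0 := [set t : k.+2.-tuple T | vfst l t + vsnd l t <= 0].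
have mA0 : measurable A0 by apply: measurable_set_ler => //; exact: measurable_funD.
pose A1 := [set t : k.+2.-tuple T | 1 <= u t].
have mA1 : measurable A1 by exact: measurable_set_ler.
have mA : measurable (A0 `|` A1) by exact: measurableU.
have AE : [set t | (star_body l q eta g : set 'rV[R]_k.+2) (\row_j tnth t j)] = A0 `|` A1.
  apply/seteqP; split => t /=; case=> [h|h]; [left| |left|]; try by right.
    by rewrite /A0/= /vfst /vsnd /row_of_tuple h; have [-> ->] := sq0 R k.+2 l; rewrite addr0.
  apply/eqP; apply: contraLR h => h; rewrite /A0/= -ltNge; exact: sq_gt0.
have BE : [set t | B4 R k.+2 l (\row_j tnth t j)] =
    [set t | vfst l t ^+ 2 + vsnd l t ^+ 2 <= 1].
  by apply/seteqP; split => t; rewrite /= B4E.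
move=> lt; rewrite /vol AE BE; apply: (lt_le_trans lt).
apply: le_measure.
- by rewrite inE; exact: mA1.
- by rewrite inE; exact: mA.
- by move=> t h; right.
Qed.

End Assembly.

Theorem theorem1p2 (R : realType) (n l i : nat)
    (hl : (1 <= l)%N) (hli : (l + 2 < i)%N) (hin : (i <= n - 1)%N) :
  exists A : set 'rV[R]_n,
    [/\ convex_body A, infinitely_smooth A, K_symmetric l A,
        (forall xi : {vspace 'rV[R]_n}, \dim xi = i ->
           (vol_in xi (A `&` [set` xi]) <= vol_in xi (B4 R n l `&` [set` xi]))%E) &
        (vol (B4 R n l) < vol A)%E].
Proof.
have i0 : (0 < i)%N by apply: leq_ltn_trans hli.
case: n hin => [|[|k]]; rewrite ?subn0 ?subnn ?subn1/= => hin;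
  try by move: (leq_trans i0 hin).
have lk : (l <= k)%N.
  by have := leq_trans hli hin; rewrite addn2 !ltnS; apply: leq_trans; rewrite leqW.
have li : (l + 2 <= i)%N by exact: ltnW.
have ln : (l <= k.+2)%N by rewrite (leq_trans lk)// leqW.
pose q : R := i%:R / 4; have q0 : 0 < q by rewrite divr_gt0// ltr0n.
pose a : R := (k.+2 - i)%:R / 4.
have a0 : 0 < a by rewrite divr_gt0// ltr0n subn_gt0 ltnS.
(* With [q = i / 4] this is exactly i >= l + 3, that is, the strict inequality l + 2 < i. *)
have lq : (2 * l%:R + 1) / 8 + 5 / 8 <= q.
  have : l%:R + 3 <= i%:R :> R by rewrite -natrD ler_nat addn3 -addn2.
  by rewrite /q; lra.
have [g [g0 g1 gap]] := kernel_gap hl lk a0 lq.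
have t0 := tmid_gt0 g0 g1.
have t1 : tmid g <= 1 by rewrite /tmid; nra.
have tg : g <= tmid g by rewrite /tmid; nra.
(* A common upper bound for the constants [tmid g ^- 2] and [g ^- 2], as [g <= tmid g]. *)
pose K := g ^- 2.
have g20 : 0 < g ^+ 2 by rewrite exprn_gt0.
have t20 : 0 < tmid g ^+ 2 by rewrite exprn_gt0.
have k21 : 1 <= tmid g ^- 2 by rewrite invf_ge1// exprn_ile1// ltW.
have k31 : 1 <= g ^- 2 by rewrite invf_ge1// exprn_ile1// ltW.
have k2K : tmid g ^- 2 <= K.
  by rewrite lef_pV2 ?posrE// ler_sqr ?nnegrE// ltW.
pose s2 := Num.sqrt (tmid g) ^- l; pose s3 := (1 - g) * Num.sqrt g ^- l.
have s20 : 0 <= s2 by rewrite invr_ge0 exprn_ge0// sqrtr_ge0.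
have s30 : 0 <= s3.
  by rewrite mulr_ge0 ?subr_ge0 ?(ltW g1)// invr_ge0 exprn_ge0// sqrtr_ge0.
have K0 : 0 <= K ^+ 2 by exact: sqr_ge0.
pose c2 := 4 * (2 * q + 1) * K ^+ 2 * s2; pose c3 := 2 * K ^+ 2 * s3.
have c20 : 0 <= c2.
  by rewrite mulr_ge0// mulr_ge0// mulr_ge0//; lra.
have c30 : 0 <= c3 by rewrite mulr_ge0// mulr_ge0.
(* The two smallness conditions read [eta * c2 <= 1 - eta * g] and [eta * c3 <= 1 - eta * g]; both
   hold because [eta * (g + c2 + c3) < 1]. *)
pose eta := (1 + g + c2 + c3)^-1.
have den0 : 0 < 1 + g + c2 + c3 by lra.
have eta0 : 0 < eta by rewrite invr_gt0.
have etaE : eta * (1 + g + c2 + c3) = 1 by rewrite mulVf// gt_eqF.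
have b2_small : 4 * (2 * q + 1) * K ^+ 2 * (eta * s2) <= 1 - eta * g.
  have -> : 4 * (2 * q + 1) * K ^+ 2 * (eta * s2) = eta * c2 by rewrite /c2; ring.
  by have := mulr_ge0 (ltW eta0) c30; nra.
have b3_small : 2 * K ^+ 2 * (eta * (1 - g) * Num.sqrt g ^- l) <= 1 - eta * g.
  have -> : 2 * K ^+ 2 * (eta * (1 - g) * Num.sqrt g ^- l) = eta * c3.
    by rewrite /c3 /s3; ring.
  by have := mulr_ge0 (ltW eta0) c20; nra.
have b1_gt0 : 0 < 1 - eta * g.
  have := mulr_ge0 (ltW eta0) c20; have := mulr_ge0 (ltW eta0) c30; nra.
have b20 : 0 <= eta * s2 by rewrite mulr_ge0// ltW.
have b30 : 0 <= eta * (1 - g) * Num.sqrt g ^- l.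
  by rewrite -mulrA mulr_ge0// ltW.
have adm : star_admissible l eta g.
  split => //; first exact: ltW.
  have K1 : 1 <= K ^+ 2 by rewrite exprn_ege1.
  by have := ler_wpM2r b30 K1; lra.
have bodyE : star_body l q eta g = comb_body l q (1 - eta * g) (eta * s2)
    (eta * (1 - g) * Num.sqrt g ^- l) (tmid g ^- 2) (g ^- 2) :> set 'rV[R]_k.+2.
  by [].
exists (star_body l q eta g); split.
- rewrite bodyE.
  exact: (@comb_body_convex_body R k.+2 l _ _ _ _ _ _ _ q0 b1_gt0 b20 b30 k21 k2K k31
    (lexx K) b3_small b2_small).
- rewrite bodyE.
  exact: (@comb_body_smooth R k.+2 l _ _ _ _ _ _ _ q0 b1_gt0 b20 b30 k21 k2K k31 b3_small).
- by rewrite bodyE; exact: comb_body_K_symmetric.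
- by move=> xi dxi; exact: star_body_section_le.
- apply: (vol_B4_lt_star_body lk i0 _ adm eta0 _ gap) => //.
  exact: kernel_integral_fin.
Qed.
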